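(* (a) Let $(B,\diamond,\nu)$ be a finite-dimensional Zinbiel bialgebra and $(D=\oplus_{i\in\mathbb Z}D_i,\dashv,\vdash,\omega)$ a quadratic $\mathbb Z$-graded diassociative algebra. Equip $D\otimes B=\oplus_i(D_i\otimes B)$ with the product $(d_1\otimes b_1)\cdot(d_2\otimes b_2)=(d_1\vdash d_2)\otimes(b_1\diamond b_2)+(d_1\dashv d_2)\otimes(b_2\diamond b_1)$ and define $\Delta:D\otimes B\to(D\otimes B)\,\hat\otimes\,(D\otimes B)$ by $$\Delta(d\otimes b)=\theta_{\vdash,\omega}(d)\bullet\nu(b)+\theta_{\dashv,\omega}(d)\bullet\tau(\nu(b)).$$ Then $(D\otimes B,\cdot,\Delta)$ is a completed ASI bialgebra. (b) Let $(D,\dashv,\vdash,\omega)$ be the quadratic $\mathbb Z$-graded diassociative algebra $D=\{f_1\partial_1+f_2\partial_2\mid f_1,f_2\in\Bbbk[t,t^{-1}]\}$ with $t^i\partial_m\dashv t^j\partial_n=t^{i+j+\delta_{1,n}}\partial_m$, $t^i\partial_m\vdash t^j\partial_n=t^{i+j+\delta_{1,m}}\partial_n$ ($i,j\in\mathbb Z$, $m,n\in\{1,2\}$), $D_i=\mathrm{span}\{t^{i-1}\partial_1,t^i\partial_2\}$, and the skew-symmetric form $\omega(t^i\partial_1,t^j\partial_2)=\delta_{i+j,0}$, $\omega(t^i\partial_1,t^j\partial_1)=\omega(t^i\partial_2,t^j\partial_2)=0$. Let $B$ be a finite-dimensional vector space with a bilinear operation $\diamond$ and a linear map $\nu:B\to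 B\otimes B$, and define $\cdot$ and $\Delta$ on $D\otimes B$ by the formulas in (a). Then $(D\otimes B,\cdot,\Delta)$ is a completed ASI bialgebra if and only if $(B,\diamond,\nu)$ is a Zinbiel bialgebra.
   Context: $\Bbbk$ is a field of characteristic zero; $\tau(x\otimes y)=y\otimes x$; $(d'\otimes d'')\bullet(b'\otimes b''):=(d'\otimes b')\otimes(d''\otimes b'')$, extended bilinearly and to formal infinite sums. Completed tensor product: for $\mathbb Z$-graded spaces $U=\oplus U_i$, $V=\oplus V_j$, $U\,\hat\otimes\,V:=\prod_{i,j}U_i\otimes V_j$ (formal infinite sums); similarly for several factors. Linear maps $f\,\hat\otimes\,g$ and the twist $\hat\tau$ act termwise on formal sums. Zinbiel algebra $(B,\diamond)$: $b_1\diamond(b_2\diamond b_3)=(b_1\diamond b_2)\diamond b_3+(b_2\diamond b_1)\diamond b_3$. Zinbiel coalgebra $(B,\nu)$: $\nu:B\to B\otimes B$ with $(\mathrm{id}\otimes\nu)\nu=(\nu\otimes\mathrm{id})\nu+(\tau\otimes\mathrm{id})(\nu\otimes\mathrm{id})\nu$. With $\bar{\mathbf l}_B(b)(x)=b\diamond x$, $\bar{\mathbf r}_B(b)(x)=x\diamond b$, a Zinbiel bialgebra $(B,\diamond,\nu)$ is a Zinbiel algebra and a Zinbiel coalgebra such that for all $b_1,b_2\in B$: $\nu(b_1\diamond b_2)+\nu(b_2\diamond b_1)=(\mathrm{id}\otimes(\bar{\mathbf l}_B+\bar{\mathbf r}_B)(b_2))\nu(b_1)+(\bar{\mathbf l}_B(b_1)\otimes\mathrm{id})\nu(b_2)$,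 $\nu(b_1\diamond b_2)+\tau\nu(b_1\diamond b_2)=(\mathrm{id}\otimes\bar{\mathbf r}_B(b_2))\nu(b_1)+(\bar{\mathbf l}_B(b_1)\otimes\mathrm{id})(\nu(b_2)+\tau\nu(b_2))$. Diassociative algebra $(D,\dashv,\vdash)$: two associative bilinear products with $(d_1\dashv d_2)\dashv d_3=d_1\dashv(d_2\vdash d_3)$, $(d_1\vdash d_2)\dashv d_3=d_1\vdash(d_2\dashv d_3)$, $(d_1\dashv d_2)\vdash d_3=(d_1\vdash d_2)\vdash d_3$. A $\mathbb Z$-graded (di)associative algebra is one with a decomposition $D=\oplus_{i\in\mathbb Z}D_i$ into finite-dimensional subspaces such that every product maps $D_i\otimes D_j$ into $D_{i+j}$. A quadratic $\mathbb Z$-graded diassociative algebra $(D,\dashv,\vdash,\omega)$ carries a skew-symmetric nondegenerate bilinear form $\omega$ that is graded (there is $m\in\mathbb Z$ with $\omega(D_i,D_j)=0$ whenever $i+j+m\neq0$) and invariant: $\omega(d_1\vdash d_2,d_3)=\omega(d_1,d_2\vdash d_3-d_2\dashv d_3)$ and $\omega(d_1\dashv d_2,d_3)=\omega(d_1,d_2\vdash d_3)$. The maps $\theta_{\dashv,\omega},\theta_{\vdash,\omega}:D\to D\,\hat\otimes\,D$ are defined by $\hat\omega(\theta_{\dashv,\omega}(d_1),d_2\otimes d_3)=\omega(d_1,d_2\dashv d_3)$ and $\hat\omega(\theta_{\vdash,\omega}(d_1),d_2\otimes d_3)=\omega(d_1,d_2\vdash d_3)$, where $\hat\omega(\sum x\otimes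 x',y\otimes y')=\sum\omega(x,y)\omega(x',y')$. Completed ASI bialgebra $(A,\cdot,\Delta)$: $(A=\oplus_iA_i,\cdot)$ is a $\mathbb Z$-graded associative algebra, $\Delta:A\to A\,\hat\otimes\,A$ is linear with $(\Delta\,\hat\otimes\,\mathrm{id})\Delta=(\mathrm{id}\,\hat\otimes\,\Delta)\Delta$, and with $\mathbf l_A(a)(x)=a\cdot x$, $\mathbf r_A(a)(x)=x\cdot a$, for all $a_1,a_2\in A$: $\Delta(a_1\cdot a_2)=(\mathbf r_A(a_2)\,\hat\otimes\,\mathrm{id})\Delta(a_1)+(\mathrm{id}\,\hat\otimes\,\mathbf l_A(a_1))\Delta(a_2)$ and $(\mathbf l_A(a_1)\,\hat\otimes\,\mathrm{id}-\mathrm{id}\,\hat\otimes\,\mathbf r_A(a_1))\Delta(a_2)=\hat\tau\big((\mathrm{id}\,\hat\otimes\,\mathbf r_A(a_2)-\mathbf l_A(a_2)\,\hat\otimes\,\mathrm{id})\Delta(a_1)\big)$. *)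

(* Defs.v *)
From HB Require Import structures.
From mathcomp Require Import all_boot all_order all_algebra.
From mathcomp Require Import generic_quotient.
From mathcomp Require Import boolp classical_sets functions cardinality fsbigop.
From mathcomp Require Import finmap monalg ring.

Set Implicit Arguments.
Unset Strict Implicit.
Unset Printing Implicit Defensive.

Import GRing.Theory.
Local Open Scope ring_scope.
Local Open Scope classical_set_scope.
Local Open Scope quotient_scope.

(* The tensor product of two (possibly infinite-dimensional) vector spaces:   *)
(* finite formal sums u_1 (x) v_1 + ... + u_n (x) v_n, represented by the     *)
(* sequence of pairs (u_i, v_i), modulo the congruence generated by           *)
(* bilinearity.                                                               *)
Section TensorProduct.
Variables (k : fieldType) (U V : lmodType k).

Inductive tens_cong : seq (U * V) -> seq (U * V) -> Prop :=
| tcong_refl s : tens_cong s s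
| tcong_sym s t : tens_cong s t -> tens_cong t s
| tcong_trans s t r : tens_cong s t -> tens_cong t r -> tens_cong s r
| tcong_cat s s' t t' :
    tens_cong s s' -> tens_cong t t' -> tens_cong (s ++ t) (s' ++ t')
| tcong_comm s t : tens_cong (s ++ t) (t ++ s)
| tcong_0 v : tens_cong [:: (0, v)] [::]
| tcong_addl u u' v : tens_cong [:: (u + u', v)] [:: (u, v); (u', v)]
| tcong_addr u v v' : tens_cong [:: (u, v + v')] [:: (u, v); (u, v')]
| tcong_scale a u v : tens_cong [:: (a *: u, v)] [:: (u, a *: v)].

Definition tens_congb (s t : seq (U * V)) : bool := `[< tens_cong s t >].

Lemma tens_congb_refl : reflexive tens_congb.
Proof. by move=> s; apply/asboolP/tcong_refl. Qed.

Lemma tens_congb_sym : symmetric tens_congb.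
Proof. by move=> s t; apply/asboolP/asboolP => /tcong_sym. Qed.

Lemma tens_congb_trans : transitive tens_congb.
Proof.
move=> s t r /asboolP h1 /asboolP h2; apply/asboolP; exact: tcong_trans h1 h2.
Qed.

Definition tens_equiv :=
  EquivRel tens_congb tens_congb_refl tens_congb_sym tens_congb_trans.

Definition tens : Type := {eq_quot tens_equiv}.

HB.instance Definition _ := Choice.on tens.
HB.instance Definition _ := EqQuotient.on tens.

Implicit Types x y z : tens.

Definition tclass (s : seq (U * V)) : tens := \pi_tens s.

Definition pure (u : U) (v : V) : tens := tclass [:: (u, v)].

Lemma tclassP s t : tclass s = tclass t <-> tens_cong s t.
Proof.
split; first by move/eqmodP/asboolP.
by move=> h; apply/eqmodP/asboolP.
Qed.

Lemma tclassK x : tclass (repr x) = x. Proof. exact: reprK. Qed.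

Lemma repr_tclass s : tens_cong (repr (tclass s)) s.
Proof. by apply/tclassP; rewrite tclassK. Qed.

Definition tens_add x y : tens := tclass (repr x ++ repr y).
Definition tens_scale a x : tens :=
  tclass [seq (a *: p.1, p.2) | p <- repr x].

Lemma tens_addE s t : tens_add (tclass s) (tclass t) = tclass (s ++ t).
Proof. by apply/tclassP/tcong_cat; exact: repr_tclass. Qed.

Lemma tcong_map a s t : tens_cong s t ->
  tens_cong [seq (a *: p.1, p.2) | p <- s] [seq (a *: p.1, p.2) | p <- t].
Proof.
elim=> {s t} /=.
- by move=> s; exact: tcong_refl.
- by move=> s t _; exact: tcong_sym.
- by move=> s t r _ h1 _ h2; exact: tcong_trans h1 h2.
- by move=> s s' t t' _ h1 _ h2; rewrite !map_cat; exact: tcong_cat.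
- by move=> s t; rewrite !map_cat; exact: tcong_comm.
- by move=> v; rewrite scaler0; exact: tcong_0.
- by move=> u u' v; rewrite scalerDr; exact: tcong_addl.
- by move=> u v v'; exact: tcong_addr.
- move=> b u v; rewrite scalerA mulrC -scalerA; exact: tcong_scale.
Qed.

Lemma tens_scaleE a s :
  tens_scale a (tclass s) = tclass [seq (a *: p.1, p.2) | p <- s].
Proof. by apply/tclassP/tcong_map/repr_tclass. Qed.

Lemma tens_addA : associative tens_add.
Proof.
move=> x y z; rewrite -(tclassK x) -(tclassK y) -(tclassK z).
by rewrite !tens_addE catA.
Qed.

Lemma tens_addC : commutative tens_add.
Proof. by move=> x y; apply/tclassP/tcong_comm. Qed.

Lemma tens_add0 : left_id (tclass [::]) tens_add.
Proof. by move=> x; rewrite -{1}(tclassK x) tens_addE /= tclassK. Qed.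

Lemma tens_addN : left_inverse (tclass [::]) (tens_scale (-1)) tens_add.
Proof.
move=> x; rewrite -(tclassK x) tens_scaleE tens_addE; apply/tclassP.
elim: (repr x) => [|[u v] s IHs] /=; first exact: tcong_refl.
rewrite -cat1s -[(u, v) :: s]cat1s catA.
apply: tcong_trans (IHs); rewrite -[X in tens_cong _ X]cat0s.
apply: (tcong_trans (t := [:: (-1 *: u, v); (u, v)] ++
                          ([seq (-1 *: p.1, p.2) | p <- s] ++ s))).
  rewrite -[[:: (-1 *: u, v); _]]/([:: (-1 *: u, v)] ++ [:: (u, v)]).
  rewrite -!catA; apply: tcong_cat; first exact: tcong_refl.
  rewrite !catA; apply: tcong_cat; [exact: tcong_comm | exact: tcong_refl].
apply: tcong_cat; last exact: tcong_refl.
apply: tcong_trans (tcong_0 v); apply: tcong_sym.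
by rewrite -(addNr u) -scaleN1r; exact: tcong_addl.
Qed.

HB.instance Definition _ :=
  GRing.isZmodule.Build tens tens_addA tens_addC tens_add0 tens_addN.

Lemma tclass_cat s t : tclass (s ++ t) = tclass s + tclass t.
Proof. by rewrite -tens_addE. Qed.

Lemma tclassE s : tclass s = \sum_(p <- s) pure p.1 p.2.
Proof.
elim: s => [|[u v] s IHs]; first by rewrite big_nil.
by rewrite big_cons -IHs -cat1s tclass_cat.
Qed.

Lemma tens_scaleA a b x : tens_scale a (tens_scale b x) = tens_scale (a * b) x.
Proof.
rewrite -(tclassK x) !tens_scaleE -map_comp; congr tclass.
by apply: eq_map => p /=; rewrite scalerA.
Qed.

Lemma tens_scale1 : left_id 1 tens_scale.
Proof.
move=> x; rewrite -{1}(tclassK x) tens_scaleE -[RHS]tclassK; congr tclass.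
by rewrite -[RHS]map_id; apply: eq_map => -[u v] /=; rewrite scale1r.
Qed.

Lemma tens_scaleDr : right_distributive tens_scale +%R.
Proof.
move=> a x y; rewrite -(tclassK x) -(tclassK y) -tclass_cat !tens_scaleE.
by rewrite map_cat tclass_cat.
Qed.

Lemma pureDl u u' v : pure (u + u') v = pure u v + pure u' v.
Proof. by rewrite -tclass_cat; apply/tclassP/tcong_addl. Qed.

Lemma pureDr u v v' : pure u (v + v') = pure u v + pure u v'.
Proof. by rewrite -tclass_cat; apply/tclassP/tcong_addr. Qed.

Lemma tens_scaleDl x : {morph tens_scale^~ x : a b / a + b}.
Proof.
move=> a b; rewrite -(tclassK x) !tens_scaleE !tclassE !big_map -big_split /=.
by apply: eq_bigr => p _; rewrite scalerDl pureDl.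
Qed.

HB.instance Definition _ := GRing.Zmodule_isLmodule.Build k tens
  tens_scaleA tens_scale1 tens_scaleDr tens_scaleDl.

Lemma pureZl a u v : pure (a *: u) v = a *: pure u v.
Proof. by rewrite [RHS]tens_scaleE. Qed.

Lemma pureZr a u v : pure u (a *: v) = a *: pure u v.
Proof. by rewrite -pureZl; apply/esym/tclassP/tcong_scale. Qed.

Lemma pure_bilinear : bilinear_for *:%R *:%R pure.
Proof.
by split=> [v a u u'|u a v v'];
  rewrite ?(pureDl, pureDr) ?(pureZl, pureZr).
Qed.

Lemma tens_sum_pure x : x = \sum_(p <- repr x) pure p.1 p.2.
Proof. by rewrite -tclassE tclassK. Qed.

End TensorProduct.

Notation "u ⊗ v" := (pure u v) (at level 35, right associativity) : ring_scope.

(* [tlift f] is the linear map u (x) v |-> f u v; it is only meaningful when  *)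
(* f is bilinear (see [tlift_pure]), as otherwise it depends on the           *)
(* representatives chosen by [repr].                                          *)
Definition tlift (k : fieldType) (U V : lmodType k) (W : zmodType)
    (f : U -> V -> W) (x : tens U V) : W :=
  \sum_(p <- repr x) f p.1 p.2.

Section TensorLift.
Variables (k : fieldType) (U V W : lmodType k) (f : U -> V -> W).
Hypothesis f_bil : bilinear_for *:%R *:%R f.

Let fDl u u' v : f (u + u') v = f u v + f u' v.
Proof. by have /= := f_bil.1 v 1 u u'; rewrite !scale1r. Qed.

Let fDr u v v' : f u (v + v') = f u v + f u v'.
Proof. by have /= := f_bil.2 u 1 v v'; rewrite !scale1r. Qed.

Let f0l v : f 0 v = 0.
Proof. by apply: (addrI (f 0 v)); rewrite -fDl !addr0. Qed.

Let f0r u : f u 0 = 0.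
Proof. by apply: (addrI (f u 0)); rewrite -fDr !addr0. Qed.

Let fZl a u v : f (a *: u) v = a *: f u v.
Proof. by have /= := f_bil.1 v a u 0; rewrite !addr0 f0l addr0. Qed.

Let fZr a u v : f u (a *: v) = a *: f u v.
Proof. by have /= := f_bil.2 u a v 0; rewrite !addr0 f0r addr0. Qed.

Lemma tlift_cong (s t : seq (U * V)) : tens_cong s t ->
  \sum_(p <- s) f p.1 p.2 = \sum_(p <- t) f p.1 p.2.
Proof.
elim=> {s t} //=.
- by move=> s t r _ h1 _ h2; rewrite h1.
- by move=> s s' t t' _ h1 _ h2; rewrite !big_cat /= h1 h2.
- by move=> s t; rewrite !big_cat /= addrC.
- by move=> v; rewrite big_seq1 big_nil f0l.
- by move=> u u' v; rewrite big_seq1 !big_cons big_nil addr0 /= fDl.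
- by move=> u v v'; rewrite big_seq1 !big_cons big_nil addr0 /= fDr.
- by move=> a u v; rewrite !big_seq1 /= fZl fZr.
Qed.

Lemma tlift_pure u v : tlift f (u ⊗ v) = f u v.
Proof. by rewrite /tlift (tlift_cong (repr_tclass _)) big_seq1. Qed.

Lemma tlift_linear : linear (tlift f).
Proof.
move=> a x y; rewrite -(tclassK x) -(tclassK y) -[a *: _]/(tens_scale _ _).
rewrite tens_scaleE -tclass_cat /tlift !(tlift_cong (repr_tclass _)).
rewrite big_cat big_map scaler_sumr; congr (_ + _); apply: eq_bigr => p _ /=.
exact: fZl.
Qed.

End TensorLift.

Section TensorMaps.
Variable k : fieldType.

Definition tmap (U V U' V' : lmodType k) (f : U -> U') (g : V -> V') :
    tens U V -> tens U' V' :=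
  tlift (fun u v => f u ⊗ g v).

Definition tswap (U V : lmodType k) : tens U V -> tens V U :=
  tlift (fun u v => v ⊗ u).

Definition tassoc (U V W : lmodType k) :
    tens U (tens V W) -> tens (tens U V) W :=
  tlift (fun u => tlift (fun v w => (u ⊗ v) ⊗ w)).

Definition subspace (V : lmodType k) (S : set V) : Prop :=
  S 0 /\ forall a u v, S u -> S v -> S (a *: u + v).

Definition linspan (V : lmodType k) (X : set V) : set V :=
  smallest (@subspace V) X.

Definition finite_dim_subspace (V : lmodType k) (S : set V) : Prop :=
  exists s : seq V, S = linspan [set` s].

(* Over a field S (x) T embeds in U (x) V for all subspaces S and T; we       *)
(* identify it with its image.                                                *)
Definition tsub (U V : lmodType k) (S : set U) (T : set V) :
    set (tens U V) :=
  linspan [set u ⊗ v | u in S & v in T].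

End TensorMaps.

Section Graded.
Variable k : fieldType.

Definition homogeneous_decomposition (V : lmodType k) (G : int -> set V)
    (v : V) (c : int -> V) : Prop :=
  [/\ forall i, G i (c i), finite_set [set i | c i != 0] &
      v = \sum_(i \in [set: int]) c i].

Definition graded_space (V : lmodType k) (G : int -> set V) : Prop :=
  (forall i, finite_dim_subspace (G i)) /\
  (forall v, exists! c, homogeneous_decomposition G v c).

Definition hcomp (V : lmodType k) (G : int -> set V) (i : int) (v : V) : V :=
  xget (fun=> 0) (homogeneous_decomposition G v) i.

(* A formal sum in U (x)^ V = prod_(i, j) U_i (x) V_j is the function sending *)
(* (i, j) to its component in U_i (x) V_j; such functions are added and       *)
(* scaled pointwise.                                                          *)
Definition ctens (U V : lmodType k) : Type := int -> int -> tens U V.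

HB.instance Definition _ (U V : lmodType k) :=
  GRing.Lmodule.copy (ctens U V) (int -> int -> tens U V).

Definition in_ctens (U V : lmodType k) (GU : int -> set U) (GV : int -> set V)
    (x : ctens U V) : Prop :=
  forall i j, tsub (GU i) (GV j) (x i j).

(* f (x)^ g, termwise: the (i, j) component of the image of the formal sum x  *)
(* collects the (i, j) components of the (f (x) g)(x_p).  The big sum is 0 by *)
(* convention when infinitely many terms are nonzero; this does not happen    *)
(* when f and g are the identity or multiplication operators of a graded      *)
(* algebra.                                                                   *)
Definition ctmap (U V U' V' : lmodType k)
    (GU' : int -> set U') (GV' : int -> set V')
    (f : U -> U') (g : V -> V') (x : ctens U V) : ctens U' V' :=
  fun i j => \sum_(p \in [set: int * int])
    tmap (fun u => hcomp GU' i (f u)) (fun v => hcomp GV' j (g v)) (x p.1 p.2).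

Definition ctswap (U V : lmodType k) (x : ctens U V) : ctens V U :=
  fun i j => tswap (x j i).

End Graded.

Section Algebras.
Variable k : fieldType.

Definition graded_product (V : lmodType k) (G : int -> set V)
    (op : V -> V -> V) : Prop :=
  forall i j x y, G i x -> G j y -> G (i + j) (op x y).

Section Zinbiel.
Variables (B : lmodType k) (z : B -> B -> B) (nu : B -> tens B B).

Definition zinbiel_algebra : Prop :=
  bilinear_for *:%R *:%R z /\
  forall b1 b2 b3, z b1 (z b2 b3) = z (z b1 b2) b3 + z (z b2 b1) b3.

Definition zinbiel_coalgebra : Prop :=
  linear nu /\
  forall b, tassoc (tmap id nu (nu b)) =
    tmap nu id (nu b) + tmap (@tswap k B B) id (tmap nu id (nu b)).

Definition zinbiel_bialgebra : Prop :=
  let lz b x := z b x in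
  let rz b x := z x b in
  [/\ zinbiel_algebra, zinbiel_coalgebra,
      forall b1 b2, nu (z b1 b2) + nu (z b2 b1) =
        tmap id (fun x => lz b2 x + rz b2 x) (nu b1)
        + tmap (lz b1) id (nu b2) &
      forall b1 b2, nu (z b1 b2) + tswap (nu (z b1 b2)) =
        tmap id (rz b2) (nu b1)
        + tmap (lz b1) id (nu b2 + tswap (nu b2))].

End Zinbiel.

Section Diassociative.
(* [dl] is the product -| and [dr] the product |- *)
Variables (D : lmodType k) (G : int -> set D) (dl dr : D -> D -> D).
Variable om : D -> D -> k.

Definition diassociative : Prop :=
  [/\ bilinear_for *:%R *:%R dl /\ bilinear_for *:%R *:%R dr,
      associative dl /\ associative dr,
      forall d1 d2 d3, dl (dl d1 d2) d3 = dl d1 (dr d2 d3),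
      forall d1 d2 d3, dl (dr d1 d2) d3 = dr d1 (dl d2 d3) &
      forall d1 d2 d3, dr (dl d1 d2) d3 = dr (dr d1 d2) d3].

Definition graded_diassociative : Prop :=
  [/\ diassociative, graded_space G, graded_product G dl &
      graded_product G dr].

Definition graded_form : Prop :=
  exists m : int, forall i j x y,
    G i x -> G j y -> i + j + m != 0 -> om x y = 0.

Definition invariant_form : Prop :=
  (forall d1 d2 d3, om (dr d1 d2) d3 = om d1 (dr d2 d3 - dl d2 d3)) /\
  (forall d1 d2 d3, om (dl d1 d2) d3 = om d1 (dr d2 d3)).

Definition quadratic_graded_diassociative : Prop :=
  [/\ graded_diassociative, bilinear_for *%R *%R om,
      forall x y, om x y = - om y x,
      forall x, (forall y, om x y = 0) -> x = 0 &
      graded_form /\ invariant_form].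

(* The sum is finite when x is in D (x)^ D and om is graded.                  *)
Definition om_hat (x : ctens D D) (y y' : D) : k :=
  \sum_(p \in [set: int * int])
    tlift (fun u u' => om u y * om u' y') (x p.1 p.2).

(* The element theta of D (x)^ D determined by                                *)
(* om_hat theta (d2 (x) d3) = om d (op d2 d3).                                *)
Definition theta (op : D -> D -> D) (d : D) : ctens D D :=
  xget 0 [set x | in_ctens G G x /\
                  forall d2 d3, om_hat x d2 d3 = om d (op d2 d3)].

End Diassociative.

Section CompletedASI.
Variables (A : lmodType k) (G : int -> set A) (mul : A -> A -> A).
Variable De : A -> ctens A A.

Definition graded_associative : Prop :=
  [/\ bilinear_for *:%R *:%R mul, associative mul, graded_space G &
      graded_product G mul].

(* Contribution of the term x_p of a formal sum x in A (x)^ A to the          *)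
(* (i, j, l) component of (De (x)^ id)(x), resp. (id (x)^ De)(x), in          *)
(* A (x)^ A (x)^ A = prod_(i, j, l) A_i (x) A_j (x) A_l.                      *)
Definition comulL_term (x : ctens A A) (i j l : int) (p : int * int) :
    tens (tens A A) A :=
  tmap (fun a => De a i j) (hcomp G l) (x p.1 p.2).

Definition comulR_term (x : ctens A A) (i j l : int) (p : int * int) :
    tens (tens A A) A :=
  tassoc (tmap (hcomp G i) (fun a => De a j l) (x p.1 p.2)).

(* As De may spread over infinitely many degrees, (De (x)^ id)(De a) and      *)
(* (id (x)^ De)(De a) only make sense when finitely many terms contribute to  *)
(* each component; this is part of coassociativity.                           *)
Definition completed_coassociative : Prop :=
  forall a i j l,
    [/\ finite_set [set p | comulL_term (De a) i j l p != 0],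
        finite_set [set p | comulR_term (De a) i j l p != 0] &
        \sum_(p \in [set: int * int]) comulL_term (De a) i j l p =
        \sum_(p \in [set: int * int]) comulR_term (De a) i j l p].

Definition completed_ASI_bialgebra : Prop :=
  let lm a x := mul a x in
  let rm a x := mul x a in
  let cmap := ctmap G G in
  [/\ graded_associative,
      linear De /\ (forall a, in_ctens G G (De a)),
      completed_coassociative,
      forall a1 a2, De (mul a1 a2) =
        cmap (rm a2) id (De a1) + cmap id (lm a1) (De a2) &
      forall a1 a2,
        cmap (lm a1) id (De a2) - cmap id (rm a1) (De a2) =
        ctswap (cmap id (rm a2) (De a1) - cmap (lm a2) id (De a1))].

End CompletedASI.

Section Affinization.
Variables (D : lmodType k) (G : int -> set D) (dl dr : D -> D -> D).
Variables (om : D -> D -> k) (B : lmodType k).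
Variables (z : B -> B -> B) (nu : B -> tens B B).

Definition aff_grading (i : int) : set (tens D B) := tsub (G i) [set: B].

Definition aff_mul (x y : tens D B) : tens D B :=
  tlift (fun d1 b1 =>
    tlift (fun d2 b2 => dr d1 d2 ⊗ z b1 b2 + dl d1 d2 ⊗ z b2 b1) y) x.

Definition tbullet (x : tens D D) (y : tens B B) :
    tens (tens D B) (tens D B) :=
  tlift (fun d' d'' => tlift (fun b' b'' => (d' ⊗ b') ⊗ (d'' ⊗ b'')) y) x.

Definition ctbullet (x : ctens D D) (y : tens B B) :
    ctens (tens D B) (tens D B) :=
  fun i j => tbullet (x i j) y.

Definition aff_comul (x : tens D B) : ctens (tens D B) (tens D B) :=
  tlift (fun d b =>
    ctbullet (theta G om dr d) (nu b)
    + ctbullet (theta G om dl d) (tswap (nu b))) x.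

End Affinization.

End Algebras.

(* The diassociative algebra k[t, t^-1] d_1 + k[t, t^-1] d_2, as the free     *)
(* vector space on the t^i d_m for i : int and m : 'I_2; the values [ix1] and *)
(* [ix2] of m stand for the indices 1 and 2.                                  *)
Section LaurentVectorFields.
Variable k : fieldType.

Definition ix1 : 'I_2 := ord0.
Definition ix2 : 'I_2 := ord_max.

Definition lvf : lmodType k := {malg k[(int * 'I_2)%type]}.

Definition tdel (i : int) (m : 'I_2) : lvf := << (i, m) >>.

Definition lvf_bilin (W : lmodType k)
    (b : int * 'I_2 -> int * 'I_2 -> W) (x y : lvf) : W :=
  \sum_(p <- msupp x) \sum_(q <- msupp y) (x@_p * y@_q) *: b p q.

Definition lvf_dl : lvf -> lvf -> lvf :=
  lvf_bilin (fun p q => tdel (p.1 + q.1 + (q.2 == ix1)%:Z) p.2).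

Definition lvf_dr : lvf -> lvf -> lvf :=
  lvf_bilin (fun p q => tdel (p.1 + q.1 + (p.2 == ix1)%:Z) q.2).

Definition lvf_om : lvf -> lvf -> k :=
  lvf_bilin (W := k^o) (fun p q =>
    if (p.2 == ix1) && (q.2 == ix2) then (p.1 + q.1 == 0)%:R
    else if (p.2 == ix2) && (q.2 == ix1) then - (p.1 + q.1 == 0)%:R
    else 0).

Definition lvf_grading (i : int) : set lvf :=
  linspan [set tdel (i - 1) ix1; tdel i ix2].

Local Notation e p := (<< p >> : lvf).

Lemma lvf_basis (x : lvf) : x = \sum_(p <- msupp x) x@_p *: e p.
Proof.
rewrite {1}[x]monalgE; apply: eq_bigr => p _; apply/malgP => q.
by rewrite mcoeffZ !mcoeffU -mulr_natr; case: eqP; rewrite ?mulr0 ?mulr1.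
Qed.

Lemma lvf_lin_ext (W : lmodType k) (f g : lvf -> W) : linear f -> linear g ->
  (forall p, f (e p) = g (e p)) -> f =1 g.
Proof.
move=> lf lg fg x.
have z0 h : linear h -> h (0 : lvf) = 0 :> W.
  by move=> lh; have := lh (-1) 0 0; rewrite !scaler0 addr0 scaleN1r addNr.
rewrite (lvf_basis x); elim: (msupp x : seq _) => [|p s IHs].
  by rewrite big_nil !z0.
by rewrite big_cons lf lg fg IHs.
Qed.

Lemma lvf_bilinE (W : lmodType k) b (x y : lvf) (d1 d2 : {fset (int * 'I_2)}) :
  (msupp x `<=` d1)%fset -> (msupp y `<=` d2)%fset ->
  lvf_bilin (W := W) b x y = \sum_(p <- d1) \sum_(q <- d2) (x@_p * y@_q) *: b p
      q.
Proof.
move=> h1 h2; rewrite /lvf_bilin (big_fset_incl _ h1) /=; last first.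
  move=> p _ /mcoeff_outdom xp; rewrite big1 // => q _.
  by rewrite xp mul0r scale0r.
apply: eq_bigr => p _; apply: big_fset_incl => // q _ /mcoeff_outdom ->.
by rewrite mulr0 scale0r.
Qed.

Lemma lvf_bilinP (W : lmodType k) b :
  bilinear_for *:%R *:%R (lvf_bilin (W := W) b).
Proof.
split=> [y a u v|y a u v] /=.
  pose d := (msupp u `|` msupp v)%fset.
  have su : (msupp u `<=` d)%fset by rewrite fsubsetUl.
  have sv : (msupp v `<=` d)%fset by rewrite fsubsetUr.
  have s : (msupp (a *: u + v) `<=` d)%fset.
    by apply: fsubset_trans (msuppD_le _ _) _; rewrite fsubUset sv andbT
        (fsubset_trans (msuppZ_le _ _)).
  rewrite !(lvf_bilinE _ su (fsubset_refl _)) !(lvf_bilinE _ sv (fsubset_refl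
      _)) !(lvf_bilinE _ s (fsubset_refl _)).
  rewrite scaler_sumr -big_split /=; apply: eq_bigr => p _.
  rewrite scaler_sumr -big_split /=; apply: eq_bigr => q _.
  by rewrite mcoeffD mcoeffZ mulrDl scalerDl scalerA mulrA.
pose d := (msupp u `|` msupp v)%fset.
have su : (msupp u `<=` d)%fset by rewrite fsubsetUl.
have sv : (msupp v `<=` d)%fset by rewrite fsubsetUr.
have s : (msupp (a *: u + v) `<=` d)%fset.
  by apply: fsubset_trans (msuppD_le _ _) _; rewrite fsubUset sv andbT
      (fsubset_trans (msuppZ_le _ _)).
rewrite !(lvf_bilinE _ (fsubset_refl _) su) !(lvf_bilinE _ (fsubset_refl _) sv)
    !(lvf_bilinE _ (fsubset_refl _) s).
rewrite scaler_sumr -big_split /=; apply: eq_bigr => p _.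
rewrite scaler_sumr -big_split /=; apply: eq_bigr => q _.
by rewrite mcoeffD mcoeffZ mulrDr scalerDl scalerA mulrCA.
Qed.

Lemma lvf_bilinU (W : lmodType k) b p q : lvf_bilin (W := W) b (e p) (e q) = b
    p q.
Proof.
by rewrite (lvf_bilinE _ msuppU_le msuppU_le) !big_seq_fset1 !mcoeffUU mulr1
    scale1r.
Qed.

Lemma lvf_dlU p q : lvf_dl (e p) (e q) = e (p.1 + q.1 + (q.2 == ix1)%:Z, p.2).
Proof. exact: lvf_bilinU. Qed.
Lemma lvf_drU p q : lvf_dr (e p) (e q) = e (p.1 + q.1 + (p.2 == ix1)%:Z, q.2).
Proof. exact: lvf_bilinU. Qed.

Definition lvf_dlP := @lvf_bilinP lvf (fun p q => tdel (p.1 + q.1 + (q.2 ==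
    ix1)%:Z) p.2).
Definition lvf_drP := @lvf_bilinP lvf (fun p q => tdel (p.1 + q.1 + (p.2 ==
    ix1)%:Z) q.2).
Lemma lvf_dl_linl a (u v y : lvf) : lvf_dl (a *: u + v) y = a *: lvf_dl u y +
    lvf_dl v y.
Proof. exact: lvf_dlP.1. Qed.
Lemma lvf_dl_linr a (u v y : lvf) : lvf_dl y (a *: u + v) = a *: lvf_dl y u +
    lvf_dl y v.
Proof. exact: lvf_dlP.2. Qed.
Lemma lvf_dr_linl a (u v y : lvf) : lvf_dr (a *: u + v) y = a *: lvf_dr u y +
    lvf_dr v y.
Proof. exact: lvf_drP.1. Qed.
Lemma lvf_dr_linr a (u v y : lvf) : lvf_dr y (a *: u + v) = a *: lvf_dr y u +
    lvf_dr y v.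
Proof. exact: lvf_drP.2. Qed.
Lemma lvf_om_linl a (u v y : lvf) : lvf_om (a *: u + v) y = a * lvf_om u y +
    lvf_om v y.
Proof. exact: (lvf_bilinP (W := k^o) _).1. Qed.
Lemma lvf_om_linr a (u v y : lvf) : lvf_om y (a *: u + v) = a * lvf_om y u +
    lvf_om y v.
Proof. exact: (lvf_bilinP (W := k^o) _).2. Qed.

Definition lvf_linE := (lvf_dl_linl, lvf_dl_linr, lvf_dr_linl, lvf_dr_linr,
    lvf_om_linl, lvf_om_linr).

Lemma lvf_trilin_ext (W : lmodType k) (f g : lvf -> lvf -> lvf -> W) :
  (forall a u v y z, f (a *: u + v) y z = a *: f u y z + f v y z) ->
  (forall a u v y z, f y (a *: u + v) z = a *: f y u z + f y v z) ->
  (forall a u v y z, f y z (a *: u + v) = a *: f y z u + f y z v) ->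
  (forall a u v y z, g (a *: u + v) y z = a *: g u y z + g v y z) ->
  (forall a u v y z, g y (a *: u + v) z = a *: g y u z + g y v z) ->
  (forall a u v y z, g y z (a *: u + v) = a *: g y z u + g y z v) ->
  (forall p q r, f (e p) (e q) (e r) = g (e p) (e q) (e r)) ->
  forall x y z, f x y z = g x y z.
Proof.
move=> f1 f2 f3 g1 g2 g3 fg x y z.
apply: (@lvf_lin_ext W (fun x => f x y z) (fun x => g x y z)) => [a u v|a u
    v|p] //=.
apply: (@lvf_lin_ext W (fun y => f _ y z) (fun y => g _ y z)) => [a u v|a u
    v|q] //=.
apply: (@lvf_lin_ext W (fun z => f _ _ z) (fun z => g _ _ z)) => [a u v|a u
    v|r] //=.
Qed.

Lemma ix2E (m : 'I_2) : (m == ix2) = ~~ (m == ix1).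
Proof. by case: m => [[|[|]]]. Qed.

Lemma lvf_omU p q : lvf_om (e p) (e q) =
  if p.2 == ix1 then (if q.2 == ix1 then 0 else (p.1 + q.1 == 0)%:R)
  else if q.2 == ix1 then - (p.1 + q.1 == 0)%:R else 0.
Proof.
by rewrite [LHS](lvf_bilinU (W := k^o)) !ix2E; case: (p.2 == _); case: (q.2 ==
    _).
Qed.

Ltac lvf_lin3 := by move=> *; rewrite ?lvf_linE ?scalerDr ?addrA.

Lemma lvf_diassociative : diassociative lvf_dl lvf_dr.
Proof.
split; first by split; [exact: lvf_dlP | exact: lvf_drP].
- split=> x y z.
  + apply: (@lvf_trilin_ext _ (fun x y z => lvf_dl x (lvf_dl y z)) (fun x y z
      => lvf_dl (lvf_dl x y) z)); [lvf_lin3..|].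
    by move=> p q r; rewrite !lvf_dlU /=; congr << _ >>; congr pair; ring.
  + apply: (@lvf_trilin_ext _ (fun x y z => lvf_dr x (lvf_dr y z)) (fun x y z
      => lvf_dr (lvf_dr x y) z)); [lvf_lin3..|].
    by move=> p q r; rewrite !lvf_drU /=; congr << _ >>; congr pair; ring.
- move=> x y z; apply: (@lvf_trilin_ext _ (fun x y z => lvf_dl (lvf_dl x y) z)
    (fun x y z => lvf_dl x (lvf_dr y z))); [lvf_lin3..|].
  by move=> p q r; rewrite ?lvf_drU ?lvf_dlU ?lvf_drU ?lvf_dlU /=; congr << _
      >>; congr pair; ring.
- move=> x y z; apply: (@lvf_trilin_ext _ (fun x y z => lvf_dl (lvf_dr x y) z)
    (fun x y z => lvf_dr x (lvf_dl y z))); [lvf_lin3..|].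
  by move=> p q r; rewrite ?lvf_drU ?lvf_dlU ?lvf_drU ?lvf_dlU /=; congr << _
      >>; congr pair; ring.
- move=> x y z; apply: (@lvf_trilin_ext _ (fun x y z => lvf_dr (lvf_dl x y) z)
    (fun x y z => lvf_dr (lvf_dr x y) z)); [lvf_lin3..|].
  by move=> p q r; rewrite ?lvf_drU ?lvf_dlU ?lvf_drU ?lvf_dlU /=; congr << _
      >>; congr pair; ring.
Qed.

Definition lvf_deg (p : int * 'I_2) : int := p.1 + (p.2 == ix1)%:Z.

Lemma lvf_gradingE i (x : lvf) : lvf_grading i x <-> forall p, x@_p != 0 ->
    lvf_deg p = i.
Proof.
split=> [|h].
  move=> hx; refine (hx [set x : lvf | forall p, x@_p != 0 -> lvf_deg p = i]
      _); split.
    split; first by move=> p; rewrite mcoeff0 eqxx.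
    move=> a u v hu hv p; rewrite mcoeffD mcoeffZ => h.
    case: (eqVneq u@_p 0) => [u0|]; last exact: hu.
    by apply: hv; move: h; rewrite u0 mulr0 add0r.
  move=> _ [->|->] p; rewrite mcoeffU; case: (_ =P p) => [<- _|]; rewrite ?eqxx
      // /lvf_deg /= ?addr0 //.
  exact: subrK.
move=> S [[S0 Sl] gS]; rewrite (lvf_basis x).
have hs : all (fun p => lvf_deg p == i) (msupp x : seq _).
  by apply/allP => p px; apply/eqP/h; rewrite mcoeff_neq0.
elim: (msupp x : seq _) hs => [|p s IHs] /=; first by rewrite big_nil.
case/andP=> /eqP dp /IHs Ss; rewrite big_cons.
apply: Sl => //.
apply: gS; case: p dp => n m; rewrite /lvf_deg /= => <-.
case: (boolP (m == ix1)) => [/eqP ->|]; first by left; rewrite /= addrK.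
by rewrite -ix2E => /eqP ->; right; rewrite /= addr0.
Qed.

Lemma linspan_subspace (V : lmodType k) (X : set V) : subspace (linspan X).
Proof.
split=> [S [[]] //|a u v hu hv S hS].
by apply: hS.1.2; [apply: hu|apply: hv].
Qed.

Lemma lvf_graded_space : graded_space lvf_grading.
Proof.
split=> [i|x].
  exists [:: tdel (i - 1) ix1; tdel i ix2]; congr linspan.
  apply/seteqP; split=> y /=; rewrite !inE.
    by move=> [->|->]; rewrite eqxx ?orbT.
  by move=> /orP[] /eqP ->; [left|right].
pose c i : lvf := \sum_(p <- msupp x | lvf_deg p == i) x@_p *: e p.
have cE i p : (c i)@_p = if lvf_deg p == i then x@_p else 0.
  rewrite /c raddf_sum /=.
  have tE q : (x@_q *: e q)@_p = if q == p then x@_p else 0.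
    by rewrite mcoeffZ mcoeffU; case: eqP => [->|]; rewrite ?mulr1 ?mulr0.
  under eq_bigr do rewrite tE.
  rewrite -big_mkcondr /=; case: (boolP (p \in msupp x)) => [px|npx].
    rewrite big_mkcond /= (big_fsetD1 p px) /= eqxx andbT.
    rewrite big1_fset ?addr0 // => q; rewrite in_fsetD1 => /andP[/negbTE -> _].
    by rewrite andbF.
  rewrite (mcoeff_outdom npx) if_same big1 //.
have cf : finite_set [set i | c i != 0].
  apply: (@sub_finite_set _ _ [set lvf_deg p | p in [set` msupp x]]); last
      first.
    exact/finite_image/finite_fset.
  move=> i /= /eqP ci; apply: contrapT => h; apply: ci; apply/malgP => p.
  rewrite cE mcoeff0; case: eqP => // dp; apply: mcoeff_outdom; apply/negP =>
      px.
  by apply: h; exists p.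
have key c' : finite_set [set i | c' i != 0] ->
    (forall i, lvf_grading i (c' i)) ->
    forall p, (\sum_(i \in [set: int]) c' i)@_p = ((c' (lvf_deg p)) : lvf)@_p.
  move=> fc hc p.
  pose F : {fset int} := (lvf_deg p |` fset_set [set i | c' i != 0])%fset.
  rewrite (fsbigTE F); last first.
    move=> i; rewrite !inE negb_or => /andP[_ /negP h].
    by apply/eqP/negPn/negP => ci; apply: h; rewrite in_fset_set //;
        apply/mem_set.
  rewrite raddf_sum /= (big_fsetD1 (lvf_deg p)) /=; last by rewrite !inE eqxx.
  rewrite big1_fset ?addr0 // => i; rewrite in_fsetD1 => /andP[/eqP ni _] _.
  by apply/eqP; apply: contra_notT ni => /(proj1 (lvf_gradingE _ _) (hc i) p)
      ->.
have hc i : lvf_grading i (c i).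
  by apply/lvf_gradingE => p; rewrite cE; case: (lvf_deg p =P i) => // _;
      rewrite eqxx.
exists c; split.
  split=> //.
  by apply/malgP => p; rewrite key // cE eqxx.
move=> c' [h1 h2 h3]; apply: funext => i; apply/malgP => p.
rewrite cE h3 key //; case: eqP => [<- //|/eqP ne].
by apply/esym/eqP; apply: contraNT ne => /(proj1 (lvf_gradingE _ _) (h1 i) p)
    ->.
Qed.

Lemma lvf_graded_product (op : lvf -> lvf -> lvf) i j :
  (forall a u v y, op (a *: u + v) y = a *: op u y + op v y) ->
  (forall a u v y, op y (a *: u + v) = a *: op y u + op y v) ->
  (forall p q, lvf_deg p = i -> lvf_deg q = j -> lvf_grading (i + j) (op (e p)
      (e q))) ->
  forall x y, lvf_grading i x -> lvf_grading j y -> lvf_grading (i + j) (op x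
      y).
Proof.
move=> o1 o2 h x y hx hy.
have ss := linspan_subspace [set tdel (i + j - 1) ix1; tdel (i + j) ix2].
have [S0 Sl] := ss.
have o0 y0 : op 0 y0 = 0.
  by have := o1 (-1) 0 0 y0; rewrite !scaler0 !addr0 scaleN1r addNr.
have o0' y0 : op y0 0 = 0.
  by have := o2 (-1) 0 0 y0; rewrite !scaler0 !addr0 scaleN1r addNr.
have step (a : k) (u v : lvf) : lvf_grading (i + j) u -> lvf_grading (i + j) v
    -> lvf_grading (i + j) (a *: u + v).
  exact (Sl a u v).
have gen p : lvf_deg p = j -> lvf_grading (i + j) (op x (e p)).
  move=> dp.
  refine (hx [set x | lvf_grading (i + j) (op x (e p))] _); split.
    split; first by rewrite /= o0.
    by move=> a u v /=; rewrite o1; exact: step.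
  by move=> _ [->|->] /=; apply: h => //; rewrite /lvf_deg /= ?addr0 ?subrK.
refine (hy [set y | lvf_grading (i + j) (op x y)] _); split.
  split; first by rewrite /= o0'.
  by move=> a u v /=; rewrite o2; exact: step.
by move=> _ [->|->] /=; apply: gen; rewrite /lvf_deg /= ?addr0 ?subrK.
Qed.

Lemma lvf_gradingU i p : lvf_deg p = i -> lvf_grading i (e p).
Proof. by move=> <-; apply/lvf_gradingE => q; rewrite mcoeffU; case: (p =P q)
    => [->|] //; rewrite eqxx. Qed.

Lemma lvf_quadratic_graded_diassociative :
  quadratic_graded_diassociative lvf_grading lvf_dl lvf_dr lvf_om.
Proof.
have skew x y : lvf_om x y = - lvf_om y x :> k.
  apply: (@lvf_lin_ext k^o (fun x => lvf_om x y) (fun x => - lvf_om y x : k^o))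
      => [a u v|a u v|p] /=.
  - by rewrite lvf_linE.
  - by rewrite lvf_linE opprD -mulrN.
  apply: (@lvf_lin_ext k^o (fun y => lvf_om (e p) y) (fun y => - lvf_om y (e p)
      : k^o)) => [a u v|a u v|q] /=.
  - by rewrite lvf_linE.
  - by rewrite lvf_linE opprD -mulrN.
  rewrite !lvf_omU addrC; case: (p.2 == _); case: (q.2 == _); rewrite ?oppr0
      ?opprK //.
have om0 y : lvf_om 0 y = 0 :> k.
  by have := lvf_om_linl (-1) 0 0 y; rewrite !scaler0 addr0 mulN1r addNr.
have om0' y : lvf_om y 0 = 0 :> k by rewrite skew om0 oppr0.
split.
- split; [exact: lvf_diassociative | exact: lvf_graded_space | move=> i j x y
    hx hy | move=> i j x y hx hy].
  + apply: (@lvf_graded_product _ i j) hx hy => [a u v z|a u v z|p q <- <-];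
      [exact: lvf_dl_linl|exact: lvf_dl_linr|].
    rewrite lvf_dlU; apply: lvf_gradingU; rewrite /lvf_deg /=; ring.
  + apply: (@lvf_graded_product _ i j) hx hy => [a u v z|a u v z|p q <- <-];
      [exact: lvf_dr_linl|exact: lvf_dr_linr|].
    rewrite lvf_drU; apply: lvf_gradingU; rewrite /lvf_deg /=; ring.
- by split=> [y a u v|y a u v]; [exact: lvf_om_linl|exact: lvf_om_linr].
- exact: skew.
- move=> x hx; apply/malgP => -[n m]; rewrite mcoeff0.
  have main q : lvf_om x (e q) = if q.2 == ix1 then - x@_(- q.1, ix2) else
      x@_(- q.1, ix1).
    apply: (@lvf_lin_ext k^o (fun x => lvf_om x (e q)) (fun x => if q.2 == ix1
        then - x@_(- q.1, ix2) else x@_(- q.1, ix1) : k^o)) => [a u v|a u v|p]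
            /=.
    - by rewrite lvf_linE.
    - by case: ifP => _; rewrite !mcoeffD !mcoeffZ // opprD -mulrN.
    case: p => n1 m1; rewrite lvf_omU !mcoeffU !xpair_eqE /= ix2E addr_eq0.
    by case: (q.2 == _); case: (m1 == _); rewrite ?andbT ?andbF ?oppr0.
  have := main (- n, if m == ix1 then ix2 else ix1); rewrite hx /= opprK.
  case: (boolP (m == ix1)) => [/eqP -> /=|]; first by move=> <-.
  by rewrite -ix2E => /eqP -> /= /esym/eqP; rewrite oppr_eq0 => /eqP.
- split; [|split].
  + exists (-1) => i j x y hx hy ne.
    have sub1 (P : lvf -> Prop) (i0 : int) : P 0 -> (forall (a : k) (u v :
        lvf), P u -> P v -> P (a *: u + v)) ->
       (forall p, lvf_deg p = i0 -> P (e p)) -> forall x, lvf_grading i0 x -> P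
           x.
      move=> P0 Pl Pe x0 h0; refine (h0 [set x | P x] _); split.
        by split; [|move=> a u v; exact (Pl a u v)].
      by move=> _ [->|->] /=; apply: Pe; rewrite /lvf_deg /= ?addr0 ?subrK.
    revert x hx; refine (sub1 (fun x => lvf_om x y = 0) i _ _ _) => [|a u v hu
        hv|p dp]; first exact: om0.
      by rewrite lvf_linE hu hv mulr0 addr0.
    revert y hy; refine (sub1 (fun y => lvf_om (e p) y = 0) j _ _ _) => [|a u v
        hu hv|q dq]; first exact: om0'.
      by rewrite lvf_linE hu hv mulr0 addr0.
    move: ne; rewrite -dp -dq /lvf_deg lvf_omU.
    case: (p.2 == _); case: (q.2 == _) => //= ne.
      by case: (_ =P 0) => // h; case/eqP: ne; rewrite -h; ring.
    by case: (_ =P 0) => [h|]; rewrite ?oppr0 //; case/eqP: ne; rewrite -h;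
        ring.
  + move=> x y z.
    apply: (@lvf_trilin_ext k^o (fun x y z => lvf_om (lvf_dr x y) z) (fun x y z
        => lvf_om x (lvf_dr y z - lvf_dl y z))).
    - by move=> *; rewrite ?lvf_linE.
    - by move=> *; rewrite ?lvf_linE.
    - by move=> *; rewrite ?lvf_linE.
    - by move=> *; rewrite ?lvf_linE.
    - by move=> a u v y0 z0; rewrite /= !lvf_linE opprD addrACA -scalerBr
        lvf_linE.
    - by move=> a u v y0 z0; rewrite /= !lvf_linE opprD addrACA -scalerBr
        lvf_linE.
    move=> p q r; have omB (u v w : lvf) : lvf_om u (v - w) = lvf_om u v -
        lvf_om u w.
      by rewrite addrC -scaleN1r lvf_linE mulN1r addrC.
    rewrite /= omB lvf_drU lvf_drU lvf_dlU !lvf_omU /=.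
    case: (p.2 == _); case: (q.2 == _); case: (r.2 == _) => //=; rewrite ?subr0
        ?sub0r ?oppr0 ?subrr ?addr0 ?addrA ?opprK //=;
      do ?congr (- _); congr (nat_of_bool _)%:R; congr eq_op; ring.
  + move=> x y z.
    apply: (@lvf_trilin_ext k^o (fun x y z => lvf_om (lvf_dl x y) z) (fun x y z
        => lvf_om x (lvf_dr y z))); try by move=> *; rewrite ?lvf_linE.
    move=> p q r; rewrite /= lvf_drU lvf_dlU !lvf_omU /=.
    case: (p.2 == _); case: (q.2 == _); case: (r.2 == _) => //=;
      do ?congr (- _); congr (nat_of_bool _)%:R; congr eq_op; ring.
Qed.

End LaurentVectorFields.

(* Main.v *)
(* For w in D let phi_w : D (x) B -> B be d (x) b |-> om(d, w) b. As om is    *)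
(* nondegenerate, the phi_w are jointly injective, even after tensoring with  *)
(* any space, so an identity in (D (x) B) (x)^ (D (x) B) may be tested by     *)
(* applying phi_u (x) phi_v for homogeneous u, v; these maps see a single     *)
(* component of a formal sum. By the definition of theta,                     *)
(*   (phi_u (x) phi_v)(De a) = nu (phi_(u |- v) a) + tau nu (phi_(u -| v) a), *)
(* and by invariance of om, phi_w (a . (d (x) b)) and phi_w ((d (x) b) . a)   *)
(* are combinations of phi_w' a <> b and b <> phi_w' a with w' in D.          *)
(* A product of three elements of D, in a given order, takes only three       *)
(* values: x |- y |- z, x |- y -| z and x -| y -| z. Each axiom of an ASI     *)
(* bialgebra on pure tensors is thus an identity with three scalar            *)
(* coefficients, the values of om on these products. The corresponding three  *)
(* identities in B follow from the axioms of a Zinbiel bialgebra; conversely, *)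
(* for the Laurent vector fields, one coefficient can be made nonzero while   *)
(* the two others vanish, which gives back these axioms.                      *)
Require Import Defs.
From mathcomp Require Import all_boot all_order all_algebra.
From mathcomp Require Import boolp classical_sets functions cardinality fsbigop.
From mathcomp Require Import finmap ring.

Set Implicit Arguments.
Unset Strict Implicit.
Unset Printing Implicit Defensive.

Import GRing.Theory.
Local Open Scope ring_scope.
Local Open Scope classical_set_scope.

(** * Linear maps and tensor products *)

(** Write phi_w for [contract om w]. By [contract_inj] these maps detect zero in D (x) W for every
    W. [separating_tens] extends this to tensor powers of D (x) B, and the grading allows tests with
    homogeneous vectors, one component of a formal sum at a time ([aff_ctens_ext], [aff_tens3_ext]).
    That [theta] exists comes from dual families in the finite-dimensional D_i ([dual_pairs],
    [theta_exists]).

    Once tested, D enters only through scalars: [aff_comul_test] and [csum_comul] turn the coproduct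
    into nu, [contract_mulr] and [contract_mull] turn the product into <>, and diassociativity
    leaves three normal forms x |- y |- z, x |- y -| z, x -| y -| z. Each axiom thus splits into
    three identities in B. Associativity gives the Zinbiel identity, its consequence b1 <> (b3 <>
    b2) = b3 <> (b1 <> b2), and the Zinbiel identity again ([aff_mul_assoc]). Coassociativity gives
    the dual statements: the coalgebra axiom, [coassoc_mid] and [coassoc_left]. Compatibility of the
    coproduct with the product gives [zinbiel_comul_sym], its twist, and the twist of
    [zinbiel_comul_mul]. The last axiom follows from the symmetry of the left side of
    [zinbiel_comul_sym] in b1, b2 and the invariance of that of [zinbiel_comul_mul] under the twist
    ([aff_comm_comul]).

    For the converse, a product of basis vectors t^i d_m keeps the index m of a single factor: the
    last, the middle or the first one, for the three normal forms respectively. As om pairs only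
    different indices, suitable indices isolate one coefficient, and each Zinbiel axiom is read off
    ([zinbiel_of_lvf_ASI]). *)

Section LinearMaps.
Variables (k : fieldType) (U V : lmodType k) (f : U -> V).
Hypothesis hf : linear f.

Lemma linD x y : f (x + y) = f x + f y.
Proof. by have := hf 1 x y; rewrite !scale1r. Qed.

Lemma lin0 : f 0 = 0.
Proof. by apply: (addrI (f 0)); rewrite -linD !addr0. Qed.

Lemma linZ a x : f (a *: x) = a *: f x.
Proof. by have := hf a x 0; rewrite !addr0 lin0 addr0. Qed.

Lemma linN x : f (- x) = - f x.
Proof. by rewrite -scaleN1r linZ scaleN1r. Qed.

Lemma linB x y : f (x - y) = f x - f y.
Proof. by rewrite linD linN. Qed.

Lemma lin_sum I (r : seq I) (P : pred I) F :
  f (\sum_(i <- r | P i) F i) = \sum_(i <- r | P i) f (F i).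
Proof. by apply: big_morph; [exact: linD | exact: lin0]. Qed.

End LinearMaps.

Section LinearClosure.
Variables (k : fieldType) (U V W : lmodType k).

Lemma linear_id : linear (fun x : U => x).
Proof. by []. Qed.

Lemma linear_comp (f : U -> V) (g : V -> W) :
  linear f -> linear g -> linear (fun x => g (f x)).
Proof. by move=> hf hg a x y; rewrite (linD hf) (linZ hf) hg. Qed.

Lemma linear_add (f g : U -> V) :
  linear f -> linear g -> linear (fun x => f x + g x).
Proof. by move=> hf hg a x y; rewrite hf hg scalerDr addrACA. Qed.

Lemma linear_sub (f g : U -> V) :
  linear f -> linear g -> linear (fun x => f x - g x).
Proof. by move=> hf hg a x y; rewrite hf hg scalerBr opprD addrACA. Qed.

Lemma linear_scale (c : k) (f : U -> V) :
  linear f -> linear (fun x => c *: f x).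
Proof. by move=> hf a x y; rewrite hf scalerDr !scalerA mulrC. Qed.

End LinearClosure.

Section Tensors.
Variable k : fieldType.
Implicit Types U V W : lmodType k.

Lemma pure0l U V (v : V) : (0 : U) ⊗ v = 0.
Proof. by rewrite -(scale0r (0 : U)) pureZl scale0r. Qed.

Lemma pure0r U V (u : U) : u ⊗ (0 : V) = 0.
Proof. by rewrite -(scale0r (0 : V)) pureZr scale0r. Qed.

Lemma tens_ind U V (P : tens U V -> Prop) :
  (forall u v, P (u ⊗ v)) -> (forall x y, P x -> P y -> P (x + y)) ->
  forall x, P x.
Proof.
move=> hp hD x; rewrite (tens_sum_pure x).
elim: (repr x) => [|p s IHs]; first by rewrite big_nil -(pure0l U (0 : V)).
by rewrite big_cons; apply: hD.
Qed.

Lemma tens_ext U V W (f g : tens U V -> W) : linear f -> linear g ->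
  (forall u v, f (u ⊗ v) = g (u ⊗ v)) -> f =1 g.
Proof.
move=> hf hg h; elim/tens_ind => // x y hx hy.
by rewrite (linD hf) (linD hg) hx hy.
Qed.

Lemma bilinP U V W (f : U -> V -> W) :
  (forall v, linear (f^~ v)) -> (forall u, linear (f u)) ->
  bilinear_for *:%R *:%R f.
Proof. by move=> h1 h2; split=> [v|u] a x y; [apply: h1 | apply: h2]. Qed.

Lemma pure_linl U V (v : V) : linear (fun u : U => u ⊗ v).
Proof. by move=> a x y; rewrite pureDl pureZl. Qed.

Lemma pure_linr U V (u : U) : linear (fun v : V => u ⊗ v).
Proof. by move=> a x y; rewrite pureDr pureZr. Qed.

Lemma tmap_bilin U V U' V' (f : U -> U') (g : V -> V') :
  linear f -> linear g -> bilinear_for *:%R *:%R (fun u v => f u ⊗ g v).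
Proof.
move=> hf hg; apply: bilinP => [v|u].
  exact: (linear_comp (g := fun x => x ⊗ g v) hf (@pure_linl _ _ _)).
exact: (linear_comp (g := fun x => f u ⊗ x) hg (@pure_linr _ _ _)).
Qed.

Lemma tmap_linear U V U' V' (f : U -> U') (g : V -> V') :
  linear f -> linear g -> linear (tmap f g).
Proof. by move=> hf hg; apply: tlift_linear; apply: tmap_bilin. Qed.

Lemma tmap_pure U V U' V' (f : U -> U') (g : V -> V') :
  linear f -> linear g -> forall u v, tmap f g (u ⊗ v) = f u ⊗ g v.
Proof. by move=> hf hg u v; rewrite /tmap (tlift_pure (tmap_bilin hf hg)). Qed.

Lemma tswap_bilin U V : bilinear_for *:%R *:%R (fun (u : U) (v : V) => v ⊗ u).
Proof. by apply: bilinP => ?; [apply: pure_linr | apply: pure_linl]. Qed.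

Lemma tswap_linear U V : linear (@tswap k U V).
Proof. by apply: tlift_linear; apply: tswap_bilin. Qed.

Lemma tswap_pure U V (u : U) (v : V) : tswap (u ⊗ v) = v ⊗ u.
Proof. by rewrite /tswap (tlift_pure (tswap_bilin _ _)). Qed.

Lemma eq_tlift U V (W : zmodType) (f g : U -> V -> W) :
  f =2 g -> tlift f =1 tlift g.
Proof. by move=> fg x; apply: eq_bigr => p _. Qed.

Lemma tliftD U V W (f g : U -> V -> W) x :
  tlift (fun u v => f u v + g u v) x = tlift f x + tlift g x.
Proof. by rewrite /tlift big_split. Qed.

Lemma tliftZ U V W a (f : U -> V -> W) x :
  tlift (fun u v => a *: f u v) x = a *: tlift f x.
Proof. by rewrite /tlift -scaler_sumr. Qed.

Lemma tassoc_in_bilin U V W (u : U) :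
  bilinear_for *:%R *:%R (fun (v : V) (w : W) => (u ⊗ v) ⊗ w).
Proof.
apply: bilinP => [w|v]; last exact: pure_linr.
exact: (linear_comp (g := fun x => x ⊗ w) (@pure_linr _ _ _) (@pure_linl _ _ _)).
Qed.

Lemma tassoc_bilin U V W : bilinear_for *:%R *:%R
  (fun (u : U) => tlift (fun (v : V) (w : W) => (u ⊗ v) ⊗ w)).
Proof.
apply: bilinP => [x|u]; last by apply: tlift_linear; apply: tassoc_in_bilin.
move=> a u u'; rewrite -tliftZ -tliftD; apply: eq_tlift => v w.
by rewrite !(pureDl, pureZl).
Qed.

Lemma tassoc_linear U V W : linear (@tassoc k U V W).
Proof. by apply: tlift_linear; apply: tassoc_bilin. Qed.

Lemma tassoc_pure U V W (u : U) (v : V) (w : W) :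
  tassoc (u ⊗ v ⊗ w) = (u ⊗ v) ⊗ w.
Proof.
by rewrite /tassoc (tlift_pure (tassoc_bilin _ _ _))
  (tlift_pure (tassoc_in_bilin _ _ _)).
Qed.

End Tensors.

Create HintDb lin discriminated.
Hint Constants Opaque : lin.

(** Linearity is proved by descent on the shape of the map; the base [lin] supplies the maps known
    to be linear in the current context. *)
Ltac solve_linear := lazymatch goal with
| |- GRing.linear_for _ (fun x => x) => exact: linear_id
| |- GRing.linear_for _ (tmap _ _) => apply: tmap_linear; solve_linear
| |- GRing.linear_for _ (@tswap _ _ _) => exact: tswap_linear
| |- GRing.linear_for _ (@tassoc _ _ _ _) => exact: tassoc_linear
| |- GRing.linear_for _ (pure _) => exact: pure_linr
| |- GRing.linear_for _ (fun x => pure _ x) => exact: pure_linr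
| |- GRing.linear_for _ (fun x => x ⊗ _) => exact: pure_linl
| |- GRing.linear_for _ (fun x => @?f x - @?g x) =>
    apply: (@linear_sub _ _ _ f g); solve_linear
| |- GRing.linear_for _ (fun x => @?f x + @?g x) =>
    apply: (@linear_add _ _ _ f g); solve_linear
| |- GRing.linear_for _ (fun x => ?c *: @?f x) =>
    apply: (@linear_scale _ _ _ c f); solve_linear
| |- GRing.linear_for _ (fun x => @?f x ⊗ ?v) =>
    apply: (@linear_comp _ _ _ _ f (fun y => y ⊗ v)); solve_linear
| |- GRing.linear_for _ (fun x => ?g (@?f x)) =>
    apply: (@linear_comp _ _ _ _ f g); solve_linear
| |- GRing.linear_for _ _ => solve [eauto 3 with lin nocore]
end.

Hint Extern 0 (GRing.linear_for _ _) => solve_linear : core.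

(* Otherwise unification unfolds tensors down to their representatives and    *)
(* overflows the stack.                                                       *)
Opaque pure tclass tens_add tens_scale tlift tswap tassoc.

Section TensorCalculus.
Variable k : fieldType.
Implicit Types U V W : lmodType k.

Lemma tmapD U V U' V' (f : U -> U') (g : V -> V') x y :
  linear f -> linear g -> tmap f g (x + y) = tmap f g x + tmap f g y.
Proof. by move=> hf hg; exact: (linD (tmap_linear hf hg)). Qed.

Lemma tmapZ U V U' V' (f : U -> U') (g : V -> V') a x :
  linear f -> linear g -> tmap f g (a *: x) = a *: tmap f g x.
Proof. by move=> hf hg; exact: (linZ (tmap_linear hf hg)). Qed.

Lemma tmap0 U V U' V' (f : U -> U') (g : V -> V') :
  linear f -> linear g -> tmap f g 0 = 0.
Proof. by move=> hf hg; exact: (lin0 (tmap_linear hf hg)). Qed.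

Lemma tswapD U V (x y : tens U V) : tswap (x + y) = tswap x + tswap y.
Proof. exact: (linD (@tswap_linear _ _ _)). Qed.

Lemma tswapZ U V a (x : tens U V) : tswap (a *: x) = a *: tswap x.
Proof. exact: (linZ (@tswap_linear _ _ _)). Qed.

Lemma tswapB U V (x y : tens U V) : tswap (x - y) = tswap x - tswap y.
Proof. exact: (linB (@tswap_linear _ _ _)). Qed.

Lemma tassocD U V W (x y : tens U (tens V W)) :
  tassoc (x + y) = tassoc x + tassoc y.
Proof. exact: (linD (@tassoc_linear _ _ _ _)). Qed.

Lemma tassocZ U V W a (x : tens U (tens V W)) :
  tassoc (a *: x) = a *: tassoc x.
Proof. exact: (linZ (@tassoc_linear _ _ _ _)). Qed.

Lemma eq_tmap U V U' V' (f f' : U -> U') (g g' : V -> V') :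
  f =1 f' -> g =1 g' -> tmap f g =1 tmap f' g'.
Proof. by move=> hf hg x; apply: eq_tlift => u v; rewrite hf hg. Qed.

Lemma tmap_addl U V U' V' (f f' : U -> U') (g : V -> V') x :
  tmap (fun u => f u + f' u) g x = tmap f g x + tmap f' g x.
Proof. by rewrite -tliftD; apply: eq_tlift => u v; rewrite pureDl. Qed.

Lemma tmap_addr U V U' V' (f : U -> U') (g g' : V -> V') x :
  tmap f (fun v => g v + g' v) x = tmap f g x + tmap f g' x.
Proof. by rewrite -tliftD; apply: eq_tlift => u v; rewrite pureDr. Qed.

Lemma tmap_scalel U V U' V' a (f : U -> U') (g : V -> V') x :
  tmap (fun u => a *: f u) g x = a *: tmap f g x.
Proof. by rewrite -tliftZ; apply: eq_tlift => u v; rewrite pureZl. Qed.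

Lemma tmap_scaler U V U' V' a (f : U -> U') (g : V -> V') x :
  tmap f (fun u => a *: g u) x = a *: tmap f g x.
Proof. by rewrite -tliftZ; apply: eq_tlift => u v; rewrite pureZr. Qed.

Lemma tmap_comp U V U' V' U'' V'' (f : U -> U') (g : V -> V')
    (f' : U' -> U'') (g' : V' -> V'') x :
  linear f -> linear g -> linear f' -> linear g' ->
  tmap f' g' (tmap f g x) = tmap (fun u => f' (f u)) (fun v => g' (g v)) x.
Proof.
move=> hf hg hf' hg'.
have cf : linear (fun u => f' (f u)) by apply: linear_comp.
have cg : linear (fun v => g' (g v)) by apply: linear_comp.
elim/tens_ind: x => [u v|x y hx hy]; first by rewrite !tmap_pure.
by rewrite !tmapD // hx hy.
Qed.

Lemma tmap_id U V (x : tens U V) : tmap id id x = x.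
Proof.
elim/tens_ind: x => [u v|x y hx hy]; first by rewrite tmap_pure.
by rewrite tmapD // hx hy.
Qed.

Lemma tswapK U V : cancel (@tswap k U V) (@tswap k V U).
Proof.
elim/tens_ind => [u v|x y hx hy]; first by rewrite !tswap_pure.
by rewrite !tswapD hx hy.
Qed.

Lemma tswap_tmap U V U' V' (f : U -> U') (g : V -> V') x :
  linear f -> linear g -> tswap (tmap f g x) = tmap g f (tswap x).
Proof.
move=> hf hg; elim/tens_ind: x => [u v|x y hx hy].
  by rewrite tmap_pure // !tswap_pure tmap_pure.
by rewrite tmapD // !tswapD tmapD // hx hy.
Qed.

(** The inverse of [tassoc]: reversing the order of the three factors exchanges the two bracketings,
    so [tassoc] conjugated by the reversal is the opposite rebracketing, and its linearity comes for
    free. *)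
Definition tassocr U V W : tens (tens U V) W -> tens U (tens V W) :=
  fun x => tmap id (@tswap k _ _)
    (tswap (tassoc (tswap (tmap (@tswap k U V) id x)))).
Arguments tassocr {U V W}.

Lemma tassocr_linear U V W : linear (@tassocr U V W).
Proof. rewrite /tassocr; solve_linear. Qed.

Lemma tassocr_pure U V W (u : U) (v : V) (w : W) :
  tassocr ((u ⊗ v) ⊗ w) = u ⊗ v ⊗ w.
Proof.
by rewrite /tassocr ?(tmap_pure, tswap_pure, tassoc_pure).
Qed.

Lemma tassocrK U V W : cancel (@tassocr U V W) (@tassoc k U V W).
Proof.
apply: tens_ext => [||x w].
- by apply: linear_comp => //; exact: tassocr_linear.
- exact: linear_id.
apply: (@tens_ext _ _ _ _ (fun x => tassoc (tassocr (x ⊗ w)))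
  (fun x => x ⊗ w)) => [||u v] //.
  by do 2?[apply: linear_comp => //]; exact: tassocr_linear.
by rewrite tassocr_pure tassoc_pure.
Qed.

Lemma tassocK U V W : cancel (@tassoc k U V W) (@tassocr U V W).
Proof.
apply: tens_ext => [||u x].
- by apply: linear_comp => //; exact: tassocr_linear.
- exact: linear_id.
apply: (@tens_ext _ _ _ _ (fun x => tassocr (tassoc (u ⊗ x)))
  (fun x => u ⊗ x)) => [||v w] //.
  by do 2?[apply: linear_comp => //]; exact: tassocr_linear.
by rewrite tassoc_pure tassocr_pure.
Qed.

End TensorCalculus.
Hint Resolve tassocr_linear : lin.
Transparent pure tclass tens_add tens_scale tlift tswap tassoc.

(** * Graded spaces and formal sums *)

Section FiniteSums.
Variables (T : choiceType) (k : fieldType) (W : lmodType k).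

Lemma fsum_sub (f : T -> W) : finite_set [set p | f p != 0] ->
  exists F : {fset T}, forall i, i \notin F -> f i = 0.
Proof.
move=> hf; exists (fset_set [set p | f p != 0]) => i.
rewrite in_fset_set // => /negP h; apply/eqP/negPn/negP => h'.
by apply: h; apply/mem_set.
Qed.

Lemma fsum_finite (f : T -> W) (F : {fset T}) :
  (forall i, i \notin F -> f i = 0) -> finite_set [set p | f p != 0].
Proof.
move=> h; apply: (@sub_finite_set _ _ [set` F]); last exact: finite_fset.
by move=> i /=; apply: contraR => /h ->.
Qed.

Lemma fsum_lin (W' : lmodType k) (h : W -> W') (f : T -> W) : linear h ->
  finite_set [set p | f p != 0] ->
  h (\sum_(p \in [set: T]) f p) = \sum_(p \in [set: T]) h (f p).
Proof.
move=> hl /fsum_sub[F hF]; rewrite !(fsbigTE F) //; first exact: lin_sum.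
by move=> i /hF ->; rewrite lin0.
Qed.

Lemma fsum_add (f g : T -> W) :
  finite_set [set p | f p != 0] -> finite_set [set p | g p != 0] ->
  \sum_(p \in [set: T]) (f p + g p) =
  \sum_(p \in [set: T]) f p + \sum_(p \in [set: T]) g p.
Proof.
move=> /fsum_sub[F hF] /fsum_sub[F' hF'].
rewrite !(fsbigTE (F `|` F')%fset) ?big_split // => i;
  rewrite inE negb_or => /andP[h h'].
- exact: hF'.
- exact: hF.
- by rewrite hF // hF' // addr0.
Qed.

Lemma fsum_scale a (f : T -> W) : finite_set [set p | f p != 0] ->
  \sum_(p \in [set: T]) (a *: f p) = a *: \sum_(p \in [set: T]) f p.
Proof.
move=> hf; have hl : linear (fun x : W => a *: x) by [].
by rewrite (fsum_lin hl).
Qed.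

Lemma fsum_single (f : T -> W) p0 :
  (forall p, p != p0 -> f p = 0) -> \sum_(p \in [set: T]) f p = f p0.
Proof.
move=> h; rewrite (fsbigTE [fset p0]%fset) ?big_seq_fset1 // => i.
by rewrite inE => /h.
Qed.

Lemma eq_fsum (f g : T -> W) : f =1 g ->
  \sum_(p \in [set: T]) f p = \sum_(p \in [set: T]) g p.
Proof. by move=> /funext ->. Qed.

End FiniteSums.

Section GradedSpaces.
Variables (k : fieldType) (V : lmodType k) (G : int -> set V).

Lemma linspan_sub (X : set V) v : X v -> linspan X v.
Proof. by move=> hv S [_ hS]; apply: hS. Qed.

Lemma linspan_min (X S : set V) : subspace S -> X `<=` S -> linspan X `<=` S.
Proof. by move=> hS hX v; apply; split. Qed.

Lemma subspaceD (S : set V) x y : subspace S -> S x -> S y -> S (x + y).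
Proof. by move=> [_ h] hx hy; rewrite -[x]scale1r; apply: h. Qed.

Lemma subspaceZ (S : set V) a x : subspace S -> S x -> S (a *: x).
Proof. by move=> [h0 h] hx; rewrite -[_ *: _]addr0; apply: h. Qed.

Lemma subspace_sum (S : set V) I (r : seq I) (P : pred I) F : subspace S ->
  (forall i, P i -> S (F i)) -> S (\sum_(i <- r | P i) F i).
Proof.
move=> hS h; apply: (big_ind S) => //; first by case: hS.
by move=> x y; apply: subspaceD.
Qed.

Lemma subspace_fsum (S : set V) (T : choiceType) (F : T -> V) : subspace S ->
  (forall i, S (F i)) -> S (\sum_(i \in [set: T]) F i).
Proof. by move=> hS h; apply: subspace_sum. Qed.

Lemma finite_dim_is_subspace (S : set V) : finite_dim_subspace S -> subspace S.
Proof. by case=> s ->; apply: linspan_subspace. Qed.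

(* Projections onto the summands turn a family of subspaces into a grading. *)
Lemma graded_space_of_proj (P : int -> V -> V) :
  (forall i, finite_dim_subspace (G i)) ->
  (forall i, linear (P i)) -> (forall i v, G i (P i v)) ->
  (forall i v, G i v -> P i v = v) ->
  (forall i j v, G j v -> i != j -> P i v = 0) ->
  (forall v, finite_set [set i | P i v != 0] /\
     v = \sum_(i \in [set: int]) P i v) ->
  graded_space G.
Proof.
move=> hfd hl hin hid hot hs; split=> // v; exists (P^~ v); split.
  by have [h1 h2] := hs v; split.
move=> c [h1 h2 ->]; apply/funext => j; rewrite (fsum_lin (hl j)) //.
rewrite (@fsum_single _ _ _ _ j) ?hid // => i ne.
by rewrite (hot j i) // eq_sym.
Qed.

Hypothesis hG : graded_space G.

Lemma graded_subspace i : subspace (G i).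
Proof. by have [h _] := hG; apply: finite_dim_is_subspace. Qed.

Lemma graded0 i : G i 0. Proof. by case: (graded_subspace i). Qed.

Lemma hcompP v : homogeneous_decomposition G v (hcomp G ^~ v).
Proof.
have [_ /(_ v) [c [hc _]]] := hG.
by apply: (@xgetPex _ (fun=> 0) (homogeneous_decomposition G v)); exists c.
Qed.

Lemma hcomp_uniq v c : homogeneous_decomposition G v c ->
  forall i, hcomp G i v = c i.
Proof.
have [_ /(_ v) [c0 [_ hu]]] := hG => hc i.
by rewrite -(hu _ hc) (hu _ (hcompP v)).
Qed.

Lemma hcomp_in i v : G i (hcomp G i v).
Proof. by have [h _ _] := hcompP v. Qed.

Lemma hcomp_finite v : finite_set [set i | hcomp G i v != 0].
Proof. by have [_ h _] := hcompP v. Qed.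

Lemma hcomp_sum v : v = \sum_(i \in [set: int]) hcomp G i v.
Proof. by have [_ _ h] := hcompP v. Qed.

Lemma hcomp_homog j v : G j v ->
  forall i, hcomp G i v = if i == j then v else 0.
Proof.
move=> hv; apply: hcomp_uniq; split.
- by move=> i; case: eqP => [->//|_]; apply: graded0.
- apply: (@fsum_finite _ _ _ _ [fset j]%fset) => i; rewrite inE.
  by move/negbTE ->.
- by rewrite (@fsum_single _ _ _ _ j) ?eqxx // => i /negbTE ->.
Qed.

Lemma hcomp_id i v : G i v -> hcomp G i v = v.
Proof. by move/hcomp_homog ->; rewrite eqxx. Qed.

Lemma hcomp_other i j v : G j v -> i != j -> hcomp G i v = 0.
Proof. by move/hcomp_homog -> => /negbTE ->. Qed.

(** By uniqueness of decompositions, as a combination of decompositions of x and y decomposes the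
    same combination of x and y. *)
Lemma hcomp_linear i : linear (hcomp G i).
Proof.
move=> a x y; rewrite (@hcomp_uniq _ (fun i => a *: hcomp G i x + hcomp G i y)) //.
have fx := hcomp_finite x; have fy := hcomp_finite y.
have fax : finite_set [set i | a *: hcomp G i x != 0].
  have [F hF] := fsum_sub fx.
  by apply: (fsum_finite (F := F)) => j /hF ->; rewrite scaler0.
split.
- move=> j; have [_ h] := graded_subspace j.
  by apply: h; apply: hcomp_in.
- have [F hF] := fsum_sub fx; have [F' hF'] := fsum_sub fy.
  apply: (fsum_finite (F := (F `|` F')%fset)) => j; rewrite inE negb_or.
  by case/andP=> /hF -> /hF' ->; rewrite scaler0 addr0.
- by rewrite fsum_add // fsum_scale // -!hcomp_sum.
Qed.

Lemma graded_ind (P : V -> Prop) : P 0 ->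
  (forall x y, P x -> P y -> P (x + y)) -> (forall i x, G i x -> P x) ->
  forall v, P v.
Proof.
move=> h0 hD hh v; rewrite (hcomp_sum v).
have [F hF] := fsum_sub (hcomp_finite v); rewrite (fsbigTE F) //.
by apply: (big_ind P) => // i _; apply: hh (hcomp_in i v).
Qed.

End GradedSpaces.

Hint Extern 2 (GRing.linear_for _ (hcomp _ _)) =>
  (apply: hcomp_linear; assumption) : lin.

Section TensorSubspaces.
Variable k : fieldType.

Lemma tsub_subspace (U V : lmodType k) (S : set U) (T : set V) : subspace (tsub S T).
Proof. exact: linspan_subspace. Qed.

Lemma tsub_pure (U V : lmodType k) (S : set U) (T : set V) u v :
  S u -> T v -> tsub S T (u ⊗ v).
Proof. by move=> hu hv; apply: linspan_sub; exists u => //; exists v. Qed.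

Variables U V : lmodType k.

Lemma tsub_ind (S : set U) (T : set V) (P : tens U V -> Prop) :
  P 0 -> (forall a x y, P x -> P y -> P (a *: x + y)) ->
  (forall u v, S u -> T v -> P (u ⊗ v)) -> forall x, tsub S T x -> P x.
Proof.
move=> h0 hD hp; apply: (@linspan_min _ _ _ P); first by split.
by move=> _ [u hu [v hv <-]]; apply: hp.
Qed.

Lemma tsub_tmap (U' V' : lmodType k) (S : set U) (T : set V) (S' : set U')
    (T' : set V') (f : U -> U') (g : V -> V') x :
  linear f -> linear g -> (forall u, S u -> S' (f u)) ->
  (forall v, T v -> T' (g v)) -> tsub S T x -> tsub S' T' (tmap f g x).
Proof.
move=> hf hg hS hT; elim/tsub_ind => [|a y y' hy hy'|u v hu hv].
- by rewrite tmap0 //; case: (tsub_subspace S' T').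
- by rewrite tmapD // tmapZ //; case: (tsub_subspace S' T') => _; apply.
- by rewrite tmap_pure //; apply: tsub_pure; [apply: hS|apply: hT].
Qed.

Lemma tmap_eq_on (U' V' : lmodType k) (S : set U) (T : set V)
    (f f' : U -> U') (g g' : V -> V') x :
  linear f -> linear g -> linear f' -> linear g' ->
  (forall u, S u -> f u = f' u) -> (forall v, T v -> g v = g' v) ->
  tsub S T x -> tmap f g x = tmap f' g' x.
Proof.
move=> hf hg hf' hg' hS hT; elim/tsub_ind => [|a y y' hy hy'|u v hu hv].
- by rewrite !tmap0.
- by rewrite !tmapD // !tmapZ // hy hy'.
- by rewrite !tmap_pure // hS // hT.
Qed.

Lemma tmap_zero_l (U' V' : lmodType k) (S : set U) (T : set V)
    (f : U -> U') (g : V -> V') x :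
  linear f -> linear g -> (forall u, S u -> f u = 0) ->
  tsub S T x -> tmap f g x = 0.
Proof.
move=> hf hg hS; elim/tsub_ind => [|a y y' hy hy'|u v hu hv].
- by rewrite tmap0.
- by rewrite tmapD // tmapZ // hy hy' scaler0 addr0.
- by rewrite tmap_pure // hS // pure0l.
Qed.

Lemma tmap_zero_r (U' V' : lmodType k) (S : set U) (T : set V)
    (f : U -> U') (g : V -> V') x :
  linear f -> linear g -> (forall v, T v -> g v = 0) ->
  tsub S T x -> tmap f g x = 0.
Proof.
move=> hf hg hS; elim/tsub_ind => [|a y y' hy hy'|u v hu hv].
- by rewrite tmap0.
- by rewrite tmapD // tmapZ // hy hy' scaler0 addr0.
- by rewrite tmap_pure // hS // pure0r.
Qed.

(** Used to see that the summands D_i (x) B are finite-dimensional. *)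
Lemma tsub_spans (s : seq U) (t : seq V) :
  tsub (linspan [set` s]) (linspan [set` t]) =
  linspan [set` [seq u ⊗ v | u <- s, v <- t]].
Proof.
apply/seteqP; split; apply: linspan_min; try exact: linspan_subspace.
  have [h0 hD] := linspan_subspace [set` [seq u ⊗ v | u <- s, v <- t]].
  move=> _ [u hu [v hv <-]].
  refine (hu [set u | linspan [set` [seq u ⊗ v | u <- s, v <- t]] (u ⊗ v)] _).
  split; first split => [/=|a x y hx hy /=]; first by rewrite pure0l.
    by rewrite pureDl pureZl; apply: hD.
  move=> {hu}u /= hu.
  refine (hv [set v | linspan [set` [seq u ⊗ v | u <- s, v <- t]] (u ⊗ v)] _).
  split; first split => [/=|a x y hx hy /=]; first by rewrite pure0r.
    by rewrite pureDr pureZr; apply: hD.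
  move=> {hv}v /= hv; apply: linspan_sub => /=.
  by apply/allpairsP; exists (u, v).
move=> _ /= /allpairsP [[u v] /= [hu hv ->]].
by apply: tsub_pure; apply: linspan_sub.
Qed.

End TensorSubspaces.

(** * Maps of finite degree and their termwise action on formal sums *)

Section FiniteDegreeMaps.
Variable k : fieldType.

(** Two linear maps with this property can be applied to the factors of a formal sum, since then
    only finitely many of its components contribute. *)
Definition finite_degree (V W : lmodType k) (G : int -> set V) (f : V -> W) :=
  exists F : {fset int}, forall i, i \notin F -> forall x, G i x -> f x = 0.

Lemma finite_degree_comp (V W W' : lmodType k) (G : int -> set V) (f : V -> W)
    (h : W -> W') :
  linear h -> finite_degree G f -> finite_degree G (fun x => h (f x)).
Proof. by move=> hh [F hF]; exists F => i /hF hi x /hi ->; rewrite lin0. Qed.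

Lemma finite_degree_add (V W : lmodType k) (G : int -> set V) (f g : V -> W) :
  finite_degree G f -> finite_degree G g ->
  finite_degree G (fun x => f x + g x).
Proof.
move=> [F hF] [F' hF']; exists (F `|` F')%fset => i; rewrite inE negb_or.
by case/andP=> /hF hi /hF' hi' x hx; rewrite hi // hi' // addr0.
Qed.

Lemma finite_degree_eq (V W : lmodType k) (G : int -> set V) (f g : V -> W) :
  f =1 g -> finite_degree G f -> finite_degree G g.
Proof. by move=> e [F hF]; exists F => i /hF hi x /hi <-; rewrite e. Qed.

(* The sum is 0 by convention when infinitely many terms are nonzero; it is   *)
(* finite when x is in U (x)^ V and f, g have finite degree.                  *)
Definition csum (U V U' V' : lmodType k) (f : U -> U') (g : V -> V')
    (x : ctens U V) : tens U' V' :=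
  \sum_(p \in [set: int * int]) tmap f g (x p.1 p.2).

Variables (U V : lmodType k) (GU : int -> set U) (GV : int -> set V).

Lemma in_ctensD (x y : ctens U V) :
  in_ctens GU GV x -> in_ctens GU GV y -> in_ctens GU GV (x + y).
Proof.
move=> hx hy i j; exact: (subspaceD (tsub_subspace _ _) (hx i j) (hy i j)).
Qed.

Lemma in_ctensZ a (x : ctens U V) :
  in_ctens GU GV x -> in_ctens GU GV (a *: x).
Proof. move=> hx i j; exact: (subspaceZ _ (tsub_subspace _ _) (hx i j)). Qed.

Lemma in_ctensB (x y : ctens U V) :
  in_ctens GU GV x -> in_ctens GU GV y -> in_ctens GU GV (x - y).
Proof.
move=> hx hy; rewrite -[- y]scaleN1r; apply: in_ctensD => //.
exact: in_ctensZ.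
Qed.

Section Sums.
Variables (U' V' : lmodType k).
Implicit Types (f : U -> U') (g : V -> V').

Lemma csum_finite f g x : linear f -> linear g ->
  finite_degree GU f -> finite_degree GV g -> in_ctens GU GV x ->
  finite_set [set p : int * int | tmap f g (x p.1 p.2) != 0].
Proof.
move=> lf lg [F hF] [F' hF'] hx.
apply: (@fsum_finite _ _ _ (fun p : int * int => tmap f g (x p.1 p.2))
  (F `*` F')%fset) => -[i j] /=; rewrite in_fsetM /= => h.
have [hi|hi] := boolP (i \in F); last by apply: tmap_zero_l (hx i j) => //; apply: hF.
have [hj|hj] := boolP (j \in F'); last by apply: tmap_zero_r (hx i j) => //; apply: hF'.
by rewrite hi hj in h.
Qed.

Lemma eq_csum f f' g g' x : f =1 f' -> g =1 g' -> csum f g x = csum f' g' x.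
Proof. by move=> hf hg; apply: eq_fsum => p; apply: eq_tmap. Qed.

Lemma csum_comp (U'' V'' : lmodType k) (h : U' -> U'') (h' : V' -> V'') f g x :
  linear f -> linear g -> linear h -> linear h' ->
  finite_degree GU f -> finite_degree GV g -> in_ctens GU GV x ->
  csum (fun u => h (f u)) (fun v => h' (g v)) x = tmap h h' (csum f g x).
Proof.
move=> lf lg lh lh' hf hg hx; rewrite /csum fsum_lin //; last exact: csum_finite.
by apply: eq_fsum => p; rewrite tmap_comp.
Qed.

Lemma csum_addl f f' g x : linear f -> linear f' -> linear g ->
  finite_degree GU f -> finite_degree GU f' -> finite_degree GV g ->
  in_ctens GU GV x ->
  csum (fun u => f u + f' u) g x = csum f g x + csum f' g x.
Proof.
move=> lf lf' lg hf hf' hg hx; rewrite /csum -fsum_add; try exact: csum_finite.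
by apply: eq_fsum => p; rewrite tmap_addl.
Qed.

Lemma csum_addr f g g' x : linear f -> linear g -> linear g' ->
  finite_degree GU f -> finite_degree GV g -> finite_degree GV g' ->
  in_ctens GU GV x ->
  csum f (fun u => g u + g' u) x = csum f g x + csum f g' x.
Proof.
move=> lf lf' lg hf hf' hg hx; rewrite /csum -fsum_add; try exact: csum_finite.
by apply: eq_fsum => p; rewrite tmap_addr.
Qed.

Lemma csum_linear_in f g a x y : linear f -> linear g ->
  finite_degree GU f -> finite_degree GV g ->
  in_ctens GU GV x -> in_ctens GU GV y ->
  csum f g (a *: x + y) = a *: csum f g x + csum f g y.
Proof.
move=> lf lg hf hg hx hy; rewrite /csum -fsum_scale; last exact: csum_finite.
rewrite -fsum_add; last exact: csum_finite; last first.
  have [F hF] := fsum_sub (csum_finite lf lg hf hg hx).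
  by apply: (fsum_finite (F := F)) => p /hF ->; rewrite scaler0.
by apply: eq_fsum => p; rewrite -tmapZ // -tmapD.
Qed.

End Sums.

Lemma ctmap_in (U' V' : lmodType k) (GU' : int -> set U') (GV' : int -> set V')
    (f : U -> U') (g : V -> V') x :
  graded_space GU' -> graded_space GV' -> linear f -> linear g ->
  in_ctens GU GV x -> in_ctens GU' GV' (ctmap GU' GV' f g x).
Proof.
move=> hU hV lf lg hx i j; apply: (subspace_fsum (tsub_subspace _ _)) => p.
apply: tsub_tmap (hx p.1 p.2) => [||u _|v _].
- by apply: linear_comp => //; apply: hcomp_linear.
- by apply: linear_comp => //; apply: hcomp_linear.
- exact: hcomp_in.
- exact: hcomp_in.
Qed.

(** As h and h' see only the degrees i and j, they absorb the projections built into [ctmap]; a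
    single component of f (x)^ g then becomes a sum over all of x, free of projections. *)
Lemma ctmap_csum (U' V' U'' V'' : lmodType k) (GU' : int -> set U')
    (GV' : int -> set V') (f : U -> U') (g : V -> V') (h : U' -> U'')
    (h' : V' -> V'') x i j :
  graded_space GU' -> graded_space GV' -> linear f -> linear g ->
  linear h -> linear h' ->
  finite_degree GU (fun u => hcomp GU' i (f u)) ->
  finite_degree GV (fun v => hcomp GV' j (g v)) ->
  (forall u, h (hcomp GU' i u) = h u) -> (forall v, h' (hcomp GV' j v) = h' v) ->
  in_ctens GU GV x ->
  tmap h h' (ctmap GU' GV' f g x i j) =
  csum (fun u => h (f u)) (fun v => h' (g v)) x.
Proof.
move=> hU hV lf lg lh lh' ff fg ih ih' hx.
have cf : linear (fun u => hcomp GU' i (f u)).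
  by apply: linear_comp => //; apply: hcomp_linear.
have cg : linear (fun u => hcomp GV' j (g u)).
  by apply: linear_comp => //; apply: hcomp_linear.
rewrite -[LHS](csum_comp cf cg lh lh' ff fg hx).
by apply: eq_csum => ?; rewrite ?ih ?ih'.
Qed.

End FiniteDegreeMaps.

(** * Separating families *)

Section Separation.
Variable k : fieldType.

(* The maps stay jointly injective after tensoring with any space, so that    *)
(* such families are stable under tensor products.                            *)
Definition separating (I : Type) (U U' : lmodType k) (f : I -> U -> U') :=
  (forall i, linear (f i)) /\
  forall (W : lmodType k) (y : tens U W),
    (forall i, tmap (f i) id y = 0) -> y = 0.

Lemma tassocr_tmap (U V W U' V' W' : lmodType k) (f : U -> U') (g : V -> V')
    (h : W -> W') x :
  linear f -> linear g -> linear h ->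
  tassocr (tmap (tmap f g) h x) = tmap f (tmap g h) (tassocr x).
Proof.
move=> lf lg lh; have lt := tassocr_linear.
elim/tens_ind: x => [x w|x y hx hy]; last first.
  by rewrite tmapD // !(linD (@lt _ _ _ _)) tmapD // hx hy.
elim/tens_ind: x => [u v|x y hx hy]; last first.
  by rewrite pureDl tmapD // !(linD (@lt _ _ _ _)) tmapD // hx hy.
by rewrite !(tmap_pure, tassocr_pure).
Qed.

(** The freedom in W is what makes this work: read (U (x) V) (x) W as U (x) (V (x) W) to remove the
    f_i, then bring V to the front, with W (x) U' as the new spectator, to remove the g_j. *)
Lemma separating_tens (I J : Type) (U U' V V' : lmodType k)
    (f : I -> U -> U') (g : J -> V -> V') :
  separating f -> separating g ->
  separating (fun ij : I * J => tmap (f ij.1) (g ij.2)).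
Proof.
move=> [lf sf] [lg sg]; split=> [[i j]|W y hy]; first exact: tmap_linear.
have lt := tassocr_linear.
rewrite -(tassocrK y); suff -> : tassocr y = 0 by rewrite lin0.
apply: sf => i; set t := tmap _ _ _.
suff ts : tswap t = 0 by rewrite -(tswapK t) ts lin0.
rewrite -(tassocrK (tswap t)).
suff -> : tassocr (tswap t) = 0 by rewrite lin0.
apply: sg => j.
have -> : tmap (g j) id (tassocr (tswap t)) =
    tmap (g j) (tmap id id) (tassocr (tswap t)).
  by apply: eq_tmap => // x; rewrite tmap_id.
have li := lf i; have lj := lg j.
rewrite -tassocr_tmap // -tswap_tmap // /t tmap_comp //.
suff -> : tmap (fun u => f i u) (fun u => tmap (g j) id u) (tassocr y) = 0.
  by rewrite (lin0 (@tswap_linear _ _ _)) (lin0 (@lt _ _ _ _)).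
have h0 := congr1 (@tassocr _ _ _ _) (hy (i, j)).
by rewrite tassocr_tmap // (lin0 (@lt _ _ _ _)) in h0.
Qed.

(** The case W = k of the definition, through U (x) k = U. *)
Lemma separating_inj (I : Type) (U U' : lmodType k) (f : I -> U -> U') x y :
  separating f -> (forall i, f i x = f i y) -> x = y.
Proof.
move=> [lf sf] h; apply/eqP; rewrite -subr_eq0; apply/eqP.
pose phi : tens U k^o -> U := tlift (fun u (a : k^o) => (a : k) *: u).
have lb : bilinear_for *:%R *:%R (fun (u : U) (a : k^o) => (a : k) *: u).
  split=> [v a u u'|u a v v'] /=; first by rewrite scalerDr !scalerA mulrC.
  by rewrite scalerDl scalerA.
have e u : phi (u ⊗ (1 : k^o)) = u by rewrite /phi (tlift_pure lb) scale1r.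
rewrite -(e (x - y)); suff -> : (x - y) ⊗ (1 : k^o) = 0.
  by rewrite /phi (lin0 (tlift_linear lb)).
apply: sf => i; have li := lf i.
by rewrite tmap_pure // linB // h subrr pure0l.
Qed.

Section Form.
Variables (D : lmodType k) (om : D -> D -> k).
Hypothesis om_bil : bilinear_for *%R *%R om.

Lemma omDl x y z : om (x + y) z = om x z + om y z.
Proof. by have /= := om_bil.1 z 1 x y; rewrite scale1r mul1r. Qed.
Lemma omDr x y z : om z (x + y) = om z x + om z y.
Proof. by have /= := om_bil.2 z 1 x y; rewrite scale1r mul1r. Qed.
Lemma om0l z : om 0 z = 0.
Proof. by apply: (addrI (om 0 z)); rewrite -omDl !addr0. Qed.
Lemma om0r z : om z 0 = 0.
Proof. by apply: (addrI (om z 0)); rewrite -omDr !addr0. Qed.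
Lemma omZl a x z : om (a *: x) z = a * om x z.
Proof. by have /= := om_bil.1 z a x 0; rewrite !addr0 om0l addr0. Qed.
Lemma omZr a x z : om z (a *: x) = a * om z x.
Proof. by have /= := om_bil.2 z a x 0; rewrite !addr0 om0r addr0. Qed.
Lemma omNl x z : om (- x) z = - om x z.
Proof. by rewrite -scaleN1r omZl mulN1r. Qed.
Lemma omNr x z : om z (- x) = - om z x.
Proof. by rewrite -scaleN1r omZr mulN1r. Qed.
Lemma omBl x y z : om (x - y) z = om x z - om y z.
Proof. by rewrite omDl omNl. Qed.
Lemma omBr x y z : om z (x - y) = om z x - om z y.
Proof. by rewrite omDr omNr. Qed.
Lemma om_suml I (r : seq I) P F z :
  om (\sum_(i <- r | P i) F i) z = \sum_(i <- r | P i) om (F i) z.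
Proof. by apply: (big_morph (om^~ z)) => [x y|]; [exact: omDl|exact: om0l]. Qed.
Lemma om_sumr I (r : seq I) P F z :
  om z (\sum_(i <- r | P i) F i) = \sum_(i <- r | P i) om z (F i).
Proof. by apply: (big_morph (om z)) => [x y|]; [exact: omDr|exact: om0r]. Qed.

(** This is phi_w, the functional om(-, w) tensored with the identity of W. *)
Definition contract (W : lmodType k) (w : D) : tens D W -> W :=
  tlift (fun d x => om d w *: x).

Lemma contract_bilin (W : lmodType k) (w : D) :
  bilinear_for *:%R *:%R (fun d (x : W) => om d w *: x).
Proof.
split=> [v a u u'|u a v v'] /=.
  by rewrite omDl omZl scalerDl scalerA.
by rewrite scalerDr !scalerA mulrC.
Qed.

Lemma contract_linear (W : lmodType k) (w : D) : linear (@contract W w).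
Proof. by apply: tlift_linear; apply: contract_bilin. Qed.

Lemma contract_pure (W : lmodType k) (w : D) d (x : W) :
  contract w (d ⊗ x) = om d w *: x.
Proof. by rewrite /contract (tlift_pure (@contract_bilin _ _)). Qed.

Hypothesis om_nd : forall x, (forall y, om x y = 0) -> x = 0.

(** Induction on the length of a presentation of y. If its first term is d (x) x with d nonzero,
    some w has om d w nonzero, and phi_w y = 0 expresses x through the other second factors;
    substituting removes one term. *)
Lemma contract_inj (W : lmodType k) (y : tens D W) :
  (forall w, contract w y = 0) -> y = 0.
Proof.
rewrite (tens_sum_pure y).
have E w s : contract w (\sum_(p <- s) p.1 ⊗ p.2) =
    \sum_(p <- s) om p.1 w *: p.2 :> W.
  rewrite (lin_sum (@contract_linear _ _)); apply: eq_bigr => p _.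
  exact: contract_pure.
move: (repr y) => s h; have {}h w : \sum_(p <- s) om p.1 w *: p.2 = 0.
  by rewrite -E h.
have [n] := ubnP (size s); elim: n s h {E} => // n IHn [|[d x] s] h hs.
  by rewrite big_nil.
have [d0|/eqP d0] := EM (d = 0).
  rewrite big_cons d0 pure0l add0r; apply: IHn => // w.
  by have := h w; rewrite big_cons d0 om0l scale0r add0r.
have [w hw] : exists w, om d w != 0.
  apply: contrapT => /forallNP hn; case/eqP: d0; apply: om_nd => w.
  by apply/eqP/negPn/negP; apply: hn.
(* [s'] is the presentation obtained by replacing x with the value found in [xE] and collecting
   terms by second factor. *)
pose c := (om d w)^-1; pose s' := [seq (p.1 - (om p.1 w * c) *: d, p.2) | p <- s].
have xE : x = - c *: \sum_(p <- s) om p.1 w *: p.2.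
  have := h w; rewrite big_cons /= => /eqP; rewrite addrC addr_eq0 => /eqP ->.
  by rewrite scaleNr scalerN opprK scalerA mulVf ?scale1r.
have key : \sum_(p <- s') p.1 ⊗ p.2 = 0.
  apply: IHn; last by rewrite size_map.
  move=> v; rewrite big_map /=; apply: etrans (h v); rewrite big_cons /= xE [RHS]addrC.
  rewrite scalerA scaler_sumr -big_split /=; apply: eq_bigr => p _.
  by rewrite scalerA -scalerDl omBl omZl; congr (_ *: _); ring.
apply: etrans key; rewrite big_map big_cons /= xE [LHS]addrC pureZr.
rewrite (lin_sum (@pure_linr _ _ _ d)) scaler_sumr -big_split /=.
apply: eq_bigr => p _; rewrite pureDl -scaleNr pureZl pureZr scalerA.
by congr (_ + _ *: _); ring.
Qed.

(** Up to rebracketing, phi_w (x) id on (D (x) W) (x) V is phi_w on D (x) (W (x) V), where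
    [contract_inj] applies. *)
Lemma separating_contract (W : lmodType k) : separating (@contract W).
Proof.
split=> [w|V y hy]; first exact: contract_linear.
rewrite -(tassocrK y); suff -> : tassocr y = 0 by rewrite lin0.
apply: contract_inj => w; rewrite -(hy w).
have lt := tassocr_linear; have lc := contract_linear; have lw := lc W w.
elim/tens_ind: y {hy} => [x v|x y hx hy]; last first.
  rewrite (linD (@lt _ _ _ _)) (linD (@lc _ _)) tmapD //.
  exact: (congr2 _ hx hy).
elim/tens_ind: x => [d b|x y hx hy]; last first.
  rewrite pureDl (linD (@lt _ _ _ _)) (linD (@lc _ _)) tmapD //.
  exact: (congr2 _ hx hy).
by rewrite tassocr_pure tmap_pure // !contract_pure pureZl.
Qed.

End Form.
End Separation.

(** * Graded nondegenerate forms *)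

Section GradedForm.
Variables (k : fieldType) (D : lmodType k) (G : int -> set D).
Variable om : D -> D -> k.
Hypothesis hG : graded_space G.
Hypothesis om_bil : bilinear_for *%R *%R om.
Hypothesis om_skew : forall x y, om x y = - om y x.
Hypothesis om_nd : forall x, (forall y, om x y = 0) -> x = 0.
Variable m : int.
Hypothesis om_graded : forall i j x y,
  G i x -> G j y -> i + j + m != 0 -> om x y = 0.

(** The only degree that a form graded with shift m can pair nontrivially with degree i. *)
Definition dual_deg (m i : int) : int := - i - m.
Local Notation "i ^@" := (dual_deg m i) (at level 1, format "i ^@").

Lemma dual_degK i : (i^@)^@ = i.
Proof. rewrite /dual_deg; ring. Qed.

Lemma dual_deg_eq i j : (i + j + m == 0) = (j == i^@).
Proof.
rewrite -[RHS]subr_eq0 /dual_deg; congr (_ == _); ring.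
Qed.

Lemma om_homog0 i j x y : G i x -> G j y -> j != i^@ -> om x y = 0.
Proof. by move=> hx hy; rewrite -dual_deg_eq; apply: om_graded hx hy. Qed.

Lemma om_hcompr i x y : G i x -> om x (hcomp G (i^@) y) = om x y.
Proof.
move=> hx; elim/(graded_ind hG): y => [|y z hy hz|j y hy].
- by rewrite (lin0 (hcomp_linear hG _)).
- by rewrite (linD (hcomp_linear hG _)) !omDr // hy hz.
rewrite (hcomp_homog hG hy); case: eqP => // /eqP ne.
by rewrite om0r // (om_homog0 hx hy) // eq_sym.
Qed.

(** The other degrees pair to zero with r anyway, and skew-symmetry moves r to the side on which
    nondegeneracy is assumed. *)
Lemma om_nd_homog i r : G (i^@) r -> (forall x, G i x -> om x r = 0) -> r = 0.
Proof.
move=> hr h; apply: om_nd => x; rewrite om_skew.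
suff -> : om x r = 0 by rewrite oppr0.
elim/(graded_ind hG): x => [|x y hx hy|j x hx]; first by rewrite om0l.
  by rewrite omDl // hx hy addr0.
have [ji|ji] := eqVneq j i; first by apply: h; rewrite -ji.
apply: om_homog0 hx hr _; apply: contra ji => /eqP e.
by rewrite -[i]dual_degK e dual_degK.
Qed.

(* Gram-Schmidt: a new vector y0 is corrected by its projection P y0, and the *)
(* dual vector of the remainder by the pairs already found.                   *)
Lemma dual_pairs i : exists L : seq (D * D),
  (forall p, p \in L -> G i p.1 /\ G (i^@) p.2) /\
  forall y, G (i^@) y -> y = \sum_(p <- L) om p.1 y *: p.2.
Proof.
have [s hs] := (hG.1 (i^@)).
suff [L [hL1 hL2]] : exists L : seq (D * D),
    (forall p, p \in L -> G i p.1 /\ G (i^@) p.2) /\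
    forall y, y \in s -> y = \sum_(p <- L) om p.1 y *: p.2.
  exists L; split=> // y; rewrite hs.
  apply: (@linspan_min _ _ _ [set y | y = \sum_(p <- L) om p.1 y *: p.2]).
    split=> [/=|a u v /= hu hv].
      by rewrite big1 // => p _; rewrite om0r // scale0r.
    rewrite {1}hu {1}hv scaler_sumr -big_split /=; apply: eq_bigr => p _.
    by rewrite omDr // omZr // scalerDl scalerA.
  by move=> y0 /= /hL2.
have {hs} : forall y, y \in s -> G (i^@) y.
  by move=> y hy; rewrite hs; apply: linspan_sub.
elim: s => [|y0 s IHs] hs; first by exists [::].
have [y hy|L [hL1 hL2]] := IHs; first by apply: hs; rewrite inE hy orbT.
pose P y := \sum_(p <- L) om p.1 y *: p.2; pose r := y0 - P y0.
have hr : G (i^@) r.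
  have hS := graded_subspace hG (i^@).
  rewrite /r -scaleN1r; apply: subspaceD => //.
    by apply: hs; rewrite inE eqxx.
  apply: subspaceZ => //; rewrite /P big_seq; apply: subspace_sum => // p.
  by move=> /hL1[_ hp]; apply: subspaceZ.
have [r0|/eqP rn0] := EM (r = 0).
  exists L; split=> // y; rewrite inE => /orP[/eqP ->|/hL2//].
  by apply/eqP; rewrite -subr_eq0; apply/eqP.
have [x hx hxr] : exists2 x, G i x & om x r != 0.
  apply: contrapT => hn; case/eqP: rn0; apply: om_nd_homog hr _ => x hx.
  by apply/eqP/negPn/negP => hxr; apply: hn; exists x.
pose c := (om x r)^-1.
pose x' := c *: (x - \sum_(p <- L) om x p.2 *: p.1).
exists ((x', r) :: L); split.
  move=> p; rewrite inE => /orP[/eqP ->|/hL1//]; split=> //=.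
  have hS := graded_subspace hG i.
  apply: subspaceZ => //; rewrite -scaleN1r; apply: subspaceD => //.
  apply: subspaceZ => //; rewrite big_seq; apply: subspace_sum => // q /hL1[hq _].
  exact: subspaceZ.
have key y : om x' y = c * om x (y - P y).
  rewrite /x' omZl // omBl // omBr //; congr (_ * (_ - _)).
  rewrite om_suml // /P om_sumr //; apply: eq_bigr => p _.
  by rewrite omZl // omZr // mulrC.
move=> y; rewrite inE big_cons /= key -/(P y) => /orP[/eqP ->|hy].
  by rewrite -/r /c mulVf // scale1r /r subrK.
by rewrite /P -(hL2 _ hy) subrr om0r // mulr0 scale0r add0r.
Qed.

Lemma om_contract_tlift (x : tens D D) y y' :
  tlift (fun u u' => om u y * om u' y') x = om (contract om y x) y'.
Proof.
rewrite /contract /tlift om_suml //; apply: eq_bigr => p _.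
by rewrite omZl.
Qed.

Lemma om_contract_pure u v y y' :
  om (contract om y (u ⊗ v)) y' = om u y * om v y'.
Proof. by rewrite contract_pure // omZl. Qed.

(** This gives uniqueness of [theta]: nondegeneracy in both factors, tested componentwise. *)
Lemma ctens_homog_ext (x x' : ctens D D) :
  in_ctens G G x -> in_ctens G G x' ->
  (forall a b y z, G a y -> G b z ->
     om (contract om y (x (a^@) (b^@))) z =
     om (contract om y (x' (a^@) (b^@))) z) -> x = x'.
Proof.
move=> hx hx' h; apply/funext => i; apply/funext => j.
apply/eqP; rewrite -subr_eq0; apply/eqP.
have hd : tsub (G i) (G j) (x i j - x' i j).
  have [_ hD] := tsub_subspace (G i) (G j).
  by rewrite addrC -scaleN1r; apply: hD.
apply: (contract_inj om_bil om_nd) => w; apply: om_nd => w'.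
(* On D_i (x) D_j the arguments w, w' count only through their components in the dual degrees. *)
have -> : om (contract om w (x i j - x' i j)) w' =
    om (contract om (hcomp G (i^@) w) (x i j - x' i j)) (hcomp G (j^@) w').
  elim/tsub_ind: hd => [|a u v hu hv|u v hu hv].
  - by rewrite !(lin0 (contract_linear om_bil _)) !om0l.
  - by rewrite !(contract_linear om_bil) !omDl // !omZl // hu hv.
  - by rewrite !om_contract_pure !om_hcompr.
have := h _ _ _ _ (hcomp_in hG (i^@) w) (hcomp_in hG (j^@) w').
rewrite !dual_degK (linB (contract_linear om_bil _)) omBl // => ->.
by rewrite subrr.
Qed.

Section Theta.
Variable op : D -> D -> D.
Hypothesis op_bil : bilinear_for *:%R *:%R op.

Let opl y : linear (op^~ y). Proof. exact: op_bil.1. Qed.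
Let opr y : linear (op y). Proof. exact: op_bil.2. Qed.

Lemma om_hat_homog (x : ctens D D) a b y z : in_ctens G G x ->
  G a y -> G b z -> om_hat om x y z = om (contract om y (x (a^@) (b^@))) z.
Proof.
move=> hx hy hz; rewrite /om_hat.
rewrite (@fsum_single _ _ (k^o) _ (a^@, b^@)) /= ?om_contract_tlift // => -[i j].
rewrite xpair_eqE negb_and om_contract_tlift /= => ne.
elim/tsub_ind: (hx i j) => [|c u v hu hv|u v hu hv].
- by rewrite !(lin0 (contract_linear om_bil _)) !om0l.
- by rewrite !(contract_linear om_bil) !omDl // !omZl // hu hv mulr0 addr0.
rewrite om_contract_pure.
case/orP: ne => ne; [rewrite (om_homog0 hu hy) ?mul0r //|
  rewrite (om_homog0 hv hz) ?mulr0 //];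
  by apply: contra ne => /eqP ->; rewrite dual_degK.
Qed.

(** With dual families (p.1, p.2) of D_i and its dual degree, the (i, j) component is the sum of
    om(d, op p.2 q.2) p.1 (x) q.1. Pairing it with y and z reassembles the components of y and z. *)
Lemma theta_exists d : exists x, in_ctens G G x /\
  forall d2 d3, om_hat om x d2 d3 = om d (op d2 d3).
Proof.
have [L hL] := choice dual_pairs.
pose x : ctens D D := fun i j => \sum_(p <- L i) \sum_(q <- L j)
  om d (op p.2 q.2) *: (p.1 ⊗ q.1).
exists x; split=> [i j|y z].
  rewrite /x big_seq; apply: (subspace_sum _ (tsub_subspace (G i) (G j))) => p hp.
  rewrite big_seq; apply: (subspace_sum _ (tsub_subspace (G i) (G j))) => q hq.
  apply: (subspaceZ _ (tsub_subspace (G i) (G j))); apply: tsub_pure.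
    by case: (hL i) => /(_ _ hp)[].
  by case: (hL j) => /(_ _ hq)[].
(* The part of om(d, op y z) coming from one pair of components of y and z. [om_hat] is the sum of
   these, and by additivity it suffices to compare it with om(d, op y z) for homogeneous y, z, where
   one term survives. *)
pose F y z (p : int * int) : k^o :=
  om d (op (hcomp G (p.1^@) y) (hcomp G (p.2^@) z)).
have hF i y0 : hcomp G (i^@) y0 = \sum_(p <- L i) om p.1 y0 *: p.2.
  have [h1 h2] := hL i; rewrite {1}(h2 _ (hcomp_in hG _ _)).
  apply: eq_big_seq => p hp; rewrite om_hcompr //.
  by case: (h1 _ hp).
have -> : om_hat om x y z = \sum_(p \in [set: int * int]) F y z p.
  rewrite /om_hat; apply: (@eq_fsum _ _ (k^o)) => -[i j] /=.
  rewrite om_contract_tlift /F /= !hF /x.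
  rewrite (lin_sum (contract_linear om_bil _)) om_suml //.
  rewrite (lin_sum (opl _)) om_sumr //; apply: eq_bigr => p _.
  rewrite (lin_sum (contract_linear om_bil _)) om_suml //.
  rewrite (lin_sum (opr _)) om_sumr //; apply: eq_bigr => q _.
  rewrite (linZ (contract_linear om_bil _)) omZl // om_contract_pure.
  rewrite (linZ (opl _)) (linZ (opr _)) !omZr //; ring.
have Ffin y0 z0 : finite_set [set p | F y0 z0 p != 0].
  have [A hA] := fsum_sub (hcomp_finite hG y0).
  have [C hC] := fsum_sub (hcomp_finite hG z0).
  apply: (fsum_finite (F := ((dual_deg m @` A) `*` (dual_deg m @` C))%fset)).
  move=> [i j]; rewrite in_fsetM negb_and /= /F /= => /orP[] ne.
    rewrite hA ?(lin0 (opl _)) ?om0r //; apply: contra ne => hi.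
    by apply/imfsetP; exists (i^@); rewrite ?dual_degK.
  rewrite hC ?(lin0 (opr _)) ?om0r //; apply: contra ne => hi.
  by apply/imfsetP; exists (j^@); rewrite ?dual_degK.
have hcD i := linD (hcomp_linear hG i).
elim/(graded_ind hG): y => [|y y' hy hy'|a y hy].
- rewrite (lin0 (opl _)) om0r // (@fsum_single _ _ (k^o) _ (0, 0)) => [|p _];
    by rewrite /F (lin0 (hcomp_linear hG _)) (lin0 (opl _)) om0r.
- rewrite (linD (opl _)) omDr // -hy -hy'.
  apply: etrans (fsum_add (Ffin y z) (Ffin y' z)).
  by apply: (@eq_fsum _ _ (k^o)) => p; rewrite /F hcD (linD (opl _)) omDr.
elim/(graded_ind hG): z => [|z z' hz hz'|b z hz].
- rewrite (lin0 (opr _)) om0r // (@fsum_single _ _ (k^o) _ (0, 0)) => [|p _];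
    by rewrite /F (lin0 (hcomp_linear hG _)) (lin0 (opr _)) om0r.
- rewrite (linD (opr _)) omDr // -hz -hz'.
  apply: etrans (fsum_add (Ffin y z) (Ffin y z')).
  by apply: (@eq_fsum _ _ (k^o)) => p; rewrite /F hcD (linD (opr _)) omDr.
rewrite (@fsum_single _ _ (k^o) _ (a^@, b^@)).
  by rewrite /F /= !dual_degK !(hcomp_id hG).
move=> [i j]; rewrite xpair_eqE negb_and /F /=.
rewrite (hcomp_homog hG hy) (hcomp_homog hG hz) => /orP[] ne.
  have -> : (i^@ == a) = false.
    by apply/negbTE; apply: contra ne => /eqP <-; rewrite dual_degK.
  by rewrite (lin0 (opl _)) om0r.
have -> : (j^@ == b) = false.
  by apply/negbTE; apply: contra ne => /eqP <-; rewrite dual_degK.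
by rewrite (lin0 (opr _)) om0r.
Qed.

Lemma theta_spec d : in_ctens G G (theta G om op d) /\
  forall d2 d3, om_hat om (theta G om op d) d2 d3 = om d (op d2 d3).
Proof. exact: (@xgetPex _ 0 _ (theta_exists d)). Qed.

Lemma theta_in d : in_ctens G G (theta G om op d).
Proof. by case: (theta_spec d). Qed.

Lemma theta_homog d a b y z : G a y -> G b z ->
  om (contract om y (theta G om op d (a^@) (b^@))) z = om d (op y z).
Proof.
move=> hy hz; have [h1 h2] := theta_spec d.
by rewrite -(om_hat_homog h1 hy hz).
Qed.

(** [theta] is defined by choice, so linearity must come from uniqueness: both sides have the same
    pairings. *)
Lemma theta_linear : linear (theta G om op).
Proof.
move=> c d d'; apply: ctens_homog_ext.
- exact: theta_in.
- by apply: in_ctensD; [apply: in_ctensZ|]; apply: theta_in.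
move=> a b y z hy hz; rewrite theta_homog // omDl // omZl //.
rewrite -[(_ + _) (a^@) (b^@)]/(c *: (theta G om op d (a^@) (b^@))
  + theta G om op d' (a^@) (b^@)).
by rewrite (contract_linear om_bil) omDl // omZl // !theta_homog.
Qed.

End Theta.
End GradedForm.

(** * The product of D (x) D and B (x) B with values in (D (x) B) (x) (D (x) B) *)

Section TensorBilinear.
Variables (k : fieldType).

Lemma tbullet_bilin (D B : lmodType k) (y : tens B B) :
  bilinear_for *:%R *:%R
    (fun d' d'' : D => tmap (pure d') (pure d'') y : tens (tens D B) (tens D B)).
Proof.
apply: bilinP => [d''|d'] a x x'.
  by rewrite -tmap_scalel -tmap_addl; apply: eq_tmap => // b;
    rewrite pureDl pureZl.
by rewrite -tmap_scaler -tmap_addr; apply: eq_tmap => // b;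
  rewrite pureDl pureZl.
Qed.

Lemma tbullet_pure (D B : lmodType k) (d d' : D) (y : tens B B) :
  tbullet (d ⊗ d') y = tmap (pure d) (pure d') y.
Proof. by rewrite /tbullet (tlift_pure (@tbullet_bilin D B y)). Qed.

Lemma tbullet_linearl (D B : lmodType k) (y : tens B B) :
  linear (fun x : tens D D => tbullet x y).
Proof. exact: tlift_linear (@tbullet_bilin D B y). Qed.

Lemma tbullet_linearr (D B : lmodType k) (x : tens D D) :
  linear (fun y : tens B B => tbullet x y).
Proof.
move=> a y y'; elim/tens_ind: x => [d d'|x x' hx hx'].
  by rewrite !tbullet_pure tmapD // tmapZ.
by rewrite !(linD (@tbullet_linearl D B _)) hx hx' scalerDr addrACA.
Qed.

Lemma tbullet_in (D B : lmodType k) (S T : set D) (x : tens D D)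
    (y : tens B B) :
  tsub S T x -> tsub (tsub S [set: B]) (tsub T [set: B]) (tbullet x y).
Proof.
set P := tsub (tsub _ _) _; have hP : subspace P by apply: tsub_subspace.
elim/tsub_ind => [|a u v hu hv|u v hu hv].
- by rewrite (lin0 (@tbullet_linearl D B y)); exact: hP.1.
- by rewrite (@tbullet_linearl D B y); exact: (hP.2 a _ _ hu hv).
rewrite tbullet_pure; elim/tens_ind: y => [b b'|y y' hy hy'].
  by rewrite tmap_pure //; apply: tsub_pure; apply: tsub_pure.
by rewrite tmapD //; exact: (subspaceD hP hy hy').
Qed.

End TensorBilinear.

(** * Affinization *)

Section AffineGrading.
Variables (k : fieldType) (D : lmodType k) (G : int -> set D).
Hypothesis hG : graded_space G.

(** B sits in degree zero: the projections are those of D tensored with the identity, and a basis of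
    B makes each summand finite-dimensional. *)
Lemma aff_graded_space (B : vectType k) :
  graded_space (aff_grading (B := B) G).
Proof.
have hl i := hcomp_linear hG i.
apply: (@graded_space_of_proj _ _ _ (fun i => tmap (hcomp G i) id)).
- move=> i; have [s hs] := hG.1 i.
  exists [seq u ⊗ v | u <- s, v <- vbasis {: B}].
  rewrite -tsub_spans -hs; congr tsub; apply/seteqP; split=> // b _.
  rewrite (coord_vbasis (memvf b)); apply: (subspace_sum _ (linspan_subspace _)) => i0 _.
  apply: (subspaceZ _ (linspan_subspace _)).
  by apply: linspan_sub; apply: mem_nth; rewrite size_tuple.
- by move=> i; apply: tmap_linear.
- move=> i; elim/tens_ind => [d b|x y hx hy].
    by rewrite tmap_pure //; apply: tsub_pure => //; apply: hcomp_in.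
  by rewrite tmapD //; exact: (subspaceD (tsub_subspace _ _) hx hy).
- move=> i v hv; rewrite -[RHS]tmap_id; apply: tmap_eq_on hv => //.
  by move=> u; apply: hcomp_id.
- move=> i j v hv ne; apply: tmap_zero_l hv => // u hu.
  exact: hcomp_other hu ne.
elim/tens_ind => [d b|x y [fx hx] [fy hy]].
  have [F hF] := fsum_sub (hcomp_finite hG d).
  split.
    by apply: (fsum_finite (F := F)) => i /hF hi; rewrite tmap_pure // hi pure0l.
  rewrite {1}(hcomp_sum hG d) (fsum_lin (@pure_linl _ _ _ b)).
    by apply: eq_fsum => i; rewrite tmap_pure.
  exact: hcomp_finite.
split; last first.
  rewrite {1}hx {1}hy -fsum_add //; apply: eq_fsum => i; rewrite tmapD //.
have [F hF] := fsum_sub fx; have [F' hF'] := fsum_sub fy.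
apply: (fsum_finite (F := (F `|` F')%fset)) => i; rewrite inE negb_or.
by case/andP=> hi hi'; rewrite tmapD // hF // hF' // addr0.
Qed.

End AffineGrading.

(** * Testing the coproduct on D (x) B with the maps phi_w *)

Section AffineTests.
Variables (k : fieldType) (D : lmodType k) (G : int -> set D).
Variable om : D -> D -> k.
Hypothesis hG : graded_space G.
Hypothesis om_bil : bilinear_for *%R *%R om.
Hypothesis om_skew : forall x y, om x y = - om y x.
Hypothesis om_nd : forall x, (forall y, om x y = 0) -> x = 0.
Variable m : int.
Hypothesis om_graded : forall i j x y,
  G i x -> G j y -> i + j + m != 0 -> om x y = 0.

Local Notation "i ^@" := (dual_deg m i) (at level 1, format "i ^@").

Variable B : vectType k.
Local Notation A := (tens D B).
Local Notation GA := (aff_grading (B := B) G).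
Local Notation phi w := (@contract k D om B w).

Let phi_lin w : linear (phi w). Proof. exact: contract_linear. Qed.
Local Hint Resolve phi_lin : lin.

Lemma contractDr u v x : phi (u + v) x = phi u x + phi v x.
Proof.
rewrite /contract -tliftD; apply: eq_tlift => d b.
by rewrite omDr // scalerDl.
Qed.

Lemma contractZr a u x : phi (a *: u) x = a *: phi u x.
Proof.
rewrite /contract -tliftZ; apply: eq_tlift => d b.
by rewrite omZr // scalerA.
Qed.

Lemma contract0r x : phi 0 x = 0.
Proof. by rewrite -(scale0r (0 : D)) contractZr scale0r. Qed.

Lemma contract_hcomp i w x : GA i x -> phi (hcomp G (i^@) w) x = phi w x.
Proof.
elim/tsub_ind => [|a u v hu hv|u v hu hv].
- by rewrite !(lin0 (phi_lin _)).
- by rewrite !(linD (phi_lin _)) !(linZ (phi_lin _)) hu hv.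
by rewrite !contract_pure // (om_hcompr hG om_bil om_graded).
Qed.

Lemma contract_homog0 i j w x : G j w -> GA i x -> i != j^@ -> phi w x = 0.
Proof.
move=> hw hx ne; rewrite -(contract_hcomp w hx) (hcomp_homog hG hw).
case: eqP => [e|_]; last exact: contract0r.
by case/eqP: ne; rewrite -e dual_degK.
Qed.

(** A homogeneous w meets only the dual degree, and an arbitrary w is a finite sum of homogeneous
    ones. *)
Lemma contract_finite_degree w : finite_degree GA (phi w).
Proof.
elim/(graded_ind hG): w => [|u v hu hv|a w hw].
- by exists fset0 => i _ x _; rewrite contract0r.
- by apply: (finite_degree_eq (f := fun x => phi u x + phi v x)) => [x|];
    [rewrite contractDr|apply: finite_degree_add].
- by exists [fset a^@]%fset => i; rewrite inE => ne x hx;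
    apply: contract_homog0 hw hx ne.
Qed.

Let hGA : graded_space GA. Proof. exact: aff_graded_space. Qed.

Lemma contract_aff_hcomp i w x : G (i^@) w -> phi w (hcomp GA i x) = phi w x.
Proof.
move=> hw; elim/(graded_ind hGA): x => [|x y hx hy|j x hx].
- by rewrite (lin0 (hcomp_linear hGA _)).
- by rewrite (linD (hcomp_linear hGA _)) !(linD (phi_lin _)) hx hy.
rewrite (hcomp_homog hGA hx); case: eqP => // /eqP ne.
rewrite (lin0 (phi_lin _)) (contract_homog0 hw hx) // dual_degK.
by rewrite eq_sym.
Qed.

Lemma separating_aff :
  separating (fun uv : D * D => tmap (phi uv.1) (phi uv.2)).
Proof. by apply: separating_tens; apply: separating_contract. Qed.

(** Homogeneous tests of the dual degrees suffice, as other components of u and v do not act on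
    degrees i and j. *)
Lemma aff_tens_ext i j (x y : tens A A) :
  tsub (GA i) (GA j) x -> tsub (GA i) (GA j) y ->
  (forall u v, G (i^@) u -> G (j^@) v ->
     tmap (phi u) (phi v) x = tmap (phi u) (phi v) y) -> x = y.
Proof.
move=> hx hy h; apply: (separating_inj separating_aff) => -[u v] /=.
have e z : tsub (GA i) (GA j) z -> tmap (phi u) (phi v) z =
    tmap (phi (hcomp G (i^@) u)) (phi (hcomp G (j^@) v)) z.
  by apply: tmap_eq_on => // a ha; rewrite contract_hcomp.
by rewrite !e //; apply: h; apply: hcomp_in.
Qed.

Lemma aff_ctens_ext (x y : ctens A A) : in_ctens GA GA x -> in_ctens GA GA y ->
  (forall i j u v, G (i^@) u -> G (j^@) v ->
     tmap (phi u) (phi v) (x i j) = tmap (phi u) (phi v) (y i j)) -> x = y.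
Proof.
move=> hx hy h; apply/funext => i; apply/funext => j.
by apply: aff_tens_ext (hx i j) (hy i j) _ => u v; apply: h.
Qed.

Lemma aff_tens3_ext i j l (x y : tens (tens A A) A) :
  tsub (tsub (GA i) (GA j)) (GA l) x -> tsub (tsub (GA i) (GA j)) (GA l) y ->
  (forall u v w, G (i^@) u -> G (j^@) v -> G (l^@) w ->
     tmap (tmap (phi u) (phi v)) (phi w) x =
     tmap (tmap (phi u) (phi v)) (phi w) y) -> x = y.
Proof.
move=> hx hy h.
have s3 := separating_tens separating_aff (separating_contract om_bil om_nd B).
apply: (separating_inj s3) => -[[u v] w] /=.
have e z : tsub (tsub (GA i) (GA j)) (GA l) z ->
    tmap (tmap (phi u) (phi v)) (phi w) z =
    tmap (tmap (phi (hcomp G (i^@) u)) (phi (hcomp G (j^@) v)))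
      (phi (hcomp G (l^@) w)) z.
  apply: tmap_eq_on => // a ha; last by rewrite contract_hcomp.
  by apply: tmap_eq_on ha => // b hb; rewrite contract_hcomp.
by rewrite !e //; apply: h; apply: hcomp_in.
Qed.

Variables dl dr : D -> D -> D.
Hypothesis dl_bil : bilinear_for *:%R *:%R dl.
Hypothesis dr_bil : bilinear_for *:%R *:%R dr.
Variable nu : B -> tens B B.
Hypothesis nu_lin : linear nu.
Local Hint Resolve nu_lin : lin.

Local Notation th := (theta G om).

Lemma aff_comul_bilin : bilinear_for *:%R *:%R (fun d b =>
  ctbullet (th dr d) (nu b) + ctbullet (th dl d) (tswap (nu b))
  : ctens (tens D B) (tens D B)).
Proof.
have tl op hop d d' a := theta_linear hG om_bil om_skew om_nd om_graded
  (op := op) hop a d d'.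
apply: bilinP => [b|d] a x y; apply/funext => i; apply/funext => j.
  rewrite !tl //.
  transitivity (tbullet (a *: th dr x i j + th dr y i j) (nu b) +
    tbullet (a *: th dl x i j + th dl y i j) (tswap (nu b))) => //.
  rewrite !(@tbullet_linearl k D B _) addrACA -scalerDr.
  by [].
transitivity (tbullet (th dr d i j) (nu (a *: x + y)) +
  tbullet (th dl d i j) (tswap (nu (a *: x + y)))) => //.
rewrite nu_lin tswapD tswapZ !(@tbullet_linearr k D B _) addrACA -scalerDr.
by [].
Qed.

Local Notation De := (aff_comul G dl dr om nu).

Lemma aff_comul_linear : linear De.
Proof. exact: tlift_linear aff_comul_bilin. Qed.

Lemma aff_comul_pure d b i j : De (d ⊗ b) i j =
  tbullet (th dr d i j) (nu b) + tbullet (th dl d i j) (tswap (nu b)).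
Proof. by rewrite /aff_comul (tlift_pure aff_comul_bilin). Qed.

Lemma aff_comul_in x : in_ctens GA GA (De x).
Proof.
have ti op hop d := theta_in hG om_bil om_skew om_nd om_graded
  (op := op) hop d.
elim/tens_ind: x => [d b|x y hx hy]; last first.
  by rewrite (linD aff_comul_linear); apply: in_ctensD.
move=> i j; rewrite aff_comul_pure; apply: (subspaceD (tsub_subspace _ _)).
- by apply: tbullet_in; apply: ti.
- by apply: tbullet_in; apply: ti.
Qed.

Lemma tmap_contract_tbullet u v (x : tens D D) (y : tens B B) :
  tmap (phi u) (phi v) (tbullet x y) = om (contract om u x) v *: y.
Proof.
elim/tens_ind: x => [d d'|x x' hx hx'].
  rewrite tbullet_pure om_contract_pure //.
  elim/tens_ind: y => [b b'|y y' hy hy']; last first.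
    by rewrite !tmapD // hy hy' scalerDr.
  by rewrite !tmap_pure // !contract_pure // pureZl pureZr scalerA.
rewrite (linD (@tbullet_linearl k D B _)) tmapD // hx hx' -scalerDl.
by rewrite (linD (contract_linear om_bil _)) omDl.
Qed.

(** On d (x) b, pairing theta(d) with u and v gives the scalars om(d, u |- v) and om(d, u -| v);
    these are absorbed into nu as the values of phi on d (x) b. *)
Lemma aff_comul_test i j u v x : G (i^@) u -> G (j^@) v ->
  tmap (phi u) (phi v) (De x i j) =
  nu (phi (dr u v) x) + tswap (nu (phi (dl u v) x)).
Proof.
move=> hu hv; elim/tens_ind: x => [d b|x y hx hy]; last first.
  rewrite (linD aff_comul_linear) [LHS]tmapD // hx hy.
  by rewrite !(linD (phi_lin _)) !(linD nu_lin) tswapD addrACA.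
have th_test op hop := @theta_homog _ _ _ _ hG om_bil om_skew om_nd _ om_graded
  op hop d _ _ _ _ hu hv.
rewrite aff_comul_pure tmapD // !tmap_contract_tbullet.
have := th_test _ dr_bil; have := th_test _ dl_bil.
rewrite !dual_degK => -> ->.
by rewrite !contract_pure // !(linZ nu_lin) tswapZ.
Qed.

Lemma csum_homog (x : ctens A A) i j u v : in_ctens GA GA x ->
  G (i^@) u -> G (j^@) v ->
  csum (phi u) (phi v) x = tmap (phi u) (phi v) (x i j).
Proof.
move=> hx hu hv; rewrite /csum (@fsum_single _ _ _ _ (i, j)) // => -[a b].
rewrite xpair_eqE negb_and /= => /orP[] ne.
  apply: tmap_zero_l (hx a b) => // y hy.
  by apply: contract_homog0 hu hy _; rewrite dual_degK.
apply: tmap_zero_r (hx a b) => // y hy.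
by apply: contract_homog0 hv hy _; rewrite dual_degK.
Qed.

Lemma csum_contract_linl (x : ctens A A) u u' v : in_ctens GA GA x ->
  csum (phi (u + u')) (phi v) x = csum (phi u) (phi v) x + csum (phi u') (phi v) x.
Proof.
move=> hx; have ff := contract_finite_degree.
rewrite -(csum_addl (phi_lin u) (phi_lin u') (phi_lin v)
  (ff u) (ff u') (ff v) hx).
by apply: eq_csum => // y; rewrite contractDr.
Qed.

Lemma csum_contract_linr (x : ctens A A) u v v' : in_ctens GA GA x ->
  csum (phi u) (phi (v + v')) x = csum (phi u) (phi v) x + csum (phi u) (phi v') x.
Proof.
move=> hx; have ff := contract_finite_degree.
rewrite -(csum_addr (phi_lin u) (phi_lin v) (phi_lin v')
  (ff u) (ff v) (ff v') hx).
by apply: eq_csum => // y; rewrite contractDr.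
Qed.

(** The form of [aff_comul_test] for arbitrary u and v. It is needed because moving a factor d
    across om replaces u by products with d, and d need not be homogeneous. *)
Lemma csum_comul u v x : csum (phi u) (phi v) (De x) =
  nu (phi (dr u v) x) + tswap (nu (phi (dl u v) x)).
Proof.
have hin := aff_comul_in x.
have rl y : linear (dr^~ y) := dr_bil.1 y.
have rr y : linear (dr y) := dr_bil.2 y.
have ll y : linear (dl^~ y) := dl_bil.1 y.
have lr y : linear (dl y) := dl_bil.2 y.
have z0 (f : A -> B) : csum (fun _ : A => 0 : B) f (De x) = 0.
  rewrite /csum (@fsum_single _ _ _ _ (0, 0)) => [|p _].
    by rewrite /tmap; apply: big1 => p _; rewrite pure0l.
  by apply: big1 => q _; rewrite pure0l.
have z0' (f : A -> B) : csum f (fun _ : A => 0 : B) (De x) = 0.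
  rewrite /csum (@fsum_single _ _ _ _ (0, 0)) => [|p _].
    by rewrite /tmap; apply: big1 => p _; rewrite pure0r.
  by apply: big1 => q _; rewrite pure0r.
elim/(graded_ind hG): u => [|u u' hu hu'|a u hu].
- rewrite (lin0 (rl v)) (lin0 (ll v)) !contract0r (lin0 nu_lin).
  rewrite (lin0 (@tswap_linear _ _ _)) addr0.
  by rewrite -[RHS](z0 (phi v)); apply: eq_csum => // y; rewrite contract0r.
- rewrite (linD (rl v)) (linD (ll v)) !contractDr !(linD nu_lin) tswapD.
  by rewrite csum_contract_linl // hu hu' addrACA.
elim/(graded_ind hG): v => [|v v' hv hv'|b v hv].
- rewrite (lin0 (rr u)) (lin0 (lr u)) !contract0r (lin0 nu_lin).
  rewrite (lin0 (@tswap_linear _ _ _)) addr0.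
  by rewrite -[RHS](z0' (phi u)); apply: eq_csum => // y; rewrite contract0r.
- rewrite (linD (rr u)) (linD (lr u)) !contractDr !(linD nu_lin) tswapD.
  by rewrite csum_contract_linr // hv hv' addrACA.
rewrite -(dual_degK m a) in hu; rewrite -(dual_degK m b) in hv.
by rewrite (csum_homog hin hu hv) aff_comul_test.
Qed.

End AffineTests.

(** * Equality of linear combinations by comparison of coefficients *)

Section LinearCombinations.
Variables (k : fieldType) (V : lmodType k).

Inductive lin_expr :=
| LAtom of nat
| LZero
| LAdd of lin_expr & lin_expr
| LOpp of lin_expr
| LScale of k & lin_expr.

Fixpoint lin_eval (env : seq V) (e : lin_expr) : V :=
  match e with
  | LAtom i => nth 0 env i
  | LZero => 0
  | LAdd e1 e2 => lin_eval env e1 + lin_eval env e2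
  | LOpp e1 => - lin_eval env e1
  | LScale a e1 => a *: lin_eval env e1
  end.

Fixpoint lin_coef (e : lin_expr) (i : nat) : k :=
  match e with
  | LAtom j => if j == i then 1 else 0
  | LZero => 0
  | LAdd e1 e2 => lin_coef e1 i + lin_coef e2 i
  | LOpp e1 => - lin_coef e1 i
  | LScale a e1 => a * lin_coef e1 i
  end.

Lemma lin_evalE env e :
  lin_eval env e = \sum_(i < size env) lin_coef e i *: nth 0 env i.
Proof.
elim: e => [j||e1 h1 e2 h2|e1 h1|a e1 h1] /=.
- have [hj|hj] := ltnP j (size env).
    rewrite (bigD1 (Ordinal hj)) //= eqxx scale1r big1 ?addr0 // => i.
    by rewrite -val_eqE /= eq_sym => /negbTE ->; rewrite scale0r.
  rewrite nth_default // big1 // => i _.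
  by rewrite gtn_eqF ?scale0r // (leq_trans (ltn_ord i)).
- by rewrite big1 // => i _; rewrite scale0r.
- by rewrite h1 h2 -big_split; apply: eq_bigr => i _; rewrite scalerDl.
- by rewrite h1 -sumrN; apply: eq_bigr => i _; rewrite scaleNr.
- by rewrite h1 scaler_sumr; apply: eq_bigr => i _; rewrite scalerA.
Qed.

Fixpoint coef_eqs (n : nat) (e1 e2 : lin_expr) : Prop :=
  if n is n'.+1 then lin_coef e1 n' = lin_coef e2 n' /\ coef_eqs n' e1 e2
  else True.

(** A sufficient criterion only: the atoms may satisfy linear relations, so those must be
    substituted beforehand. *)
Lemma lin_eval_eq env e1 e2 :
  coef_eqs (size env) e1 e2 -> lin_eval env e1 = lin_eval env e2.
Proof.
move=> h; rewrite !lin_evalE; apply: eq_bigr => -[i hi] _ /=; congr (_ *: _).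
elim: (size env) hi h => //= n IHn; rewrite ltnS leq_eqVlt.
by case/orP=> [/eqP -> []|hi [_ /(IHn hi)]].
Qed.

End LinearCombinations.

Ltac atom_index env t :=
  match env with
  | ?a :: _ => let __ := match goal with _ => unify a t end in constr:(0%N)
  | _ :: ?env' => let n := atom_index env' t in constr:(n.+1)
  end.

Ltac atom_mem env t :=
  match env with
  | ?a :: _ => let __ := match goal with _ => unify a t end in constr:(true)
  | _ :: ?env' => atom_mem env' t
  | _ => constr:(false)
  end.

Ltac atoms env t :=
  lazymatch t with
  | 0 => env
  | ?x + ?y => let env' := atoms env x in atoms env' y
  | - ?x => atoms env x
  | _ *: ?x => atoms env x
  | _ => lazymatch atom_mem env t with
    | true => env
    | false => constr:(t :: env)
    end
  end.

Ltac reify_lin k env t :=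
  lazymatch t with
  | 0 => constr:(@LZero k)
  | ?x + ?y => let e1 := reify_lin k env x in let e2 := reify_lin k env y in
      constr:(@LAdd k e1 e2)
  | - ?x => let e := reify_lin k env x in constr:(@LOpp k e)
  | ?a *: ?x => let e := reify_lin k env x in constr:(@LScale k a e)
  | _ => let n := atom_index env t in constr:(@LAtom k n)
  end.

(* Proves an equality of linear combinations by comparing the coefficients of *)
(* each atom.                                                                 *)
Ltac lin_comb k V :=
  match goal with |- ?x = ?y =>
    let env := atoms (@nil (GRing.Lmodule.sort V)) x in
    let env := atoms env y in
    let e1 := reify_lin k env x in
    let e2 := reify_lin k env y in
    apply: (@lin_eval_eq k V env e1 e2); simpl; repeat split; ring
  end.

(** * Additivity of f (x)^ g in f, in g and in the formal sum *)

Section CompletedMaps.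
Variables (k : fieldType) (U V U' V' : lmodType k).
Variables (GU : int -> set U) (GV : int -> set V).
Variables (GU' : int -> set U') (GV' : int -> set V').
Hypotheses (hU : graded_space GU') (hV : graded_space GV').

Lemma ctmap_addl (f f' : U -> U') (g : V -> V') x :
  linear f -> linear f' -> linear g ->
  (forall i, finite_degree GU (fun x => hcomp GU' i (f x))) ->
  (forall i, finite_degree GU (fun x => hcomp GU' i (f' x))) ->
  (forall i, finite_degree GV (fun x => hcomp GV' i (g x))) ->
  in_ctens GU GV x ->
  ctmap GU' GV' (fun u => f u + f' u) g x =
  ctmap GU' GV' f g x + ctmap GU' GV' f' g x.
Proof.
move=> lf lf' lg df df' dg hx; apply/funext => i; apply/funext => j.
have hi := hcomp_linear hU i; have hj := hcomp_linear hV j.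
have li := linear_comp lf hi; have li' := linear_comp lf' hi.
have lj := linear_comp lg hj.
rewrite -[RHS](csum_addl li li' lj (df i) (df' i) (dg j) hx).
by apply: eq_csum => // u; rewrite (linD hi).
Qed.

Lemma ctmap_addr (f : U -> U') (g g' : V -> V') x :
  linear f -> linear g -> linear g' ->
  (forall i, finite_degree GU (fun x => hcomp GU' i (f x))) ->
  (forall i, finite_degree GV (fun x => hcomp GV' i (g x))) ->
  (forall i, finite_degree GV (fun x => hcomp GV' i (g' x))) ->
  in_ctens GU GV x ->
  ctmap GU' GV' f (fun u => g u + g' u) x =
  ctmap GU' GV' f g x + ctmap GU' GV' f g' x.
Proof.
move=> lf lg lg' df dg dg' hx; apply/funext => i; apply/funext => j.
have hi := hcomp_linear hU i; have hj := hcomp_linear hV j.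
have li := linear_comp lf hi; have lj' := linear_comp lg' hj.
have lj := linear_comp lg hj.
rewrite -[RHS](csum_addr li lj lj' (df i) (dg j) (dg' j) hx).
by apply: eq_csum => // u; rewrite (linD hj).
Qed.

Lemma ctmapD (f : U -> U') (g : V -> V') x y :
  linear f -> linear g ->
  (forall i, finite_degree GU (fun x => hcomp GU' i (f x))) ->
  (forall i, finite_degree GV (fun x => hcomp GV' i (g x))) ->
  in_ctens GU GV x -> in_ctens GU GV y ->
  ctmap GU' GV' f g (x + y) = ctmap GU' GV' f g x + ctmap GU' GV' f g y.
Proof.
move=> lf lg df dg hx hy; apply/funext => i; apply/funext => j.
have li := linear_comp lf (hcomp_linear hU i).
have lj := linear_comp lg (hcomp_linear hV j).
have := csum_linear_in 1 li lj (df i) (dg j) hx hy.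
by rewrite !scale1r.
Qed.

End CompletedMaps.

(** * The product on D (x) B and its interaction with phi_w *)

Section AffineProduct.
Variables (k : fieldType) (D : lmodType k) (G : int -> set D).
Variable om : D -> D -> k.
Hypothesis hG : graded_space G.
Hypothesis om_bil : bilinear_for *%R *%R om.
Hypothesis om_skew : forall x y, om x y = - om y x.
Variable m : int.
Local Notation "i ^@" := (dual_deg m i) (at level 1, format "i ^@").
Variable B : vectType k.
Local Notation A := (tens D B).
Local Notation GA := (aff_grading (B := B) G).
Local Notation phi w := (@contract k D om B w).
Variables dl dr : D -> D -> D.
Hypothesis dl_bil : bilinear_for *:%R *:%R dl.
Hypothesis dr_bil : bilinear_for *:%R *:%R dr.
Hypothesis dl_graded : graded_product G dl.
Hypothesis dr_graded : graded_product G dr.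
Hypothesis om_inv : invariant_form dl dr om.
Variable z : B -> B -> B.
Hypothesis z_bil : bilinear_for *:%R *:%R z.

Let phi_lin w : linear (phi w). Proof. exact: contract_linear. Qed.
Local Hint Resolve phi_lin : lin.
Let rl y : linear (dr^~ y). Proof. exact: dr_bil.1. Qed.
Let rr y : linear (dr y). Proof. exact: dr_bil.2. Qed.
Let ll y : linear (dl^~ y). Proof. exact: dl_bil.1. Qed.
Let lr y : linear (dl y). Proof. exact: dl_bil.2. Qed.
Let zl y : linear (z^~ y). Proof. exact: z_bil.1. Qed.
Let zr y : linear (z y). Proof. exact: z_bil.2. Qed.

Local Notation mu := (aff_mul dl dr z).

Lemma aff_mul_bilin_in d1 b1 : bilinear_for *:%R *:%R
  (fun d2 b2 => dr d1 d2 ⊗ z b1 b2 + dl d1 d2 ⊗ z b2 b1).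
Proof.
apply: bilinP => [b2|d2] a x y; last first.
  by rewrite zl zr !pureDr !pureZr scalerDr addrACA.
by rewrite lr rr !pureDl !pureZl scalerDr addrACA.
Qed.

Lemma aff_mul_bilin_out y : bilinear_for *:%R *:%R (fun d1 b1 =>
  tlift (fun d2 b2 => dr d1 d2 ⊗ z b1 b2 + dl d1 d2 ⊗ z b2 b1) y).
Proof.
apply: bilinP => [b1|d1] c v v'; rewrite -tliftZ -tliftD;
  apply: eq_tlift => d2 b2.
  by rewrite (linD (rl _)) (linZ (rl _)) (linD (ll _)) (linZ (ll _))
    !pureDl !pureZl scalerDr addrACA.
by rewrite (linD (zl _)) (linZ (zl _)) (linD (zr _)) (linZ (zr _))
  !pureDr !pureZr scalerDr addrACA.
Qed.

Lemma aff_mul_linearr x : linear (mu x).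
Proof.
move=> a y y'; rewrite /aff_mul; elim/tens_ind: x => [d b|x x' hx hx'].
  rewrite !(tlift_pure (aff_mul_bilin_out _)).
  exact: (tlift_linear (aff_mul_bilin_in d b)).
rewrite !(linD (tlift_linear (aff_mul_bilin_out _))) hx hx'.
by rewrite scalerDr addrACA.
Qed.

Lemma aff_mul_linearl y : linear (mu^~ y).
Proof. exact: tlift_linear (aff_mul_bilin_out y). Qed.

Lemma aff_mul_pure d1 b1 d2 b2 : mu (d1 ⊗ b1) (d2 ⊗ b2) =
  dr d1 d2 ⊗ z b1 b2 + dl d1 d2 ⊗ z b2 b1.
Proof.
by rewrite /aff_mul (tlift_pure (aff_mul_bilin_out _))
  (tlift_pure (aff_mul_bilin_in d1 b1)).
Qed.

Lemma aff_mul_bilin : bilinear_for *:%R *:%R mu.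
Proof. by apply: bilinP => ?; [apply: aff_mul_linearl|apply: aff_mul_linearr]. Qed.

Lemma aff_mul_graded : graded_product GA mu.
Proof.
move=> i j x y hx hy; have hS := tsub_subspace (G (i + j)) [set: B].
elim/tsub_ind: hx => [|a u v hu hv|d b hd _].
- by rewrite (lin0 (aff_mul_linearl y)); exact: hS.1.
- by rewrite (aff_mul_linearl y); exact: (hS.2 a _ _ hu hv).
elim/tsub_ind: hy => [|a u v hu hv|d' b' hd' _].
- by rewrite (lin0 (aff_mul_linearr _)); exact: hS.1.
- by rewrite (aff_mul_linearr _); exact: (hS.2 a _ _ hu hv).
rewrite aff_mul_pure; apply: (subspaceD hS); apply: tsub_pure => //.
  exact: dr_graded.
exact: dl_graded.
Qed.

Let hGA : graded_space GA. Proof. exact: aff_graded_space. Qed.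

(** For a of degree n only x of degree i - n reaches degree i; a general a is a finite sum of such.
    Hence multiplication operators act on formal sums. *)
Lemma mulr_finite_degree a i : finite_degree GA (fun x => hcomp GA i (mu x a)).
Proof.
have hl := hcomp_linear hGA i.
elim/(graded_ind hGA): a => [|x y hx hy|n a ha].
- by exists fset0 => j _ x _; rewrite (lin0 (aff_mul_linearr _)) (lin0 hl).
- apply: finite_degree_eq (finite_degree_add hx hy) => u.
  by rewrite (linD (aff_mul_linearr _)) (linD hl).
exists [fset (i - n)%R]%fset => j; rewrite inE => ne x hx.
apply: (hcomp_other hGA (aff_mul_graded hx ha)).
by apply: contra ne => /eqP ->; rewrite addrK.
Qed.

Lemma mull_finite_degree a i : finite_degree GA (fun x => hcomp GA i (mu a x)).
Proof.
have hl := hcomp_linear hGA i.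
elim/(graded_ind hGA): a => [|x y hx hy|n a ha].
- by exists fset0 => j _ x _; rewrite (lin0 (aff_mul_linearl _)) (lin0 hl).
- apply: finite_degree_eq (finite_degree_add hx hy) => u.
  by rewrite (linD (aff_mul_linearl _)) (linD hl).
exists [fset (i - n)%R]%fset => j; rewrite inE => ne x hx.
apply: (hcomp_other hGA (aff_mul_graded ha hx)).
by apply: contra ne => /eqP ->; rewrite addrAC subrr add0r.
Qed.

Lemma id_finite_degree i : finite_degree GA (fun x => hcomp GA i (id x)).
Proof.
exists [fset i]%fset => j; rewrite inE => ne x hx.
by apply: (hcomp_other hGA hx); rewrite eq_sym.
Qed.

(** Invariance moves the right factor of a product across om; with skew-symmetry, this lemma and
    [om_dl] move the left factor. *)
Lemma om_dr x y w : om (dr x y) w = om y (dl w x).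
Proof. by rewrite om_skew -om_inv.2 -om_skew. Qed.

Lemma om_dl x y w : om (dl x y) w = om y (dl w x) - om y (dr w x).
Proof.
rewrite -om_dr; have := om_inv.1 w x y; rewrite omBr //.
rewrite (om_skew w (dl x y)) opprK (om_skew w (dr x y)) (om_skew (dr w x)).
by move=> /eqP; rewrite addrC -subr_eq opprK addrC => /eqP <-.
Qed.

(** Invariance shifts the action of d from the first factor of x to the test vector u, so that only
    <> by b remains on B. *)
Lemma contract_mulr u x d b : phi u (mu x (d ⊗ b)) =
  z (phi (dr d u - dl d u) x) b + z b (phi (dr d u) x).
Proof.
elim/tens_ind: x => [d' b'|x y hx hy]; last first.
  rewrite (linD (aff_mul_linearl _)) !(linD (phi_lin _)) hx hy.
  by rewrite (linD (zl _)) (linD (zr _)) addrACA.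
rewrite aff_mul_pure (linD (phi_lin _)) !contract_pure //.
by rewrite om_inv.1 om_inv.2 (linZ (zl _)) (linZ (zr _)).
Qed.

Lemma contract_mull u x d b : phi u (mu (d ⊗ b) x) =
  z b (phi (dl u d) x) + z (phi (dl u d - dr u d) x) b.
Proof.
elim/tens_ind: x => [d' b'|x y hx hy]; last first.
  rewrite (linD (aff_mul_linearr _)) !(linD (phi_lin _)) hx hy.
  by rewrite (linD (zl _)) (linD (zr _)) addrACA.
rewrite aff_mul_pure (linD (phi_lin _)) !contract_pure //.
by rewrite om_dr om_dl omBr // (linZ (zl _)) (linZ (zr _)).
Qed.

Hypothesis om_graded : forall i j x y,
  G i x -> G j y -> i + j + m != 0 -> om x y = 0.

Let phi_fd w : finite_degree GA (phi w).
Proof. exact: (contract_finite_degree hG om_bil om_graded). Qed.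

Lemma csum_mulr_l u v d b X : in_ctens GA GA X ->
  csum (fun x => phi u (mu x (d ⊗ b))) (phi v) X =
  tmap (z^~ b) id (csum (phi (dr d u - dl d u)) (phi v) X) +
  tmap (z b) id (csum (phi (dr d u)) (phi v) X).
Proof.
move=> hX; have fl := @finite_degree_comp k _ _ _ GA _ _ (zl b) (phi_fd (dr d u - dl d u)).
have fr := @finite_degree_comp k _ _ _ GA _ _ (zr b) (phi_fd (dr d u)).
have lzl := zl b; have lzr := zr b.
have c1 := linear_comp (phi_lin (dr d u - dl d u)) lzl.
have c2 := linear_comp (phi_lin (dr d u)) lzr.
rewrite -!(csum_comp _ _ _ _ (phi_fd _) (phi_fd v) hX) //.
rewrite -(csum_addl c1 c2 (phi_lin v) fl fr (phi_fd v) hX).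
by apply: eq_csum => // x; rewrite contract_mulr.
Qed.

Lemma csum_mulr_r u v d b X : in_ctens GA GA X ->
  csum (phi v) (fun x => phi u (mu x (d ⊗ b))) X =
  tmap id (z^~ b) (csum (phi v) (phi (dr d u - dl d u)) X) +
  tmap id (z b) (csum (phi v) (phi (dr d u)) X).
Proof.
move=> hX; have fl := @finite_degree_comp k _ _ _ GA _ _ (zl b) (phi_fd (dr d u - dl d u)).
have fr := @finite_degree_comp k _ _ _ GA _ _ (zr b) (phi_fd (dr d u)).
have lzl := zl b; have lzr := zr b.
have c1 := linear_comp (phi_lin (dr d u - dl d u)) lzl.
have c2 := linear_comp (phi_lin (dr d u)) lzr.
rewrite -!(csum_comp _ _ _ _ (phi_fd v) (phi_fd _) hX) //.
rewrite -(csum_addr (phi_lin v) c1 c2 (phi_fd v) fl fr hX).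
by apply: eq_csum => // x; rewrite contract_mulr.
Qed.

Lemma csum_mull_l u v d b X : in_ctens GA GA X ->
  csum (fun x => phi u (mu (d ⊗ b) x)) (phi v) X =
  tmap (z b) id (csum (phi (dl u d)) (phi v) X) +
  tmap (z^~ b) id (csum (phi (dl u d - dr u d)) (phi v) X).
Proof.
move=> hX; have fl := @finite_degree_comp k _ _ _ GA _ _ (zl b) (phi_fd (dl u d - dr u d)).
have fr := @finite_degree_comp k _ _ _ GA _ _ (zr b) (phi_fd (dl u d)).
have lzl := zl b; have lzr := zr b.
have c1 := linear_comp (phi_lin (dl u d - dr u d)) lzl.
have c2 := linear_comp (phi_lin (dl u d)) lzr.
rewrite -!(csum_comp _ _ _ _ (phi_fd _) (phi_fd v) hX) //.
rewrite -(csum_addl c2 c1 (phi_lin v) fr fl (phi_fd v) hX).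
by apply: eq_csum => // x; rewrite contract_mull.
Qed.

Lemma csum_mull_r u v d b X : in_ctens GA GA X ->
  csum (phi v) (fun x => phi u (mu (d ⊗ b) x)) X =
  tmap id (z b) (csum (phi v) (phi (dl u d)) X) +
  tmap id (z^~ b) (csum (phi v) (phi (dl u d - dr u d)) X).
Proof.
move=> hX; have fl := @finite_degree_comp k _ _ _ GA _ _ (zl b) (phi_fd (dl u d - dr u d)).
have fr := @finite_degree_comp k _ _ _ GA _ _ (zr b) (phi_fd (dl u d)).
have lzl := zl b; have lzr := zr b.
have c1 := linear_comp (phi_lin (dl u d - dr u d)) lzl.
have c2 := linear_comp (phi_lin (dl u d)) lzr.
rewrite -!(csum_comp _ _ _ _ (phi_fd v) (phi_fd _) hX) //.
rewrite -(csum_addr (phi_lin v) c2 c1 (phi_fd v) fr fl hX).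
by apply: eq_csum => // x; rewrite contract_mull.
Qed.

End AffineProduct.

(** * The axioms of an ASI bialgebra, tested on D (x) B *)

Section AffineBialgebra.
Variables (k : fieldType) (D : lmodType k) (G : int -> set D).
Variables (dl dr : D -> D -> D) (om : D -> D -> k).
Hypothesis hdi : diassociative dl dr.
Hypothesis hG : graded_space G.
Hypothesis dl_graded : graded_product G dl.
Hypothesis dr_graded : graded_product G dr.
Hypothesis om_bil : bilinear_for *%R *%R om.
Hypothesis om_skew : forall x y, om x y = - om y x.
Hypothesis om_nd : forall x, (forall y, om x y = 0) -> x = 0.
Variable m : int.
Hypothesis om_graded : forall i j x y,
  G i x -> G j y -> i + j + m != 0 -> om x y = 0.
Hypothesis om_inv : invariant_form dl dr om.
Variables (B : vectType k) (z : B -> B -> B) (nu : B -> tens B B).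
Hypothesis z_bil : bilinear_for *:%R *:%R z.
Hypothesis nu_lin : linear nu.

Local Notation "i ^@" := (dual_deg m i) (at level 1, format "i ^@").
Local Notation A := (tens D B).
Local Notation GA := (aff_grading (B := B) G).
Local Notation phi w := (@contract k D om B w).
Local Notation mu := (aff_mul dl dr z).
Local Notation De := (aff_comul G dl dr om nu).

Let dl_bil : bilinear_for *:%R *:%R dl. Proof. by case: hdi => [[]]. Qed.
Let dr_bil : bilinear_for *:%R *:%R dr. Proof. by case: hdi => [[]]. Qed.
Let phi_lin w : linear (phi w). Proof. exact: contract_linear. Qed.
Let rl y : linear (dr^~ y). Proof. exact: dr_bil.1. Qed.
Let rr y : linear (dr y). Proof. exact: dr_bil.2. Qed.
Let ll y : linear (dl^~ y). Proof. exact: dl_bil.1. Qed.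
Let lr y : linear (dl y). Proof. exact: dl_bil.2. Qed.
Let zl y : linear (z^~ y). Proof. exact: z_bil.1. Qed.
Let zr y : linear (z y). Proof. exact: z_bil.2. Qed.
Local Hint Resolve phi_lin zl zr nu_lin : lin.

Let hGA : graded_space GA. Proof. exact: aff_graded_space. Qed.
Let De_in x : in_ctens GA GA (De x).
Proof. exact: (aff_comul_in hG om_bil om_skew om_nd om_graded). Qed.
Let De_lin : linear De.
Proof. exact: (aff_comul_linear hG om_bil om_skew om_nd om_graded). Qed.

Lemma dr_dr x y w : dr (dr x y) w = dr x (dr y w).
Proof. by case: hdi => _ [_ ->]. Qed.
Lemma dl_dl x y w : dl (dl x y) w = dl x (dl y w).
Proof. by case: hdi => _ [->]. Qed.
Lemma dr_dl x y w : dr (dl x y) w = dr x (dr y w).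
Proof. by case: hdi => _ _ _ _ ->; apply: dr_dr. Qed.
Lemma dl_dr x y w : dl (dr x y) w = dr x (dl y w).
Proof. by case: hdi. Qed.
Lemma dl_r x y w : dl x (dr y w) = dl x (dl y w).
Proof. by rewrite -dl_dl; case: hdi => _ _ ->. Qed.
(* Normal forms x |- (y |- z), x |- (y -| z), x -| (y -| z).                  *)
Definition diE := (dr_dr, dl_dl, dr_dl, dl_dr, dl_r).

(** With P, Q, R as in [comul_mul_test], this pairing and the next two are P - R, Q - R and -R:
    cyclically rotated products are brought back to the pairings of d1 with the products of d2, u,
    v. *)
Lemma om_dr_dl u v d1 d2 : om d2 (dr u (dl v d1)) =
  om d1 (dr d2 (dr u v)) - om d1 (dl d2 (dl u v)).
Proof. by rewrite -dl_dr -(om_dr om_skew om_inv) om_inv.1 omBr // dl_r. Qed.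

Lemma om_dl_dl u v d1 d2 : om d2 (dl u (dl v d1)) =
  om d1 (dr d2 (dl u v)) - om d1 (dl d2 (dl u v)).
Proof. by rewrite -dl_dl -(om_dr om_skew om_inv) om_inv.1 omBr. Qed.

Lemma om_dr_dr u v d1 d2 : om d2 (dr u (dr v d1)) = - om d1 (dl d2 (dl u v)).
Proof.
(* Evaluating om(d1 -| d2, u |- v) by moving d2 gives P, by moving d1 gives (P - R) - X; solve for
   X. *)
have := om_dl om_bil om_skew om_inv d1 d2 (dr u v).
rewrite om_inv.2 dl_dr dr_dr om_dr_dl.
set P := om d1 (dr d2 _); set R := om d1 _; set X := om d2 _ => e.
have -> : X = (P - R) - (P - R - X) by ring.
by rewrite -e; ring.
Qed.

(** * Tests of the two compatibility conditions *)

Lemma comul_mul_test i j u v d1 b1 d2 b2 : G (i^@) u -> G (j^@) v ->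
  let P := om d1 (dr d2 (dr u v)) in let Q := om d1 (dr d2 (dl u v)) in
  let R := om d1 (dl d2 (dl u v)) in
  tmap (phi u) (phi v) (De (mu (d1 ⊗ b1) (d2 ⊗ b2)) i j) =
    (P - R) *: nu (z b1 b2) + P *: nu (z b2 b1) +
    (Q - R) *: tswap (nu (z b1 b2)) + Q *: tswap (nu (z b2 b1)).
Proof.
move=> hu hv P Q R.
rewrite (aff_comul_test hG om_bil om_skew om_nd om_graded dl_bil dr_bil nu_lin _ hu hv).
rewrite (aff_mul_pure dl_bil dr_bil z_bil) !(linD (phi_lin _)) !contract_pure //.
rewrite !om_inv.1 !om_inv.2 !omBr // dl_r -/P -/Q -/R.
by rewrite !(linD nu_lin) !(linZ nu_lin) tswapD !tswapZ addrA.
Qed.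

Let id_fd i : finite_degree GA (fun x => hcomp GA i (id x)).
Proof. exact: id_finite_degree. Qed.
Let mr_fd a i : finite_degree GA (fun x => hcomp GA i (mu x a)).
Proof. exact: mulr_finite_degree. Qed.
Let ml_fd a i : finite_degree GA (fun x => hcomp GA i (mu a x)).
Proof. exact: mull_finite_degree. Qed.
Let mr_lin a : linear (mu^~ a). Proof. exact: aff_mul_linearl. Qed.
Let ml_lin a : linear (mu a). Proof. exact: aff_mul_linearr. Qed.
Let phi_h i w : G (i^@) w -> forall x, phi w (hcomp GA i x) = phi w x.
Proof. by move=> hw x; apply: (contract_aff_hcomp hG om_bil om_graded). Qed.
Let cD u v x : csum (phi u) (phi v) (De x) =
  nu (phi (dr u v) x) + tswap (nu (phi (dl u v) x)).
Proof. exact: (csum_comul hG om_bil om_skew om_nd om_graded). Qed.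

Lemma cmap_rm_id_test i j u v X d b : in_ctens GA GA X ->
  G (i^@) u -> G (j^@) v ->
  tmap (phi u) (phi v) (ctmap GA GA (fun x => mu x (d ⊗ b)) id X i j) =
  tmap (z^~ b) id (csum (phi (dr d u - dl d u)) (phi v) X) +
  tmap (z b) id (csum (phi (dr d u)) (phi v) X).
Proof.
move=> hX hu hv.
rewrite (ctmap_csum hGA hGA (mr_lin _) (@linear_id _ _) (phi_lin u) (phi_lin v)
  (mr_fd _ _) (id_fd _) (phi_h hu) (phi_h hv) hX).
exact: (csum_mulr_l hG om_bil dl_bil dr_bil om_inv z_bil om_graded).
Qed.

Lemma cmap_id_rm_test i j u v X d b : in_ctens GA GA X ->
  G (i^@) u -> G (j^@) v ->
  tmap (phi u) (phi v) (ctmap GA GA id (fun x => mu x (d ⊗ b)) X i j) =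
  tmap id (z^~ b) (csum (phi u) (phi (dr d v - dl d v)) X) +
  tmap id (z b) (csum (phi u) (phi (dr d v)) X).
Proof.
move=> hX hu hv.
rewrite (ctmap_csum hGA hGA (@linear_id _ _) (mr_lin _) (phi_lin u) (phi_lin v)
  (id_fd _) (mr_fd _ _) (phi_h hu) (phi_h hv) hX).
exact: (csum_mulr_r hG om_bil dl_bil dr_bil om_inv z_bil om_graded).
Qed.

Lemma cmap_lm_id_test i j u v X d b : in_ctens GA GA X ->
  G (i^@) u -> G (j^@) v ->
  tmap (phi u) (phi v) (ctmap GA GA (fun x => mu (d ⊗ b) x) id X i j) =
  tmap (z b) id (csum (phi (dl u d)) (phi v) X) +
  tmap (z^~ b) id (csum (phi (dl u d - dr u d)) (phi v) X).
Proof.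
move=> hX hu hv.
rewrite (ctmap_csum hGA hGA (ml_lin _) (@linear_id _ _) (phi_lin u) (phi_lin v)
  (ml_fd _ _) (id_fd _) (phi_h hu) (phi_h hv) hX).
exact: (csum_mull_l hG om_bil om_skew dl_bil dr_bil om_inv z_bil om_graded).
Qed.

Lemma cmap_id_lm_test i j u v X d b : in_ctens GA GA X ->
  G (i^@) u -> G (j^@) v ->
  tmap (phi u) (phi v) (ctmap GA GA id (fun x => mu (d ⊗ b) x) X i j) =
  tmap id (z b) (csum (phi u) (phi (dl v d)) X) +
  tmap id (z^~ b) (csum (phi u) (phi (dl v d - dr v d)) X).
Proof.
move=> hX hu hv.
rewrite (ctmap_csum hGA hGA (@linear_id _ _) (ml_lin _) (phi_lin u) (phi_lin v)
  (id_fd _) (ml_fd _ _) (phi_h hu) (phi_h hv) hX).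
exact: (csum_mull_r hG om_bil om_skew dl_bil dr_bil om_inv z_bil om_graded).
Qed.

Let t1 b : linear (tmap (z b) (fun x : B => x)). Proof. exact: tmap_linear. Qed.
Let t2 b : linear (tmap (z^~ b) (fun x : B => x)). Proof. exact: tmap_linear. Qed.
Let t3 b : linear (tmap (fun x : B => x) (z b)). Proof. exact: tmap_linear. Qed.
Let t4 b : linear (tmap (fun x : B => x) (z^~ b)). Proof. exact: tmap_linear. Qed.

Let tE := (fun b => linD (t1 b), fun b => linD (t2 b), fun b => linD (t3 b),
  fun b => linD (t4 b), fun b => linZ (t1 b), fun b => linZ (t2 b),
  fun b => linZ (t3 b), fun b => linZ (t4 b), linZ nu_lin, @tswapZ k B B).

Let dB := (fun d => linB (rl d), fun d => linB (rr d), fun d => linB (ll d),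
  fun d => linB (lr d)).

(** Against [comul_mul_test], the coefficient of P is [zinbiel_comul_sym] at (b2, b1), that of Q its
    twist, and that of R, up to sign, the twist of [zinbiel_comul_mul] at (b1, b2). *)
Lemma mul_comul_test i j u v d1 b1 d2 b2 : G (i^@) u -> G (j^@) v ->
  let P := om d1 (dr d2 (dr u v)) in let Q := om d1 (dr d2 (dl u v)) in
  let R := om d1 (dl d2 (dl u v)) in
  tmap (phi u) (phi v)
    ((ctmap GA GA (fun x => mu x (d2 ⊗ b2)) id (De (d1 ⊗ b1)) +
      ctmap GA GA id (fun x => mu (d1 ⊗ b1) x) (De (d2 ⊗ b2))) i j) =
    (Q - R) *: tmap (z^~ b2) id (tswap (nu b1)) +
    P *: tmap (z b2) id (nu b1) + Q *: tmap (z b2) id (tswap (nu b1)) +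
    (P - R) *: tmap id (z b1) (nu b2) +
    (Q - R) *: tmap id (z b1) (tswap (nu b2)) + P *: tmap id (z^~ b1) (nu b2).
Proof.
move=> hu hv P Q R.
rewrite -[(_ + _) i j]/(ctmap GA GA (fun x => mu x (d2 ⊗ b2)) id (De (d1 ⊗ b1)) i j +
   ctmap GA GA id (fun x => mu (d1 ⊗ b1) x) (De (d2 ⊗ b2)) i j).
rewrite tmapD // cmap_rm_id_test // cmap_id_lm_test //.
rewrite !cD !(contract_pure om_bil) !dB !(omBr om_bil) !diE.
rewrite !(om_dr_dl u v d1 d2) !(om_dl_dl u v d1 d2) !(om_dr_dr u v d1 d2) !tE.
rewrite -/P -/Q -/R.
lin_comb k (tens B B : lmodType k).
Qed.

Lemma comm_comul_test i j u v d1 b1 d2 b2 : G (i^@) u -> G (j^@) v ->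
  let P := om d2 (dr u (dr d1 v)) in let Q := om d2 (dr u (dl d1 v)) in
  let R := om d2 (dl u (dl d1 v)) in
  tmap (phi u) (phi v)
    ((ctmap GA GA (fun x => mu (d1 ⊗ b1) x) id (De (d2 ⊗ b2)) -
      ctmap GA GA id (fun x => mu x (d1 ⊗ b1)) (De (d2 ⊗ b2))) i j) =
    P *: (tmap (z b1) id (nu b2) - tmap id (z^~ b1) (nu b2)
          - tmap id (z b1) (nu b2)) +
    Q *: (tmap id (z^~ b1) (nu b2) - tmap (z^~ b1) id (tswap (nu b2))) +
    R *: (tmap (z b1) id (tswap (nu b2)) + tmap (z^~ b1) id (tswap (nu b2))
          - tmap id (z b1) (tswap (nu b2))).
Proof.
move=> hu hv P Q R.
rewrite -[(_ - _) i j]/(ctmap GA GA (fun x => mu (d1 ⊗ b1) x) id (De (d2 ⊗ b2)) i j -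
   ctmap GA GA id (fun x => mu x (d1 ⊗ b1)) (De (d2 ⊗ b2)) i j).
rewrite linB // cmap_lm_id_test // cmap_id_rm_test //.
rewrite !cD !(contract_pure om_bil) !dB !(omBr om_bil) !diE !tE.
rewrite -/P -/Q -/R.
lin_comb k (tens B B : lmodType k).
Qed.

(** * Coassociativity *)

Lemma tassoc_tmap (U V W U' V' W' : lmodType k) (f : U -> U') (g : V -> V')
    (h : W -> W') x : linear f -> linear g -> linear h ->
  tassoc (tmap f (tmap g h) x) = tmap (tmap f g) h (tassoc x).
Proof.
move=> lf lg lh; elim/tens_ind: x => [u x|x y hx hy]; last first.
  by rewrite tmapD // !tassocD tmapD // hx hy.
elim/tens_ind: x => [v w|x y hx hy]; last first.
  by rewrite pureDr tmapD // !tassocD tmapD // hx hy.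
by rewrite !(tmap_pure, tassoc_pure).
Qed.

Lemma tassoc_tsub (U V W : lmodType k) (S : set U) (T : set V) (R : set W) x :
  tsub S (tsub T R) x -> tsub (tsub S T) R (tassoc x).
Proof.
have hS := tsub_subspace (tsub S T) R.
elim/tsub_ind => [|a x1 x2 h1 h2|u x1 hu hx].
- by rewrite (lin0 (@tassoc_linear _ _ _ _)); exact: hS.1.
- by rewrite tassocD tassocZ; exact: (hS.2 a _ _ h1 h2).
elim/tsub_ind: hx => [|a y1 y2 h1 h2|v w hv hw].
- by rewrite pure0r (lin0 (@tassoc_linear _ _ _ _)); exact: hS.1.
- by rewrite pureDr pureZr tassocD tassocZ; exact: (hS.2 a _ _ h1 h2).
by rewrite tassoc_pure; apply: tsub_pure => //; apply: tsub_pure.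
Qed.

Let De_ij_lin i j : linear (fun a => De a i j).
Proof. by move=> a x y; rewrite De_lin. Qed.

(** Tests of the (i, j) component use u |- v and u -| v, both of degree i^@ + j^@, so only one
    degree of a contributes. This makes both iterated coproducts finite in each component. *)
Let De_fd i j : finite_degree GA (fun a => De a i j).
Proof.
exists [fset dual_deg m (i^@ + j^@)]%fset => n; rewrite inE => ne x hx.
have h0 : tsub (GA i) (GA j) 0 by case: (tsub_subspace (GA i) (GA j)).
change (De x i j = 0 :> tens A A).
apply: (aff_tens_ext hG om_bil om_nd om_graded (@De_in x i j) h0) => u v hu hv.
rewrite (aff_comul_test hG om_bil om_skew om_nd om_graded dl_bil dr_bil nu_lin _ hu hv).
have hc := contract_homog0 hG om_bil om_graded _ hx ne.
rewrite !hc; [|exact: dl_graded|exact: dr_graded].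
by rewrite (lin0 nu_lin) (lin0 (@tswap_linear _ _ _)) addr0 tmap0.
Qed.

Let h_lin i : linear (hcomp GA i). Proof. exact: hcomp_linear. Qed.

Let comulL_finite a i j l :
  finite_set [set p | comulL_term GA De (De a) i j l p != 0].
Proof.
exact: (csum_finite (De_ij_lin i j) (h_lin l) (De_fd i j) (id_fd l) (De_in a)).
Qed.

Let comulR0_finite a i j l : finite_set [set p : int * int |
  tmap (hcomp GA i) (fun a => De a j l) (De a p.1 p.2) != 0].
Proof.
exact: (csum_finite (h_lin i) (De_ij_lin j l) (id_fd i) (De_fd j l) (De_in a)).
Qed.

Let comulR_finite a i j l :
  finite_set [set p | comulR_term GA De (De a) i j l p != 0].
Proof.
have [F hF] := fsum_sub (comulR0_finite a i j l).
apply: (fsum_finite (F := F)) => p /hF hp.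
by rewrite /comulR_term hp (lin0 (@tassoc_linear _ _ _ _)).
Qed.

Let comulLE a i j l : \sum_(p \in [set: int * int]) comulL_term GA De (De a) i j l p
  = csum (fun a => De a i j) (hcomp GA l) (De a).
Proof. by []. Qed.

Let comulRE a i j l : \sum_(p \in [set: int * int]) comulR_term GA De (De a) i j l p
  = tassoc (csum (hcomp GA i) (fun a => De a j l) (De a)).
Proof. by rewrite /csum (fsum_lin (@tassoc_linear _ _ _ _)). Qed.

Let nus : B -> tens B B := fun b => tswap (nu b).
Let nus_lin : linear nus. Proof. by apply: linear_comp. Qed.
Local Hint Resolve nus_lin : lin.

(** Two applications of the test formula bracket u, v, w from the left; here [xR] occurs twice
    because (u -| v) |- w = (u |- v) |- w. *)
Lemma coassocL_test a i j l u v w : G (i^@) u -> G (j^@) v -> G (l^@) w ->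
  let xR := phi (dr u (dr v w)) a in let xM := phi (dr u (dl v w)) a in
  let xL := phi (dl u (dl v w)) a in
  tmap (tmap (phi u) (phi v)) (phi w)
    (csum (fun a => De a i j) (hcomp GA l) (De a)) =
  tmap nu id (nu xR + tswap (nu xM)) + tmap nus id (nu xR + tswap (nu xL)).
Proof.
move=> hu hv hw xR xM xL.
have l2 : linear (tmap (phi u) (phi v)) by [].
rewrite -(csum_comp (De_ij_lin i j) (h_lin l) l2 (phi_lin w) (De_fd i j) (id_fd l) (De_in a)).
have fd := contract_finite_degree hG om_bil om_graded B.
have c1 : linear (fun x => nu (phi (dr u v) x)) by [].
have c2 : linear (fun x => nus (phi (dl u v) x)) by [].
have f1 := finite_degree_comp nu_lin (fd (dr u v)).
have f2 := finite_degree_comp nus_lin (fd (dl u v)).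
have -> : csum (fun x => tmap (phi u) (phi v) (De x i j))
    (fun x => phi w (hcomp GA l x)) (De a) =
    csum (fun x => nu (phi (dr u v) x) + nus (phi (dl u v) x)) (phi w) (De a).
  apply: eq_csum => x; last exact: phi_h.
  exact: (aff_comul_test hG om_bil om_skew om_nd om_graded).
rewrite (csum_addl c1 c2 (phi_lin w) f1 f2 (fd w) (De_in a)).
rewrite !(csum_comp (h' := id) _ _ _ _ (fd _) (fd w) (De_in a)) //.
by rewrite !cD !diE.
Qed.

Lemma coassocR_test a i j l u v w : G (i^@) u -> G (j^@) v -> G (l^@) w ->
  let xR := phi (dr u (dr v w)) a in let xM := phi (dr u (dl v w)) a in
  let xL := phi (dl u (dl v w)) a in
  tmap (tmap (phi u) (phi v)) (phi w)
    (tassoc (csum (hcomp GA i) (fun a => De a j l) (De a))) =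
  tassoc (tmap id nu (nu xR + tswap (nu xL)) +
          tmap id nus (nu xM + tswap (nu xL))).
Proof.
move=> hu hv hw xR xM xL; rewrite -tassoc_tmap //; congr tassoc.
have l2 : linear (tmap (phi v) (phi w)) by [].
rewrite -(csum_comp (h_lin i) (De_ij_lin j l) (phi_lin u) l2 (id_fd i) (De_fd j l) (De_in a)).
have fd := contract_finite_degree hG om_bil om_graded B.
have c1 : linear (fun x => nu (phi (dr v w) x)) by [].
have c2 : linear (fun x => nus (phi (dl v w) x)) by [].
have f1 := finite_degree_comp nu_lin (fd (dr v w)).
have f2 := finite_degree_comp nus_lin (fd (dl v w)).
have -> : csum (fun x => phi u (hcomp GA i x))
    (fun x => tmap (phi v) (phi w) (De x j l)) (De a) =
    csum (phi u) (fun x => nu (phi (dr v w) x) + nus (phi (dl v w) x)) (De a).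
  apply: eq_csum => x; first exact: phi_h.
  exact: (aff_comul_test hG om_bil om_skew om_nd om_graded).
rewrite (csum_addr (phi_lin u) c1 c2 (fd u) f1 f2 (De_in a)).
rewrite !(csum_comp (h := id) _ _ _ _ (fd u) (fd _) (De_in a)) //.
by rewrite !cD !diE.
Qed.

Lemma tens3_ind (U V W : lmodType k) (P : tens (tens U V) W -> Prop) :
  (forall u v w, P ((u ⊗ v) ⊗ w)) -> (forall x y, P x -> P y -> P (x + y)) ->
  forall x, P x.
Proof.
move=> hp hD; elim/tens_ind => // x w; elim/tens_ind: x => // x y hx hy.
by rewrite pureDl; apply: hD.
Qed.

Definition zinbiel_coassoc := forall b,
  tassoc (tmap id nu (nu b)) = tmap nu id (nu b) + tmap nus id (nu b).

(* The iterated coproduct (id (x) nu) nu b is invariant under exchange of its *)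
(* first two factors.                                                         *)
Lemma coassoc_mid b : zinbiel_coassoc ->
  tmap nu id (tswap (nu b)) = tassoc (tmap id nus (nu b)).
Proof.
move=> h; pose t12 : tens (tens B B) B -> tens (tens B B) B := tmap (@tswap k B B) id.
have l12 : linear t12 by apply: tmap_linear.
have t12K y : t12 (t12 y) = y.
  elim/tens3_ind: y => [x y w|x y hx hy]; last by rewrite !(linD l12) hx hy.
  by rewrite /t12 !tmap_pure // tswapK.
have nusE y : tmap nus id y = t12 (tmap nu id y).
  by rewrite /t12 tmap_comp.
pose X := tassoc (tmap id nu (nu b)).
have tX : t12 X = X.
  by rewrite /X h nusE (linD l12) t12K addrC.
have eX : tmap id nu (nu b) = tassocr X by rewrite /X tassocK.
have -> : tmap nu id (tswap (nu b)) = tswap (tassocr X).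
  by rewrite -eX tswap_tmap.
have -> : tmap id nus (nu b) = tmap id (@tswap k B B) (tassocr X).
  by rewrite -eX tmap_comp.
rewrite -{1}tX; elim/tens3_ind: X {tX eX} => [x y w|x y hx hy].
  rewrite /t12 !(tmap_pure, tswap_pure, tassocr_pure) //.
  by rewrite !(tmap_pure, tswap_pure, tassoc_pure).
have lt := @tassocr_linear k.
rewrite (linD l12) !(linD (@lt _ _ _)) tswapD [in RHS]tmapD // tassocD.
by rewrite hx hy.
Qed.

(** The coalgebra axiom with the last tensor factor moved to the front: with Y = (nu (x) id) nu b,
    both sides are the same rearrangement of Y plus its exchange of the first two factors. *)
Lemma coassoc_left b : zinbiel_coassoc ->
  tmap nus id (tswap (nu b)) =
  tassoc (tmap id nu (tswap (nu b)) + tmap id nus (tswap (nu b))).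
Proof.
move=> h; pose t12 : tens (tens B B) B -> tens (tens B B) B := tmap (@tswap k B B) id.
have l12 : linear t12 by apply: tmap_linear.
have nusE y : tmap nus id y = t12 (tmap nu id y).
  by rewrite /t12 tmap_comp.
pose X := tassoc (tmap id nu (nu b)); pose Y := tmap nu id (nu b).
have XE : X = Y + t12 Y by rewrite /X h nusE.
have eX : tmap id nu (nu b) = tassocr X by rewrite /X tassocK.
have -> : tmap nus id (tswap (nu b)) = t12 (tswap (tassocr X)).
  by rewrite -eX tswap_tmap // nusE.
have -> : tmap id nus (tswap (nu b)) = tmap id (@tswap k B B) (tswap Y).
  by rewrite /Y tswap_tmap // tmap_comp.
have -> : tmap id nu (tswap (nu b)) = tswap Y by rewrite /Y tswap_tmap.
rewrite XE; elim/tens3_ind: (Y) => [x y w|x y hx hy].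
  rewrite /t12 tmap_pure // tswap_pure.
  have lt := @tassocr_linear k.
  rewrite (linD (@lt _ _ _)) !tassocr_pure tswapD !tswap_pure tmapD //.
  rewrite !tmap_pure // !tswap_pure tassocD !tassoc_pure addrC.
  by [].
have lt := @tassocr_linear k.
rewrite (linD l12) addrACA (linD (@lt _ _ _)) tswapD (linD l12) hx hy.
rewrite [in RHS]tswapD [in RHS]tmapD // addrACA.
by rewrite !tassocD.
Qed.

(** The parts in [xR], [xM] and [xL] agree by the coalgebra axiom, [coassoc_mid] and [coassoc_left]
    respectively. *)
Lemma aff_coassociative : zinbiel_coassoc -> completed_coassociative GA De.
Proof.
move=> h a i j l; split; [exact: comulL_finite|exact: comulR_finite|].
rewrite comulLE comulRE.
apply: (aff_tens3_ext hG om_bil om_nd om_graded).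
- apply: (subspace_fsum (tsub_subspace _ _)) => p.
  by apply: tsub_tmap (@De_in a p.1 p.2) => // x _; [apply: De_in|apply: hcomp_in].
- apply: tassoc_tsub; apply: (subspace_fsum (tsub_subspace _ _)) => p.
  by apply: tsub_tmap (@De_in a p.1 p.2) => // x _; [apply: hcomp_in|apply: De_in].
move=> u v w hu hv hw; rewrite coassocL_test // coassocR_test //.
rewrite !tmapD // !tassocD h coassoc_mid // coassoc_left // tassocD.
by lin_comb k (tens (tens B B) B : lmodType k).
Qed.

Lemma zinbiel_coassoc_of_completed a b c d u v w :
  G a u -> G b v -> G c w -> om d (dr u (dr v w)) = 1 ->
  om d (dr u (dl v w)) = 0 -> om d (dl u (dl v w)) = 0 ->
  completed_coassociative GA De -> zinbiel_coassoc.
Proof.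
move=> hu hv hw hR hM hL h x.
have [_ _] := h (d ⊗ x) (a^@) (b^@) (c^@); rewrite comulLE comulRE.
move=> /(congr1 (tmap (tmap (phi u) (phi v)) (phi w))).
rewrite coassocL_test ?coassocR_test ?dual_degK // !contract_pure //.
rewrite hR hM hL scale1r !scale0r (lin0 nu_lin) (lin0 (@tswap_linear _ _ _)).
by rewrite !addr0 [tmap id nus 0]tmap0 // addr0 => ->.
Qed.

(** * The compatibility conditions: reduction to pure tensors and proofs *)

Let rmD (x y : A) X : in_ctens GA GA X ->
  ctmap GA GA (fun u => mu u (x + y)) id X =
  ctmap GA GA (fun u => mu u x) id X + ctmap GA GA (fun u => mu u y) id X.
Proof.
have e : (fun u => mu u (x + y)) = (fun u => mu u x + mu u y).
  by apply/funext => u; exact: (linD (ml_lin u)).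
rewrite e; exact: (ctmap_addl hGA hGA (mr_lin x) (mr_lin y)
  (@linear_id _ _) (mr_fd x) (mr_fd y) id_fd).
Qed.

Let rmD' (x y : A) X : in_ctens GA GA X ->
  ctmap GA GA id (fun u => mu u (x + y)) X =
  ctmap GA GA id (fun u => mu u x) X + ctmap GA GA id (fun u => mu u y) X.
Proof.
have e : (fun u => mu u (x + y)) = (fun u => mu u x + mu u y).
  by apply/funext => u; exact: (linD (ml_lin u)).
rewrite e; exact: (ctmap_addr hGA hGA (@linear_id _ _)
  (mr_lin x) (mr_lin y) id_fd (mr_fd x) (mr_fd y)).
Qed.

Let lmD (x y : A) X : in_ctens GA GA X ->
  ctmap GA GA (fun u => mu (x + y) u) id X =
  ctmap GA GA (fun u => mu x u) id X + ctmap GA GA (fun u => mu y u) id X.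
Proof.
have e : (fun u => mu (x + y) u) = (fun u => mu x u + mu y u).
  by apply/funext => u; exact: (linD (mr_lin u)).
rewrite e; exact: (ctmap_addl hGA hGA (ml_lin x) (ml_lin y)
  (@linear_id _ _) (ml_fd x) (ml_fd y) id_fd).
Qed.

Let lmD' (x y : A) X : in_ctens GA GA X ->
  ctmap GA GA id (fun u => mu (x + y) u) X =
  ctmap GA GA id (fun u => mu x u) X + ctmap GA GA id (fun u => mu y u) X.
Proof.
have e : (fun u => mu (x + y) u) = (fun u => mu x u + mu y u).
  by apply/funext => u; exact: (linD (mr_lin u)).
rewrite e; exact: (ctmap_addr hGA hGA (@linear_id _ _)
  (ml_lin x) (ml_lin y) id_fd (ml_fd x) (ml_fd y)).
Qed.

Let cDr a (x y : A) : ctmap GA GA (fun u => mu u a) id (De (x + y)) =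
  ctmap GA GA (fun u => mu u a) id (De x) +
  ctmap GA GA (fun u => mu u a) id (De y).
Proof.
rewrite (linD De_lin).
exact: (ctmapD hGA hGA (mr_lin a) (@linear_id _ _) (mr_fd a) id_fd).
Qed.

Let cDr' a (x y : A) : ctmap GA GA id (fun u => mu u a) (De (x + y)) =
  ctmap GA GA id (fun u => mu u a) (De x) +
  ctmap GA GA id (fun u => mu u a) (De y).
Proof.
rewrite (linD De_lin).
exact: (ctmapD hGA hGA (@linear_id _ _) (mr_lin a) id_fd (mr_fd a)).
Qed.

Let cDl a (x y : A) : ctmap GA GA (fun u => mu a u) id (De (x + y)) =
  ctmap GA GA (fun u => mu a u) id (De x) +
  ctmap GA GA (fun u => mu a u) id (De y).
Proof.
rewrite (linD De_lin).
exact: (ctmapD hGA hGA (ml_lin a) (@linear_id _ _) (ml_fd a) id_fd).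
Qed.

Let cDl' a (x y : A) : ctmap GA GA id (fun u => mu a u) (De (x + y)) =
  ctmap GA GA id (fun u => mu a u) (De x) +
  ctmap GA GA id (fun u => mu a u) (De y).
Proof.
rewrite (linD De_lin).
exact: (ctmapD hGA hGA (@linear_id _ _) (ml_lin a) id_fd (ml_fd a)).
Qed.

Let rm_in a X : in_ctens GA GA X ->
  in_ctens GA GA (ctmap GA GA (fun u => mu u a) id X).
Proof. by apply: ctmap_in => //; apply: mr_lin. Qed.
Let rm_in' a X : in_ctens GA GA X ->
  in_ctens GA GA (ctmap GA GA id (fun u => mu u a) X).
Proof. by apply: ctmap_in => //; apply: mr_lin. Qed.
Let lm_in a X : in_ctens GA GA X ->
  in_ctens GA GA (ctmap GA GA (fun u => mu a u) id X).
Proof. by apply: ctmap_in => //; apply: ml_lin. Qed.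
Let lm_in' a X : in_ctens GA GA X ->
  in_ctens GA GA (ctmap GA GA id (fun u => mu a u) X).
Proof. by apply: ctmap_in => //; apply: ml_lin. Qed.

Definition zinbiel_comul_sym := forall b1 b2,
  nu (z b1 b2) + nu (z b2 b1) = tmap id (z b2) (nu b1) +
    tmap id (z^~ b2) (nu b1) + tmap (z b1) id (nu b2).

Definition zinbiel_comul_mul := forall b1 b2,
  nu (z b1 b2) + tswap (nu (z b1 b2)) = tmap id (z^~ b2) (nu b1) +
    (tmap (z b1) id (nu b2) + tmap (z b1) id (tswap (nu b2))).

Let swapE := (fun b x => tswap_tmap x (zr b) (@linear_id _ B),
  fun b x => tswap_tmap x (zl b) (@linear_id _ B),
  fun b x => tswap_tmap x (@linear_id _ B) (zr b),
  fun b x => tswap_tmap x (@linear_id _ B) (zl b), @tswapK k B B).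

Lemma aff_comul_mul : zinbiel_comul_sym -> zinbiel_comul_mul ->
  forall a1 a2, De (mu a1 a2) = ctmap GA GA (fun x => mu x a2) id (De a1) +
    ctmap GA GA id (fun x => mu a1 x) (De a2).
Proof.
move=> h3 h4 a1 a2.
elim/tens_ind: a1 => [d1 b1|x y hx hy]; last first.
  by rewrite (linD (mr_lin _)) (linD De_lin) hx hy cDr lmD' // addrACA.
elim/tens_ind: a2 => [d2 b2|x y hx hy]; last first.
  by rewrite (linD (ml_lin _)) (linD De_lin) hx hy rmD // cDl' addrACA.
apply: (aff_ctens_ext hG om_bil om_nd om_graded).
- exact: De_in.
- by apply: in_ctensD; [apply: rm_in|apply: lm_in'].
move=> i j u v hu hv; rewrite comul_mul_test // mul_comul_test //.
(* Of nu on the two products b1 <> b2, b2 <> b1 and their twists, three are eliminated by the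
   axioms; what remains cancels formally. *)
have e21 : nu (z b2 b1) = tmap id (z b1) (nu b2) + tmap id (z^~ b1) (nu b2) +
    tmap (z b2) id (nu b1) - nu (z b1 b2) by rewrite -h3 addrK.
have s21 : tswap (nu (z b2 b1)) = tmap (z b2) id (tswap (nu b1)) +
    tmap (z^~ b2) id (tswap (nu b1)) + tmap id (z b1) (tswap (nu b2)) -
    tswap (nu (z b1 b2)).
  have := congr1 (@tswap k B B) (h3 b1 b2); rewrite !tswapD !swapE => <-.
  by rewrite addrAC subrr add0r.
have e12 : tswap (nu (z b1 b2)) = tmap (z^~ b2) id (tswap (nu b1)) +
    (tmap id (z b1) (tswap (nu b2)) + tmap id (z b1) (nu b2)) - nu (z b1 b2).
  have := congr1 (@tswap k B B) (h4 b1 b2); rewrite !tswapD !swapE => <-.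
  by rewrite addrK.
set P := om _ _; set Q := om _ (dr _ (dl _ _)); set R := om _ (dl _ _).
rewrite s21 e21 e12.
lin_comb k (tens B B : lmodType k).
Qed.

Let comm a1 a2 := ctmap GA GA (fun x => mu a1 x) id (De a2) -
  ctmap GA GA id (fun x => mu x a1) (De a2).

Let commDl x y a : comm (x + y) a = comm x a + comm y a.
Proof. by rewrite /comm lmD // rmD' // opprD addrACA. Qed.

Let commDr x y a : comm a (x + y) = comm a x + comm a y.
Proof. by rewrite /comm cDl cDr' opprD addrACA. Qed.

Let comm_in a1 a2 : in_ctens GA GA (comm a1 a2).
Proof. by apply: in_ctensB; [apply: lm_in|apply: rm_in']. Qed.

Let ctswap_in (X : ctens A A) : in_ctens GA GA X -> in_ctens GA GA (ctswap X).
Proof.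
move=> hX i j; rewrite /ctswap.
have hS := tsub_subspace (GA i) (GA j).
elim/tsub_ind: (hX j i) => [|a x y hx hy|x y hx hy].
- by rewrite (lin0 (@tswap_linear _ _ _)); exact: hS.1.
- by rewrite tswapD tswapZ; exact: (hS.2 a _ _ hx hy).
- by rewrite tswap_pure; apply: tsub_pure.
Qed.

(** Exchanging d1 with d2 and u with v sends the coefficients (P, Q, R) of [comm_comul_test] to (R -
    Q, -Q, P - Q), by this lemma and the next two. *)
Lemma om_comm_R u v d1 d2 : om d1 (dr v (dr d2 u)) =
  om d2 (dl u (dl d1 v)) - om d2 (dr u (dl d1 v)).
Proof. by rewrite -om_inv.2 om_skew om_inv.1 omBr // opprB. Qed.

Lemma om_comm_M u v d1 d2 : om d1 (dr v (dl d2 u)) = - om d2 (dr u (dl d1 v)).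
Proof. by rewrite -om_inv.2 om_skew om_inv.2. Qed.

Lemma om_comm_L u v d1 d2 : om d1 (dl v (dl d2 u)) =
  om d2 (dr u (dr d1 v)) - om d2 (dr u (dl d1 v)).
Proof.
have := om_inv.1 d1 v (dl d2 u); rewrite omBr // om_comm_M om_skew om_inv.2.
set P := om d2 _; set Q := om d2 _; set R := om d1 _ => e.
have -> : R = - Q - (- Q - R) by ring.
by rewrite -e; ring.
Qed.

Lemma aff_comm_comul : zinbiel_comul_sym -> zinbiel_comul_mul ->
  forall a1 a2, comm a1 a2 = ctswap (ctmap GA GA id (fun x => mu x a2) (De a1) -
    ctmap GA GA (fun x => mu a2 x) id (De a1)).
Proof.
move=> h3 h4 a1 a2.
have -> : ctmap GA GA id (fun x => mu x a2) (De a1) -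
    ctmap GA GA (fun x => mu a2 x) id (De a1) = - comm a2 a1 by rewrite opprB.
have cs (X Y : ctens A A) : ctswap (- (X + Y)) = ctswap (- X) + ctswap (- Y).
  apply/funext => i; apply/funext => j; rewrite opprD.
  exact: tswapD.
elim/tens_ind: a1 => [d1 b1|x y hx hy]; last first.
  by rewrite commDl commDr cs hx hy.
elim/tens_ind: a2 => [d2 b2|x y hx hy]; last first.
  by rewrite commDl commDr cs hx hy.
apply: (aff_ctens_ext hG om_bil om_nd om_graded).
- exact: comm_in.
- by apply: ctswap_in; rewrite -scaleN1r; apply: in_ctensZ.
move=> i j u v hu hv; rewrite comm_comul_test //.
have -> : ctswap (- comm (d2 ⊗ b2) (d1 ⊗ b1)) i j =
    - tswap (comm (d2 ⊗ b2) (d1 ⊗ b1) j i)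
  by apply: (linN (@tswap_linear k _ _) (comm (d2 ⊗ b2) (d1 ⊗ b1) j i)).
rewrite (linN (tmap_linear (phi_lin u) (phi_lin v))).
rewrite -(tswap_tmap _ (phi_lin v) (phi_lin u)).
rewrite comm_comul_test // (om_comm_R u v d1 d2) (om_comm_M u v d1 d2)
  (om_comm_L u v d1 d2).
set P := om _ _; set Q := om _ (dr _ (dl _ _)); set R := om _ (dl _ _).
(* [zinbiel_comul_sym] has the same left side at (b1, b2) and (b2, b1), so its right sides agree;
   [e2] is the twist of this. *)
have e1 : tmap (z b1) id (nu b2) = tmap id (z b1) (nu b2) +
    tmap id (z^~ b1) (nu b2) + tmap (z b2) id (nu b1) -
    (tmap id (z b2) (nu b1) + tmap id (z^~ b2) (nu b1)).
  by apply/eqP; rewrite eq_sym subr_eq -h3 addrC h3 addrC.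
have e2 : tmap id (z b1) (tswap (nu b2)) = tmap (z b1) id (tswap (nu b2)) +
    tmap (z^~ b1) id (tswap (nu b2)) + tmap id (z b2) (tswap (nu b1)) -
    (tmap (z b2) id (tswap (nu b1)) + tmap (z^~ b2) id (tswap (nu b1))).
  by have := congr1 (@tswap k B B) e1; rewrite tswapB !tswapD !swapE.
(* The left side of [zinbiel_comul_mul] is fixed by the twist, hence so is its right side at (b2,
   b1). *)
have e3 : tmap id (z^~ b1) (nu b2) = tmap (z^~ b1) id (tswap (nu b2)) +
    (tmap id (z b2) (tswap (nu b1)) + tmap id (z b2) (nu b1)) -
    (tmap (z b2) id (nu b1) + tmap (z b2) id (tswap (nu b1))).
  apply/eqP; rewrite eq_sym subr_eq -h4; apply/eqP.
  have := congr1 (@tswap k B B) (h4 b2 b1); rewrite !tswapD !swapE => <-.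
  by rewrite addrC.
rewrite e1 e2 e3 !(tswapD, tswapB, tswapZ) !swapE.
lin_comb k (tens B B : lmodType k).
Qed.

(** * Associativity, and recovering the Zinbiel axioms from isolated coefficients *)

Definition zinbiel_rel := forall b1 b2 b3,
  z b1 (z b2 b3) = z (z b1 b2) b3 + z (z b2 b1) b3.

Let muE := aff_mul_pure dl_bil dr_bil z_bil.

Lemma aff_mul_assoc : zinbiel_rel -> associative mu.
Proof.
move=> hz a1 a2 a3.
elim/tens_ind: a1 => [d1 b1|x y hx hy]; last first.
  by rewrite !(linD (mr_lin _)) hx hy.
elim/tens_ind: a2 => [d2 b2|x y hx hy]; last first.
  by rewrite (linD (mr_lin _)) !(linD (ml_lin _)) (linD (mr_lin _)) hx hy.
elim/tens_ind: a3 => [d3 b3|x y hx hy]; last first.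
  by rewrite !(linD (ml_lin _)) hx hy.
rewrite !muE (linD (ml_lin _)) (linD (mr_lin _)) !muE !diE.
(* Every right-bracketed product is expanded into left-bracketed ones, after which both sides agree
   term by term. *)
rewrite (hz b1 b2 b3) (hz b1 b3 b2) (hz b3 b1 b2) (hz b3 b2 b1) !pureDr.
lin_comb k (tens D B : lmodType k).
Qed.

Lemma zinbiel_rel_of_assoc d1 d2 d3 w :
  om (dr d1 (dr d2 d3)) w = 1 -> om (dr d1 (dl d2 d3)) w = 0 ->
  om (dl d1 (dl d2 d3)) w = 0 -> associative mu -> zinbiel_rel.
Proof.
move=> hR hM hL h b1 b2 b3.
have := congr1 (phi w) (h (d1 ⊗ b1) (d2 ⊗ b2) (d3 ⊗ b3)).
rewrite !muE (linD (ml_lin _)) (linD (mr_lin _)) !muE !diE.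
rewrite !(linD (phi_lin _)) !(contract_pure om_bil) hR hM hL.
by rewrite !scale1r !scale0r !addr0.
Qed.

Lemma zinbiel_comul_sym_of a b u v d1 d2 : G a u -> G b v ->
  om d1 (dr d2 (dr u v)) = 1 -> om d1 (dr d2 (dl u v)) = 0 ->
  om d1 (dl d2 (dl u v)) = 0 ->
  (forall a1 a2, De (mu a1 a2) = ctmap GA GA (fun x => mu x a2) id (De a1) +
    ctmap GA GA id (fun x => mu a1 x) (De a2)) -> zinbiel_comul_sym.
Proof.
rewrite -{1}(dual_degK m a) -{1}(dual_degK m b) => hu hv hP hQ hR h b1 b2.
(* The coefficient of P is the axiom with b1 and b2 exchanged, so they enter the tested product in
   that order. *)
have := congr1 (fun X : ctens A A => tmap (phi u) (phi v) (X (a^@) (b^@)))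
  (h (d1 ⊗ b2) (d2 ⊗ b1)).
rewrite comul_mul_test // mul_comul_test // hP hQ hR.
rewrite !subr0 !scale1r !scale0r !addr0 !add0r => e.
rewrite addrC e; lin_comb k (tens B B : lmodType k).
Qed.

Lemma zinbiel_comul_mul_of a b u v d1 d2 : G a u -> G b v ->
  om d1 (dr d2 (dr u v)) = 0 -> om d1 (dr d2 (dl u v)) = 0 ->
  om d1 (dl d2 (dl u v)) = -1 ->
  (forall a1 a2, De (mu a1 a2) = ctmap GA GA (fun x => mu x a2) id (De a1) +
    ctmap GA GA id (fun x => mu a1 x) (De a2)) -> zinbiel_comul_mul.
Proof.
rewrite -{1}(dual_degK m a) -{1}(dual_degK m b) => hu hv hP hQ hR h b1 b2.
have := congr1 (fun X : ctens A A => tmap (phi u) (phi v) (X (a^@) (b^@)))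
  (h (d1 ⊗ b1) (d2 ⊗ b2)).
rewrite comul_mul_test // mul_comul_test // hP hQ hR.
rewrite ?sub0r ?opprK ?scale1r ?scale0r ?addr0 ?add0r => e.
(* R carries a minus sign, hence the value -1; its coefficient is the twisted axiom, and the left
   side is twist-invariant. *)
rewrite -[LHS]tswapK tswapD tswapK addrC e !tswapD !swapE.
lin_comb k (tens B B : lmodType k).
Qed.

End AffineBialgebra.

(** * Zinbiel bialgebras and the Laurent vector fields *)

Lemma zinbiel_bialgebraE (k : fieldType) (B : vectType k) (z : B -> B -> B)
    (nu : B -> tens B B) :
  bilinear_for *:%R *:%R z -> linear nu ->
  zinbiel_bialgebra z nu <->
  [/\ zinbiel_rel z, zinbiel_coassoc nu, zinbiel_comul_sym z nu &
      zinbiel_comul_mul z nu].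
Proof.
move=> hz hnu; have zl y : linear (z^~ y) := hz.1 y.
have zr y : linear (z y) := hz.2 y.
have symE b1 b2 : tmap id (fun x => z b2 x + z x b2) (nu b1) +
    tmap (z b1) id (nu b2) = tmap id (z b2) (nu b1) +
    tmap id (z^~ b2) (nu b1) + tmap (z b1) id (nu b2) by rewrite tmap_addr.
have mulE b1 b2 : tmap id (z^~ b2) (nu b1) +
    tmap (z b1) id (nu b2 + tswap (nu b2)) = tmap id (z^~ b2) (nu b1) +
    (tmap (z b1) id (nu b2) + tmap (z b1) id (tswap (nu b2))).
  by rewrite (linD (tmap_linear (zr b1) (@linear_id _ _))).
have coE b : tmap nu id (nu b) + tmap (@tswap k B B) id (tmap nu id (nu b)) =
    tmap nu id (nu b) + tmap (fun b => tswap (nu b)) id (nu b).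
  by rewrite (tmap_comp _ hnu (@linear_id _ _) (@tswap_linear _ _ _) (@linear_id _ _)).
split=> [[[_ h1] [_ h2] h3 h4]|[h1 h2 h3 h4]]; split.
- exact: h1.
- by move=> b; rewrite h2; apply: coE.
- by move=> b1 b2; rewrite -symE -h3.
- by move=> b1 b2; rewrite -mulE -h4.
- by split.
- by split=> // b; rewrite coE; apply: h2.
- by move=> b1 b2; rewrite /= symE; apply: h3.
- by move=> b1 b2; rewrite /= mulE; apply: h4.
Qed.

Lemma aff_completed_ASI (k : fieldType) (D : lmodType k) (G : int -> set D)
    (dl dr : D -> D -> D) (om : D -> D -> k)
    (B : vectType k) (z : B -> B -> B) (nu : B -> tens B B) :
  quadratic_graded_diassociative G dl dr om -> zinbiel_bialgebra z nu ->
  completed_ASI_bialgebra (aff_grading (B := B) G)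
    (aff_mul dl dr z) (aff_comul G dl dr om nu).
Proof.
case=> [[hdi hG gl gr] ob os on [[m og] oi]] hzb.
have [[hz _] [hnu _] _ _] := hzb.
have [h1 h2 h3 h4] := proj1 (zinbiel_bialgebraE hz hnu) hzb.
have [[dlb drb] _ _ _ _] := hdi.
split.
- split.
  + exact: aff_mul_bilin.
  + exact: (aff_mul_assoc hdi hz h1).
  + exact: aff_graded_space.
  + exact: aff_mul_graded.
- split; first exact: (aff_comul_linear hG ob os on og).
  exact: (aff_comul_in hG ob os on og).
- exact: (aff_coassociative hdi hG gl gr ob os on og hnu h2).
- exact: (aff_comul_mul hdi hG gl gr ob os on og oi).
- exact: (aff_comm_comul hdi hG gl gr ob os on og oi).
Qed.

Lemma zinbiel_of_lvf_ASI (k : fieldType) (B : vectType k) (z : B -> B -> B)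
    (nu : B -> tens B B) :
  bilinear_for *:%R *:%R z -> linear nu ->
  completed_ASI_bialgebra (aff_grading (B := B) (@lvf_grading k))
    (aff_mul (@lvf_dl k) (@lvf_dr k) z)
    (aff_comul (@lvf_grading k) (@lvf_dl k) (@lvf_dr k) (@lvf_om k) nu) ->
  zinbiel_bialgebra z nu.
Proof.
move=> hz hnu [[_ hA _ _] _ hC hM _].
have [[hdi hG gl gr] ob os on [[m og] oi]] := lvf_quadratic_graded_diassociative k.
have hU i n : lvf_grading (lvf_deg (i, n)) (tdel k i n) by apply: lvf_gradingU.
apply/(zinbiel_bialgebraE hz hnu); split.
(* Here d_2 |- d_2 |- d_1 = d_1 pairs to 1 with d_2, while the other two normal forms equal t d_2
   and pair to 0. *)
- apply: (zinbiel_rel_of_assoc hdi ob hz (d1 := tdel k 0 ix2)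
    (d2 := tdel k 0 ix2) (d3 := tdel k 0 ix1) (w := tdel k 0 ix2)) hA;
    by rewrite !(lvf_drU, lvf_dlU) lvf_omU.
(* Here d_1 |- d_1 |- d_2 = t^2 d_2, which the exponent -2 compensates; the other two normal forms
   are t d_1, of the same index as the vector they are paired with. The next axiom uses the same
   product. *)
- apply: (zinbiel_coassoc_of_completed hdi hG gl gr ob os on og hnu
    (hU 0 ix1) (hU 0 ix1) (hU 0 ix2) (d := tdel k (-2) ix1)) hC;
    by rewrite !(lvf_drU, lvf_dlU) lvf_omU.
- apply: (zinbiel_comul_sym_of hdi hG gl gr ob os on og oi hz hnu
    (hU 0 ix1) (hU 0 ix2) (d1 := tdel k (-2) ix1) (d2 := tdel k 0 ix1)) hM;
    by rewrite !(lvf_drU, lvf_dlU) lvf_omU.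
(* Here d_1 -| d_2 -| d_2 = d_1 and om(d_2, d_1) = -1; the other two normal forms are t d_2. *)
- apply: (zinbiel_comul_mul_of hdi hG gl gr ob os on og oi hz hnu
    (hU 0 ix2) (hU 0 ix2) (d1 := tdel k 0 ix2) (d2 := tdel k 0 ix1)) hM;
    by rewrite !(lvf_drU, lvf_dlU) lvf_omU.
Qed.

Theorem mainTheorem2 (k : fieldType) (hk : [pchar k] =i pred0) :
  (forall (D : lmodType k) (G : int -> set D) (dl dr : D -> D -> D)
      (om : D -> D -> k)
      (B : vectType k) (z : B -> B -> B) (nu : B -> tens B B),
    quadratic_graded_diassociative G dl dr om ->
    zinbiel_bialgebra z nu ->
    completed_ASI_bialgebra (aff_grading (B := B) G)
      (aff_mul dl dr z) (aff_comul G dl dr om nu))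
  /\
  (forall (B : vectType k) (z : B -> B -> B) (nu : B -> tens B B),
    bilinear_for *:%R *:%R z -> linear nu ->
    completed_ASI_bialgebra (aff_grading (B := B) (@lvf_grading k))
      (aff_mul (@lvf_dl k) (@lvf_dr k) z)
      (aff_comul (@lvf_grading k) (@lvf_dl k) (@lvf_dr k) (@lvf_om k) nu)
    <-> zinbiel_bialgebra z nu).
Proof.
split=> [D G dl dr om B z nu|B z nu hz hnu]; first exact: aff_completed_ASI.
split; first exact: zinbiel_of_lvf_ASI.
exact: aff_completed_ASI (lvf_quadratic_graded_diassociative k).
Qed.
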